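(* Let $n,m\ge 1$ be integers and let $\Omega\subset\mathbb{R}^n$ be a $C^2$ bounded simply connected domain that is convex in the direction $\mathbf{e}_1=(1,0,\dots,0)$. Let $\lambda_0=\inf_{x\in\Omega}x_1$ and let $\Lambda_0$ be the maximal reflection position in the direction $\mathbf{e}_1$ (defined in the context). For each $1\le i\le m$ let $f^i\in C(\overline{\Omega}\times\mathbb{R}^m\times\mathbb{R}^n,\mathbb{R})$, $(x,\mathbf{z},p)\mapsto f^i(x,\mathbf{z},p)$ with $\mathbf{z}=(z^1,\dots,z^m)$. Assume that for every $1\le i\le m$: (1) there is a constant $c_f>0$ with $f^i(x,\mathbf{z},p)\ge c_f$ for all $(x,\mathbf{z},p)\in\Omega\times\mathbb{R}^m\times\mathbb{R}^n$; (2) $f^i=f^{i,1}+f^{i,2}$, where $f^{i,1}$ is locally uniformly Lipschitz continuous in the component $z^i$ and $f^{i,2}$ is non-increasing in $z^i$, whenever the remaining components $z^j$ ($j\ne i$) and $x,p$ are fixed; (3) for every $j\neq i$, $f^i$ is non-increasing in $z^j$ whenever the remaining components $z^k$ ($k\ne j$) and $x,p$ are fixed; (4) $f^i$ is locally uniformly Lipschitz continuous in the component $p$, whenever $x,\mathbf{z}$ are fixed; (5) $f^i(y_1,x',\mathbf{z},\bar p)\ge f^i(x,\mathbf{z},p)$ for all $\mathbf{z}\in\mathbb{R}^m$, $p\in\mathbb{R}^n$ and $x=(x_1,x')\in\Omega$ such that $p_1\le 0$, $x_1\le 0$, with $x_1\le y_1\le -x_1$, where $\bar p:=(-p_1,p_2,\dots,p_n)$.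 Let $\mathbf{u}=(u^1,\dots,u^m)\in[C^2(\overline{\Omega})]^m$, with each $u^i$ strictly convex, satisfy, for every $1\le i\le m$, $$\det(D^2u^i)=f^i(x,\mathbf{u},\nabla u^i)\quad\text{in }\Omega,$$ together with the boundary conditions $$u^i(y)>u^i(x)\ \text{ for all }x\in\Omega,\ y\in\partial\Omega\text{ with }y_1<x_1,\qquad u^i(y)\ge u^i(x)\ \text{ for all }x,y\in\partial\Omega\text{ with }y_1<x_1.$$ Then for every $i$, $$u^i(x_1,x')\ge u^i(2\Lambda_0-x_1,x')\quad\text{and}\quad\frac{\partial u^i}{\partial x_1}(x)<0\qquad\text{in }\{x\in\Omega: x_1<\Lambda_0\}.$$ Furthermore, if $\frac{\partial u^i}{\partial x_1}(\Lambda_0,x')=0$ for some $x\in\{x_1=\Lambda_0\}$, then such $u^i$ must be symmetric with respect to $\{x_1=\Lambda_0\}$ and strictly decreasing in the $\mathbf{e}_1$ direction for $x_1<\Lambda_0$; more precisely, $$u^i(x)=u^i(|x_1-\Lambda_0|,x')\quad\text{in }\{x\in\Omega:|x_1-\Lambda_0|<\Lambda_0-\lambda_0\}$$ (that is, there $u^i$ depends on $x_1$ only through $|x_1-\Lambda_0|$), and moreover $$\frac{\partial u^i}{\partial x_1}(x)<0\quad\text{in }\{x\in\Omega:x_1<\Lambda_0\}.$$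
   Context: Points are written $x=(x_1,x')$ with $x'=(x_2,\dots,x_n)$. $\Omega$ is convex in direction $\mathbf{e}_1$ if every segment parallel to $\mathbf{e}_1$ with endpoints in $\Omega$ lies in $\Omega$. For $\lambda\in\mathbb{R}$ put $\Sigma_\lambda=\{x\in\Omega: x_1<\lambda\}$, let $x_\lambda=(2\lambda-x_1,x')$ be the reflection of $x$ in $\{x_1=\lambda\}$, and let $\Sigma_\lambda^\lambda=\{x_\lambda: x\in\Sigma_\lambda\}$. Then $\Lambda_0:=\sup\{\lambda>\lambda_0:\Sigma_\lambda^\lambda\subset\Omega\}$. ''Locally uniformly Lipschitz in a variable'' means, as usual, that on every compact subset of $\overline{\Omega}\times\mathbb{R}^m\times\mathbb{R}^n$ the function is Lipschitz in that variable (the others being fixed) with a constant independent of the other variables. $D^2u$ denotes the Hessian matrix of $u$.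
   Formalization: The formal theorem adds the assumption Λ₀ ≤ 0 (placement of the origin presupposed by (5)). Without it the claim fails: n=m=1, Ω=(9,11), f=u'', u strictly convex with minimum at 9.5, u(9)≥u(11), u(9)>u in Ω; (5) is vacuous and u'>0 on (9.5,10). *)

(* Defs.v *)
From mathcomp Require Import all_boot all_order all_algebra.
From mathcomp Require Import all_classical all_reals all_analysis.

Set Implicit Arguments.
Unset Strict Implicit.
Unset Printing Implicit Defensive.

Import Order.TTheory GRing.Theory Num.Theory.
Import numFieldNormedType.Exports.

Local Open Scope classical_set_scope.
Local Open Scope ring_scope.

(* The space of dimension n >= 1 is 'rV[R]_n.+1; the coordinate called x_1 in
   the mathematics is x 0 0. *)

Section Geometry.
Context {R : realType} {n : nat}.
Implicit Types (x p : 'rV[R]_n.+1) (Omega U : set 'rV[R]_n.+1).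

Definition basis_vec (j : 'I_n.+1) : 'rV[R]_n.+1 := delta_mx 0 j.

(* The point (t, x'). *)
Definition set_first (t : R) x : 'rV[R]_n.+1 :=
  \row_j (if j == 0 then t else x 0 j).

Definition reflect_at (lambda : R) x := set_first (2 * lambda - x 0 0) x.

(* (-p_1, p_2, .., p_n) *)
Definition negate_first p := set_first (- p 0 0) p.

Definition boundary Omega := closure Omega `\` Omega°.

Definition partial (j : 'I_n.+1) (u : 'rV[R]_n.+1 -> R) x : R :=
  'D_(basis_vec j) u x.

Definition grad (u : 'rV[R]_n.+1 -> R) x : 'rV[R]_n.+1 :=
  \row_j partial j u x.

Definition hessian (u : 'rV[R]_n.+1 -> R) x : 'M[R]_n.+1 :=
  \matrix_(j, k) partial k (partial j u) x.

(* Meant for U open. *)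
Definition C2_on U (u : 'rV[R]_n.+1 -> R) : Prop :=
  [/\ forall x, U x -> {for x, continuous u},
      forall j x, U x ->
        derivable u x (basis_vec j) /\ {for x, continuous (partial j u)} &
      forall j k x, U x ->
        derivable (partial j u) x (basis_vec k) /\
        {for x, continuous (partial k (partial j u))}].

Definition extends_continuously Omega (g : 'rV[R]_n.+1 -> R) : Prop :=
  exists h : 'rV[R]_n.+1 -> R,
    {within closure Omega, continuous h} /\ forall x, Omega x -> h x = g x.

(* C^2 of the closure of Omega: u is continuous on the closure, C^2 in Omega,
   and its partial derivatives of order 1 and 2 extend continuously to the
   closure. *)
Definition C2_closure Omega (u : 'rV[R]_n.+1 -> R) : Prop :=
  [/\ {within closure Omega, continuous u},
      C2_on Omega u,
      forall j, extends_continuously Omega (partial j u) &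
      forall j k, extends_continuously Omega (partial k (partial j u))].

(* Near each boundary point Omega is a strict sublevel set of a C^2 function
   with nonvanishing gradient. *)
Definition C2_boundary Omega : Prop :=
  forall x0, boundary Omega x0 ->
    exists (U : set 'rV[R]_n.+1) (rho : 'rV[R]_n.+1 -> R),
      [/\ open U, U x0, C2_on U rho,
          forall x, U x -> grad rho x != 0 &
          forall x, U x -> (Omega x <-> rho x < 0)].

Definition path_connected Omega : Prop :=
  forall x y, Omega x -> Omega y ->
    exists gamma : R -> 'rV[R]_n.+1,
      [/\ {within `[0, 1], continuous gamma},
          forall t, t \in `[0, 1] -> Omega (gamma t),
          gamma 0 = x & gamma 1 = y].

(* H (s, t) is the homotopy at time s and path parameter t. *)
Definition null_homotopic Omega (gamma : R -> 'rV[R]_n.+1) : Prop :=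
  exists H : R * R -> 'rV[R]_n.+1,
    [/\ {within `[0, 1] `*` `[0, 1], continuous H},
        forall s t, s \in `[0, 1] -> t \in `[0, 1] -> Omega (H (s, t)),
        forall t, t \in `[0, 1] -> H (0, t) = gamma t,
        forall t, t \in `[0, 1] -> H (1, t) = gamma 0 &
        forall s, s \in `[0, 1] -> H (s, 0) = gamma 0 /\ H (s, 1) = gamma 0].

Definition simply_connected Omega : Prop :=
  path_connected Omega /\
  forall gamma : R -> 'rV[R]_n.+1,
    {within `[0, 1], continuous gamma} ->
    (forall t, t \in `[0, 1] -> Omega (gamma t)) ->
    gamma 0 = gamma 1 ->
    null_homotopic Omega gamma.

Definition domain Omega : Prop :=
  [/\ open Omega, connected Omega & Omega !=set0].

Definition convex_in_e1 Omega : Prop :=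
  forall x (s t : R), 0 <= s <= t ->
    Omega x -> Omega (x + t *: basis_vec 0) -> Omega (x + s *: basis_vec 0).

(* Omega need not be convex, so the inequality is required along the segments
   contained in Omega. *)
Definition strictly_convex_in Omega (u : 'rV[R]_n.+1 -> R) : Prop :=
  forall x y, x != y ->
    (forall t, t \in `[0, 1] -> Omega ((1 - t) *: x + t *: y)) ->
    forall t, t \in `]0, 1[ ->
      u ((1 - t) *: x + t *: y) < (1 - t) * u x + t * u y.

Definition lambda_0 Omega : R := inf [set x 0 0 | x in Omega].

Definition cap Omega (lambda : R) : set 'rV[R]_n.+1 :=
  [set x | Omega x /\ x 0 0 < lambda].

Definition Lambda_0 Omega : R :=
  sup [set lambda | lambda_0 Omega < lambda /\
                    reflect_at lambda @` cap Omega lambda `<=` Omega].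

End Geometry.

Section Nonlinearities.
Context {R : realType} {n m : nat}.
Implicit Types (Omega : set 'rV[R]_n.+1)
  (g : 'rV[R]_n.+1 -> 'rV[R]_m.+1 -> 'rV[R]_n.+1 -> R).

(* The set closure Omega x R^m x R^n on which the nonlinearities live; their
   values elsewhere are irrelevant. *)
Definition phase Omega : set ('rV[R]_n.+1 * 'rV[R]_m.+1 * 'rV[R]_n.+1) :=
  [set w | closure Omega w.1.1].

Definition continuous_nonlinearity Omega g : Prop :=
  {within phase Omega, continuous (fun w => g w.1.1 w.1.2 w.2)}.

Definition agree_off (j : 'I_m.+1) (z z' : 'rV[R]_m.+1) : Prop :=
  forall k, k != j -> z 0 k = z' 0 k.

Definition loc_unif_lipschitz_z Omega (j : 'I_m.+1) g : Prop :=
  forall K : set ('rV[R]_n.+1 * 'rV[R]_m.+1 * 'rV[R]_n.+1),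
    compact K -> K `<=` phase Omega ->
    exists L : R, forall x z z' p, agree_off j z z' ->
      K (x, z, p) -> K (x, z', p) ->
      `|g x z p - g x z' p| <= L * `|z 0 j - z' 0 j|.

(* The norm on row vectors is the sup norm; the notion does not depend on the
   choice of norm. *)
Definition loc_unif_lipschitz_p Omega g : Prop :=
  forall K : set ('rV[R]_n.+1 * 'rV[R]_m.+1 * 'rV[R]_n.+1),
    compact K -> K `<=` phase Omega ->
    exists L : R, forall x z p q,
      K (x, z, p) -> K (x, z, q) ->
      `|g x z p - g x z q| <= L * `|p - q|.

Definition nonincreasing_z Omega (j : 'I_m.+1) g : Prop :=
  forall x z z' p, closure Omega x -> agree_off j z z' -> z 0 j <= z' 0 j ->
    g x z' p <= g x z p.

End Nonlinearities.

(* Main.v *)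
Require Import Defs.
From mathcomp Require Import all_boot all_order all_algebra.
From mathcomp Require Import all_classical all_reals all_analysis.
From mathcomp Require Import ring lra.

(** Moving planes. Write w_l(x) = u(x) - u(x_l) on the cap {x_1 < l}. As det D^2u
    is bounded below and the second derivatives are bounded, u is uniformly
    convex; with the boundary conditions this makes u strictly decreasing, up to
    the boundary, along every e_1-segment issuing from a boundary point left of
    Lambda_0. Hence w_l can only degenerate at interior points, and no narrow
    domain principle is needed (the coupling in z^j is not Lipschitz, so none is
    available). At interior points all w_l^j are nonnegative, so d_1 u < 0 by
    convexity, and the hypotheses on f bound det D^2u(x) - det D^2u(x_l) by
    L (w_l + |D w_l|). An exponential barrier supported in a thin paraboloid along
    a coordinate axis then propagates positivity of w_l along axis-parallel
    segments of the cap (strong maximum principle) and gives d_1 w_l < 0 on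
    {x_1 = l} (Hopf). If d_1 u vanishes at a point of {x_1 = Lambda_0}, the set
    of points near which u is symmetric is nonempty, open and closed in Omega. *)

Set Implicit Arguments.
Unset Strict Implicit.
Unset Printing Implicit Defensive.

Import Order.TTheory GRing.Theory Num.Theory.
Import numFieldNormedType.Exports.

Local Open Scope classical_set_scope.
Local Open Scope ring_scope.

(** * Quadratic forms and determinants *)

Section QuadraticForms.
Context {R : realFieldType}.

(** The determinant is never linearised. Where [w_l] minus the barrier has a negative interior
    minimum, the second-order conditions say that the Hessian of [u] dominates its reflected copy
    plus a rank-one matrix of order [al ^+ 2] minus a multiple of the identity of order [al].
    Monotonicity of the determinant turns this into a lower bound for the difference of
    determinants, whereas the hypotheses on [f] bound it above by terms of order at most [al]; a
    large [al] is contradictory. Paraboloids take the place of the usual annuli because their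
    defining function has a gradient whose axial component is 1 in absolute value: it vanishes
    nowhere, and one comparison serves for both the strong maximum principle and Hopf's lemma. The
    boundary argument needs segments that run beyond the reflected point by [Lambda_0 - l]. Hence
    [w_l > 0] is obtained for [l < Lambda_0] only, and passing to the limit leaves a weak inequality
    at [Lambda_0]; this is where the symmetric alternative comes from. *)

Lemma addmx_coef k l (A B : 'M[R]_(k, l)) i j : (A + B) i j = A i j + B i j.
Proof. by rewrite mxE. Qed.

Lemma scalemx_coef k l (a : R) (A : 'M[R]_(k, l)) i j : (a *: A) i j = a * A i j.
Proof. by rewrite mxE. Qed.

Definition qform n (A : 'M[R]_n) (d : 'rV_n) : R := (d *m A *m d^T) 0 0.

Definition dotp n (x y : 'rV[R]_n) : R := (x *m y^T) 0 0.

Definition posdef n (A : 'M[R]_n) := forall d, d != 0 -> 0 < qform A d.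

Lemma dotpE n (x y : 'rV[R]_n) : dotp x y = \sum_j x 0 j * y 0 j.
Proof. by rewrite /dotp mxE; apply: eq_bigr => j _; rewrite mxE. Qed.

Lemma dotp_ge0 n (x : 'rV[R]_n) : 0 <= dotp x x.
Proof. by rewrite dotpE; apply: sumr_ge0 => j _; rewrite -expr2 sqr_ge0. Qed.

Lemma sqr_coord_le_dotp n (x : 'rV[R]_n) j : x 0 j ^+ 2 <= dotp x x.
Proof.
rewrite dotpE (bigD1 j) //= -expr2 lerDl.
by apply: sumr_ge0 => k _; rewrite -expr2 sqr_ge0.
Qed.

Lemma dotp_gt0 n (x : 'rV[R]_n) : x != 0 -> 0 < dotp x x.
Proof.
move=> x0; rewrite lt_neqAle dotp_ge0 andbT eq_sym; apply: contra x0 => /eqP x0.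
apply/eqP/rowP => j; rewrite mxE; apply/eqP; rewrite -sqrf_eq0.
by apply/eqP/le_anti; rewrite sqr_ge0 andbT -x0 sqr_coord_le_dotp.
Qed.

Lemma qformE n (A : 'M[R]_n) d :
  qform A d = \sum_j \sum_k d 0 j * d 0 k * A j k.
Proof.
rewrite /qform mxE exchange_big /=; apply: eq_bigr => k _.
by rewrite !mxE big_distrl /=; apply: eq_bigr => j _; ring.
Qed.

Lemma qformZ n (A : 'M[R]_n) (s : R) d : qform A (s *: d) = s ^+ 2 * qform A d.
Proof.
rewrite /qform linearZ /= -!scalemxAl -scalemxAr !mxE; ring.
Qed.

Lemma qformDl n (A B : 'M[R]_n) d : qform (A + B) d = qform A d + qform B d.
Proof. by rewrite /qform mulmxDr mulmxDl !mxE. Qed.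

Lemma qformZl n (A : 'M[R]_n) (s : R) d : qform (s *: A) d = s * qform A d.
Proof. by rewrite /qform -scalemxAr -scalemxAl !mxE. Qed.

Lemma qform_outer n (y d : 'rV[R]_n) : qform (y^T *m y) d = dotp y d ^+ 2.
Proof.
rewrite /qform mulmxA -mulmxA mxE big_ord1 expr2 /dotp; congr (_ * _).
by rewrite !mxE; apply: eq_bigr => j _; rewrite !mxE mulrC.
Qed.

Lemma qform1 n (d : 'rV[R]_n) : qform 1%:M d = dotp d d.
Proof. by rewrite /qform mulmx1. Qed.

Lemma qform_delta n (A : 'M[R]_n) k : qform A (delta_mx 0 k) = A k k.
Proof.
rewrite qformE (bigD1 k) //= [X in _ + X]big1 ?addr0; last first.
  by move=> j jk; rewrite big1 // => l _; rewrite !mxE (negbTE jk) !andbF mul0r mul0r.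
rewrite (bigD1 k) //= [X in _ + X]big1 ?addr0 ?mxE ?eqxx ?mulr1 ?mul1r //.
by move=> j jk; rewrite !mxE (negbTE jk) andbF mulr0 mul0r.
Qed.

Definition schur n (A : 'M[R]_(1 + n)) : 'M[R]_n :=
  drsubmx A - (A 0 0)^-1 *: ((ursubmx A)^T *m ursubmx A).

Lemma schur_sym n (A : 'M[R]_(1 + n)) : A^T = A -> (schur A)^T = schur A.
Proof.
move=> As; rewrite /schur linearB /= linearZ /= trmx_mul trmxK; congr (_ - _).
by rewrite -[in LHS]As -trmx_drsub trmxK.
Qed.

Lemma sym_blockE n (A : 'M[R]_(1 + n)) : A^T = A ->
  A = block_mx (A 0 0)%:M (ursubmx A) (ursubmx A)^T (drsubmx A).
Proof.
move=> As; rewrite -[LHS]submxK; congr block_mx.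
  rewrite [LHS]mx11_scalar; congr (_%:M); rewrite !mxE.
  by congr (A _ _); apply/val_inj.
by rewrite -[in LHS]As -trmx_ursub.
Qed.

Lemma det_schur n (A : 'M[R]_(1 + n)) : A^T = A -> A 0 0 != 0 ->
  \det A = A 0 0 * \det (schur A).
Proof.
move=> As a0; set a := A 0 0.
pose E : 'M[R]_(1 + n) := block_mx 1%:M 0 (- a^-1 *: (ursubmx A)^T) 1%:M.
have EA : E *m A = block_mx a%:M (ursubmx A) 0 (schur A).
  rewrite {1}(sym_blockE As) mulmx_block !mul1mx !mul0mx !addr0 -/a.
  rewrite mul_mx_scalar scalerA mulrN mulfV // scaleN1r addNr.
  by rewrite /schur -scalemxAl scaleNr addrC.
have <- : \det (E *m A) = \det A by rewrite det_mulmx det_lblock !det1 !mul1r.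
by rewrite EA det_ublock det_scalar1.
Qed.

Lemma qform_schur n (A : 'M[R]_(1 + n)) (s : R) (x : 'rV_n) :
  A^T = A -> A 0 0 != 0 ->
  qform A (row_mx s%:M x) =
  A 0 0 * (s + (A 0 0)^-1 * dotp (ursubmx A) x) ^+ 2 + qform (schur A) x.
Proof.
move=> As a0; set a := A 0 0; set r := ursubmx A.
have rx : (x *m r^T) 0 0 = dotp r x.
  by rewrite /dotp !mxE; apply: eq_bigr => j _; rewrite !mxE mulrC.
have -> : qform (schur A) x = qform (drsubmx A) x - a^-1 * dotp r x ^+ 2.
  by rewrite /schur qformDl -scaleNr qformZl qform_outer mulNr.
have xr : dotp x r = dotp r x by rewrite !dotpE; apply: eq_bigr => j _; rewrite mulrC.
rewrite /qform {1}(sym_blockE As) mul_row_block tr_row_mx mul_row_col -/a -/r.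
rewrite tr_scalar_mx !mul_scalar_mx !mul_mx_scalar mulmxDl -scalemxAl.
rewrite -/(qform (drsubmx A) x) scalerDr scale_scalar_mx.
rewrite !(addmx_coef, scalemx_coef) rx -/(dotp r x) -/(qform (drsubmx A) x).
by rewrite !mxE eqxx mulr1n; field.
Qed.

(** Induction on the size. Minimising a form over the first coordinate gives the form of the Schur
    complement, so the order passes to Schur complements; the pivots are ordered by testing on the
    first basis vector. *)
Lemma det_le n (A B : 'M[R]_n) : A^T = A -> B^T = B -> posdef B ->
  (forall d, qform B d <= qform A d) -> 0 < \det B <= \det A.
Proof.
elim: n A B => [|n IHn] A B As Bs Bp BA; first by rewrite !det_mx00 ltr01 lexx.
change 'M[R]_(1 + n) in A, B.
have b0 : 0 < B 0 0.
  rewrite -qform_delta Bp //; apply/eqP => /rowP/(_ 0)/eqP.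
  by rewrite !mxE eqxx oner_eq0.
have ba : B 0 0 <= A 0 0 by rewrite -!qform_delta.
have a0 : 0 < A 0 0 := lt_le_trans b0 ba.
have SB x : x != 0 -> 0 < qform (schur B) x.
  move=> x0; have := @Bp (row_mx (- ((B 0 0)^-1 * dotp (ursubmx B) x))%:M x).
  rewrite qform_schur ?gt_eqF // addNr expr0n mulr0 add0r; apply.
  apply: contra x0 => /eqP x0; apply/eqP.
  by rewrite -[x](@row_mxKr _ _ _ _ (- ((B 0 0)^-1 * dotp (ursubmx B) x))%:M) x0 linear0.
have SAB x : qform (schur B) x <= qform (schur A) x.
  (* This vector minimises the form of [A]; for [B] the completed square only adds a nonnegative
     term. *)
  have := BA (row_mx (- ((A 0 0)^-1 * dotp (ursubmx A) x))%:M x).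
  rewrite !qform_schur ?gt_eqF // addNr expr0n mulr0 add0r; apply: le_trans.
  by rewrite lerDr mulr_ge0 ?sqr_ge0 ?ltW.
have /andP[SB0 SBA] := IHn _ _ (schur_sym As) (schur_sym Bs) SB SAB.
rewrite !det_schur ?gt_eqF // mulr_gt0 //=.
by apply: ler_pM => //; exact: ltW.
Qed.

Lemma det_gt0 n (B : 'M[R]_n) : B^T = B -> posdef B -> 0 < \det B.
Proof. by move=> Bs Bp; have /andP[] := det_le Bs Bs Bp (fun=> lexx _). Qed.

Lemma posdef_unitmx n (B : 'M[R]_n) : B^T = B -> posdef B -> B \in unitmx.
Proof. by move=> Bs Bp; rewrite unitmxE unitfE gt_eqF // det_gt0. Qed.

(** The matrix determinant lemma: the bordered matrix [E] is factored in two ways, by eliminating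
    with its corner 1 and with [B]. *)
Lemma det_rank1_update n (B : 'M[R]_n) (y : 'rV_n) (t : R) : B \in unitmx ->
  \det (B + t *: (y^T *m y)) = \det B * (1 + t * qform (invmx B) y).
Proof.
move=> Bu.
pose E : 'M[R]_(1 + n) := block_mx 1%:M (- t *: y) y^T B.
have E1 : \det E = \det (B + t *: (y^T *m y)).
  have -> : E = block_mx 1%:M 0 y^T 1%:M *m
                block_mx 1%:M (- t *: y) 0 (B + t *: (y^T *m y)).
    rewrite mulmx_block !(mul1mx, mul0mx, mulmx1, mulmx0, addr0, add0r).
    by rewrite -scalemxAr [- t *: (_ *m _)]scaleNr addrCA addNr addr0.
  by rewrite det_mulmx det_lblock det_ublock !det1 !mul1r.
rewrite -E1.
have -> : E = block_mx (1 + t * qform (invmx B) y)%:M (- t *: (y *m invmx B)) 0 1%:M *m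
              block_mx 1%:M 0 y^T B.
  rewrite mulmx_block !(mul1mx, mul0mx, mulmx1, mulmx0, addr0, add0r).
  rewrite -!scalemxAl mulmxKV // ; congr block_mx.
  rewrite [X in _ = _ + _ *: X]mx11_scalar -/(qform (invmx B) y).
  by rewrite scale_scalar_mx raddfD /= mulNr raddfN /= addrK.
by rewrite det_mulmx det_ublock det_lblock !det1 !mulr1 mul1r det_scalar1 mulrC.
Qed.

Lemma qform0 n (B : 'M[R]_n) : qform B 0 = 0.
Proof. by rewrite /qform !mul0mx mxE. Qed.

Lemma posdef_qform_ge0 n (B : 'M[R]_n) d : posdef B -> 0 <= qform B d.
Proof. by move=> Bp; have [->|/Bp/ltW//] := eqVneq d 0; rewrite qform0. Qed.

Lemma dotpC n (x y : 'rV[R]_n) : dotp x y = dotp y x.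
Proof. by rewrite !dotpE; apply: eq_bigr => j _; rewrite mulrC. Qed.

Lemma qform_subZ n (B : 'M[R]_n) (s : R) (v x : 'rV_n) : B^T = B ->
  qform B (v - s *: x) = qform B v - 2 * s * dotp (v *m B) x + s ^+ 2 * qform B x.
Proof.
move=> Bs.
have xv : (x *m B *m v^T) 0 0 = dotp (v *m B) x.
  by rewrite dotpC /dotp trmx_mul Bs mulmxA.
rewrite /qform -scaleNr [(_ + _)^T]linearD /= [(_ *: x)^T]linearZ /= !(mulmxDl, mulmxDr).
rewrite -!scalemxAl -!scalemxAr !(addmx_coef, scalemx_coef).
rewrite xv -/(dotp (v *m B) x) -/(qform B v) -/(qform B x); ring.
Qed.

(** Cauchy-Schwarz for the scalar product of [B], applied to [y *m invmx B] and [x]: their product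
    is [dotp y x], and the form of [B] at the former is [qform (invmx B) y]. *)
Lemma sqr_dotp_le_invmx n (B : 'M[R]_n) (x y : 'rV_n) : B^T = B -> posdef B ->
  dotp y x ^+ 2 <= qform (invmx B) y * qform B x.
Proof.
move=> Bs Bp; have Bu := posdef_unitmx Bs Bp.
have [->|x0] := eqVneq x 0.
  by rewrite qform0 mulr0 dotpC /dotp mul0mx mxE expr0n.
have q0 : 0 < qform B x := Bp _ x0.
pose s := dotp y x / qform B x.
have iq : qform B (y *m invmx B) = qform (invmx B) y.
  by rewrite /qform trmx_mul trmx_inv Bs mulmxKV // mulmxA.
have := posdef_qform_ge0 (y *m invmx B - s *: x) Bp.
rewrite qform_subZ // mulmxKV // iq.
have -> : qform (invmx B) y - 2 * s * dotp y x + s ^+ 2 * qform B x =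
          qform (invmx B) y - dotp y x ^+ 2 / qform B x.
  by rewrite /s; field; rewrite gt_eqF.
by rewrite subr_ge0 ler_pdivrMr.
Qed.

Lemma dotp_div_le_invmx n (B : 'M[R]_n) (K : R) (y : 'rV_n) : B^T = B -> posdef B ->
  0 < K -> (forall d, qform B d <= K * dotp d d) ->
  dotp y y / K <= qform (invmx B) y.
Proof.
move=> Bs Bp K0 BK; have [->|y0] := eqVneq y 0.
  by rewrite {1}/dotp mul0mx mxE mul0r qform0.
have yy := dotp_gt0 y0.
have := sqr_dotp_le_invmx y y Bs Bp; rewrite -(ler_pdivrMr _ _ (Bp _ y0)).
apply: le_trans; rewrite ler_pdivlMr ?Bp // mulrAC ler_pdivrMr // expr2 -mulrA.
by rewrite ler_wpM2l ?dotp_ge0 // mulrC.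
Qed.

Lemma scalar_mx_posdef n (K : R) : 0 < K -> posdef (K%:M : 'M[R]_n).
Proof.
by move=> K0 d d0; rewrite -scalemx1 qformZl qform1 mulr_gt0 // dotp_gt0.
Qed.

(* [K |d|^2] dominates the form, so bounding the determinant of the rank-one
   update [B + t d^T d] above by that of [K + t d^T d] bounds [d B^-1 d^T],
   hence bounds [qform B d] below by Cauchy-Schwarz. *)
Lemma qform_lower n (B : 'M[R]_n) (K c : R) d : B^T = B -> posdef B ->
  0 < K -> 0 < c -> (forall d, qform B d <= K * dotp d d) -> c <= \det B ->
  c * K / (2 * K ^+ n) * dotp d d <= qform B d.
Proof.
move=> Bs Bp K0 c0 BK Bc; have [->|d0] := eqVneq d 0.
  by rewrite qform0 /dotp mul0mx mxE mulr0.
have dd := dotp_gt0 d0.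
(* Normalised so that the update of [K%:M] has determinant [2 * K ^+ n]. *)
pose t := K / dotp d d.
have t0 : 0 < t by rewrite divr_gt0.
have outer_sym : (d^T *m d)^T = d^T *m d by rewrite trmx_mul trmxK.
have BtS : (B + t *: (d^T *m d))^T = B + t *: (d^T *m d).
  by rewrite linearD linearZ /= outer_sym Bs.
have BtP : posdef (B + t *: (d^T *m d)).
  move=> e /Bp e0; rewrite qformDl qformZl qform_outer.
  by rewrite ltr_wpDr // mulr_ge0 ?sqr_ge0 // ltW.
have KtS : (K%:M + t *: (d^T *m d))^T = K%:M + t *: (d^T *m d).
  by rewrite linearD linearZ /= outer_sym tr_scalar_mx.
have BKt e : qform (B + t *: (d^T *m d)) e <= qform (K%:M + t *: (d^T *m d)) e.
  by rewrite !qformDl lerD2r -[K%:M]scalemx1 qformZl qform1.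
have /andP[_] := det_le KtS BtS BtP BKt.
have KS : (K%:M : 'M[R]_n)^T = K%:M by rewrite tr_scalar_mx.
rewrite !det_rank1_update ?posdef_unitmx //; last exact: scalar_mx_posdef.
rewrite det_scalar invmx_scalar -scalemx1 qformZl qform1.
have -> : 1 + t * (K^-1 * dotp d d) = 2.
  by rewrite /t; field; rewrite !gt_eqF.
have CS := sqr_dotp_le_invmx d d Bs Bp.
set q := qform B d in CS *; set i := qform (invmx B) d in CS *.
have q0 : 0 < q := Bp _ d0.
have i0 : 0 < i by rewrite -(pmulr_lgt0 _ q0) (lt_le_trans _ CS) // exprn_gt0.
move=> H; have H1 : c * (t * i) <= 2 * K ^+ n.
  rewrite [leRHS]mulrC (le_trans _ H) // mulrDr mulr1 ler_wpDl //.
    by rewrite (le_trans _ Bc) // ltW.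
  by rewrite ler_wpM2r // mulr_ge0 // ltW.
rewrite mulrAC ler_pdivrMr ?mulr_gt0 ?exprn_gt0 //.
have : c * (t * i) * q <= 2 * K ^+ n * q by rewrite ler_wpM2r // ltW.
rewrite [leRHS]mulrC; apply: le_trans.
have -> : c * K * dotp d d = c * t * dotp d d ^+ 2.
  by rewrite /t; field; rewrite gt_eqF.
have -> : c * (t * i) * q = c * t * (i * q) by ring.
by rewrite ler_wpM2l // mulr_ge0 // ltW.
Qed.

Lemma bernoulli_sub (s : R) n : 0 <= s <= 1 -> 1 - n%:R * s <= (1 - s) ^+ n.
Proof.
move=> /andP[s0 s1]; elim: n => [|n IHn]; first by rewrite expr0 mul0r subr0.
rewrite exprSr; apply: (@le_trans _ _ ((1 - n%:R * s) * (1 - s))); last first.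
  by rewrite ler_wpM2r // subr_ge0.
have : 0 <= n%:R * s ^+ 2 by rewrite mulr_ge0 ?ler0n ?sqr_ge0.
rewrite -natr1; nra.
Qed.

(* The loss [s] is absorbed by [B >= mu], at the cost of a factor
   [(1 - s / mu)^n]; the gain is then a rank-one update of [B]. *)
Lemma det_gain n (A B : 'M[R]_n) (mu K s t : R) (y : 'rV_n) :
  A^T = A -> B^T = B -> 0 < mu -> 0 < K -> 0 <= s -> 0 <= t ->
  (forall d, mu * dotp d d <= qform B d <= K * dotp d d) ->
  n%:R * s / mu <= 1 / 2 -> s / mu <= 1 / 2 ->
  (forall d, qform B d - s * dotp d d + t * dotp y d ^+ 2 <= qform A d) ->
  \det B * (1 + t * dotp y y / (2 * K) - n%:R * s / mu) <= \det A.
Proof.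
move=> As Bs mu0 K0 s0 t0 BK sn s1 BA; set r := s / mu.
have r0 : 0 <= r by rewrite divr_ge0 // ltW.
have Bp : posdef B.
  move=> d d0; have /andP[+ _] := BK d; apply: lt_le_trans.
  by rewrite mulr_gt0 ?dotp_gt0.
have r1 : 0 < 1 - r by rewrite /r; lra.
pose C := (1 - r) *: (B + t *: (y^T *m y)).
have BtS : (B + t *: (y^T *m y))^T = B + t *: (y^T *m y).
  by rewrite linearD linearZ /= trmx_mul trmxK Bs.
have Cs : C^T = C by rewrite linearZ /= BtS.
have Cp : posdef C.
  move=> e /Bp e0; rewrite qformZl qformDl qformZl qform_outer mulr_gt0 //.
  by rewrite ltr_wpDr // mulr_ge0 ?sqr_ge0.
have CA d : qform C d <= qform A d.
  apply: le_trans (BA d); rewrite qformZl qformDl qformZl qform_outer.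
  have /andP[h _] := BK d.
  have : s * dotp d d <= r * qform B d.
    by rewrite /r mulrAC ler_pdivlMr // -mulrA ler_wpM2l // mulrC.
  have : 0 <= r * (t * dotp y d ^+ 2) by rewrite mulr_ge0 // mulr_ge0 // sqr_ge0.
  rewrite mulrBl mul1r mulrDr; lra.
have /andP[_] := det_le As Cs Cp CA; apply: le_trans.
rewrite detZ det_rank1_update ?posdef_unitmx // mulrCA.
have detB := det_gt0 Bs Bp; rewrite ler_pM2l //.
have /= i1 : dotp y y / K <= qform (invmx B) y.
  by apply: dotp_div_le_invmx => // d; have /andP[] := BK d.
have rn : 1 - n%:R * r <= (1 - r) ^+ n by apply: bernoulli_sub; apply/andP; split=> //; lra.
have sn' : n%:R * r <= 1 / 2 by rewrite /r mulrA.
have -> : n%:R * s / mu = n%:R * r by rewrite /r mulrA.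
have nr0 : 0 <= n%:R * r by rewrite mulr_ge0 ?ler0n.
have p1 : 1 + t * (dotp y y / K) <= 1 + t * qform (invmx B) y.
  by rewrite lerD2l ler_wpM2l.
have p0 : 0 <= t * (dotp y y / K) by rewrite mulr_ge0 // divr_ge0 // ?dotp_ge0 // ltW.
apply: (@le_trans _ _ ((1 - n%:R * r) * (1 + t * (dotp y y / K)))); last first.
  by apply: ler_pM => //; lra.
(* As [n%:R * r <= 1 / 2], at least half of the gain survives in the product; this is the 2 in
   [2 * K]. *)
have -> : t * dotp y y / (2 * K) = t * (dotp y y / K) / 2 by field; rewrite gt_eqF.
nra.
Qed.
End QuadraticForms.

(** * Calculus in one and several variables *)

Section RowNorm.
Context {R : realType} {n : nat}.
Implicit Types x y : 'rV[R]_n.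

Lemma coord_le_norm x j : `|x 0 j| <= `|x|.
Proof.
rewrite [leRHS]/Num.norm /= mx_normrE.
by apply: (le_bigmax _ (fun ij : 'I_1 * 'I_n => `|x ij.1 ij.2|) (0, j)).
Qed.

Lemma norm_lt_coord x (r : R) : 0 < r -> (forall j, `|x 0 j| < r) -> `|x| < r.
Proof.
move=> r0 xr; rewrite [ltLHS]/Num.norm /= mx_normrE; apply/bigmax_ltP; split => //.
by move=> [i j] _ /=; rewrite ord1.
Qed.

Lemma norm_le_coord x (r : R) : 0 <= r -> (forall j, `|x 0 j| <= r) -> `|x| <= r.
Proof.
move=> r0 xr; rewrite [leLHS]/Num.norm /= mx_normrE; apply/bigmax_leP; split => //.
by move=> [i j] _ /=; rewrite ord1.
Qed.

Lemma norm_delta_mx (j : 'I_n) : `|delta_mx 0 j : 'rV[R]_n| = 1.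
Proof.
apply/le_anti/andP; split.
  apply: norm_le_coord => // k; rewrite mxE eqxx /=.
  by case: (k == j); rewrite ?normr1 ?normr0 ?ler01.
by have := coord_le_norm (delta_mx 0 j) j; rewrite mxE !eqxx normr1.
Qed.

Lemma continuous_at_dist (f : 'rV[R]_n -> R) x (e : R) : {for x, continuous f} ->
  0 < e -> exists2 d, 0 < d & forall y, `|y - x| < d -> `|f y - f x| < e.
Proof.
move=> /cvgrPdist_lt/(_ e) + e0 => /(_ e0) /nbhs_ballP[d /= d0 H].
exists d => // y yx; rewrite distrC; apply: H.
by rewrite -ball_normE /ball_ /= distrC.
Qed.

Lemma open_dist (U : set 'rV[R]_n) x : open U -> U x ->
  exists2 d, 0 < d & forall y, `|y - x| < d -> U y.
Proof.
rewrite openE => oU /oU/nbhs_ballP[d /= d0 H]; exists d => // y yx; apply: H.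
by rewrite -ball_normE /ball_ /= distrC.
Qed.
End RowNorm.

Section OneVariable.
Context {R : realType}.
Implicit Types (f df : R -> R).

Lemma mean_value f df (a b : R) : a <= b ->
  (forall t : R, a <= t <= b -> is_derive t 1 f (df t)) ->
  exists2 c, a <= c <= b & f b - f a = df c * (b - a).
Proof.
move=> ab fd; have [] := @MVT_segment R f df a b ab.
- by move=> t; rewrite in_itv /= => /andP[/ltW ta /ltW tb]; apply: fd; rewrite ta.
- apply: derivable_within_continuous => t; rewrite in_itv /= => tab.
  by have [] := fd _ tab.
- by move=> c; rewrite in_itv /=; exists c.
Qed.

Lemma mean_value0 f df (h : R) :
  (forall t : R, `|t| <= `|h| -> is_derive t 1 f (df t)) ->
  exists2 c, `|c| <= `|h| & f h - f 0 = df c * h.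
Proof.
move=> fd; have [h0|/ltW h0] := leP 0 h.
  have [|c c0h ->] := @mean_value f df 0 h h0.
    by move=> t /andP[t0 th]; apply: fd; rewrite !ger0_norm.
  by exists c; rewrite ?subr0 //; case/andP: c0h => c0 ch; rewrite !ger0_norm.
have [|c c0h E] := @mean_value f df h 0 h0.
  by move=> t /andP[t0 th]; apply: fd; rewrite !ler0_norm ?lerN2.
exists c; first by case/andP: c0h => c0 ch; rewrite !ler0_norm ?lerN2.
by rewrite -opprB E sub0r mulrN opprK.
Qed.

Lemma exists_small (a b : R) : 0 < a -> 0 < b -> exists2 h, 0 < h & (h < a) && (h < b).
Proof.
move=> a0 b0; exists (Num.min a b / 2); first by rewrite divr_gt0 // lt_min a0.
by rewrite -lt_min ltr_pdivrMr // ltr_pMr ?ltr1n // lt_min a0.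
Qed.

Lemma is_derive_dist f (x D e : R) : is_derive x 1 f D -> 0 < e ->
  exists2 d : R, 0 < d & forall h, h != 0 -> `|h| < d ->
    `|h^-1 * (f (x + h) - f x) - D| < e.
Proof.
move=> [fd fE] e0.
have : (fun h => h^-1 *: ((f \o shift x) (h *: (1 : R)) - f x)) @ (0 : R)^' --> D.
  by rewrite -fE.
move=> /cvgrPdist_lt /(_ _ e0); rewrite near_withinE => /nbhs_ballP[d d0 H].
exists d => // h h0 hd; have := H h; rewrite -ball_normE /ball_ /= sub0r normrN.
by rewrite [h *: 1]mulr1 distrC (addrC x) => /(_ hd h0).
Qed.

(** [df] is differentiated at 0 only: if [D < 0], then [df] is negative just to the right of 0, and
    the mean value theorem contradicts the minimum. *)
Lemma local_min_second_derivative f df (r D : R) : 0 < r ->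
  (forall t : R, `|t| < r -> is_derive t 1 f (df t)) -> is_derive (0 : R) 1 df D ->
  (forall t, `|t| < r -> f 0 <= f t) -> df 0 = 0 /\ 0 <= D.
Proof.
move=> r0 fd dfd fmin.
have df0 : df 0 = 0.
  have fd0 : is_derive (0 : R) 1 f (df 0) by apply: fd; rewrite normr0.
  have [] : is_derive (0 : R) 1 f 0.
    apply: (@derive1_at_min _ f (- r) r 0).
    - by lra.
    - by move=> t; rewrite in_itv /= -ltr_norml => /fd[].
    - by rewrite in_itv /= oppr_lt0 r0.
    - by move=> t; rewrite in_itv /= -ltr_norml => /fmin.
  by move=> _ E; have [_ <-] := fd0.
split => //; rewrite leNgt; apply/negP => D0.
have [|d d0 H] := is_derive_dist (e := - D) dfd; first by rewrite oppr_gt0.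
have [h h0 /andP[hd hr]] := exists_small d0 r0.
have neg t : 0 < t <= h -> df t < 0.
  move=> /andP[t0 th]; have := H t (lt0r_neq0 t0).
  rewrite gtr0_norm // df0 subr0 add0r => /(_ (le_lt_trans th hd)) /ltr_normlP[] ? ?.
  have : t^-1 * df t < 0 by lra.
  by rewrite pmulr_rlt0 // invr_gt0.
have [] := @MVT R f df 0 h h0.
- by move=> t; rewrite in_itv /= => /andP[t0 th]; apply: fd; rewrite gtr0_norm //; lra.
- apply: derivable_within_continuous => t; rewrite in_itv /= => /andP[t0 th].
  by have [] : is_derive t 1 f (df t) by apply: fd; rewrite ger0_norm //; lra.
move=> c; rewrite in_itv /= subr0 => /andP[c0 ch] E.
have := fmin h; rewrite gtr0_norm // => /(_ ltac:(lra)).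
have : df c < 0 by apply: neg; rewrite c0 ltW.
rewrite -subr_ge0 E => dc; rewrite pmulr_lge0 //; lra.
Qed.
End OneVariable.

Section SeveralVariables.
Context {R : realType} {n : nat}.
Implicit Types (x y d h : 'rV[R]_n.+1) (U : set 'rV[R]_n.+1)
  (u : 'rV[R]_n.+1 -> R).

Lemma is_derive_line u x v (t : R) : derivable u (x + t *: v) v ->
  is_derive t 1 (fun s : R => u (x + s *: v)) ('D_v u (x + t *: v)).
Proof.
have E : (fun h : R => h^-1 *: (((fun s : R => u (x + s *: v)) \o shift t) (h *: (1 : R))
                             - u (x + t *: v))) =
  (fun h : R => h^-1 *: ((u \o shift (x + t *: v)) (h *: v) - u (x + t *: v))).
  by apply/funext => h /=; rewrite [h *: 1]mulr1 scalerDl addrCA.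
by move=> uv; split; [rewrite /derivable E|rewrite /derive E].
Qed.

Definition trunc k h : 'rV[R]_n.+1 := \row_j (if (j < k)%N then h 0 j else 0).

Lemma trunc0 h : trunc 0 h = 0.
Proof. by apply/rowP => j; rewrite !mxE. Qed.

Lemma trunc_full h : trunc n.+1 h = h.
Proof. by apply/rowP => j; rewrite !mxE ltn_ord. Qed.

Lemma truncS h (k : 'I_n.+1) : trunc k.+1 h = trunc k h + h 0 k *: basis_vec k.
Proof.
apply/rowP => j; rewrite !mxE /= ltnS leq_eqVlt.
have [->|jk] := eqVneq j k; first by rewrite eqxx ltnn mulr1 add0r.
by rewrite (negbTE (jk : (j : nat) != k)) mulr0 addr0.
Qed.

Lemma norm_trunc_le h (k : 'I_n.+1) (t : R) : `|t| <= `|h 0 k| ->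
  `|trunc k h + t *: basis_vec k| <= `|h|.
Proof.
move=> tk; apply: norm_le_coord => // j; rewrite !mxE /=.
have [->|jk] := eqVneq j k.
  by rewrite ltnn mulr1 add0r (le_trans tk) // coord_le_norm.
by rewrite mulr0 addr0; case: ifP => _; rewrite ?normr0 // coord_le_norm.
Qed.


Definition C1_on U u := forall j x, U x ->
  derivable u x (basis_vec j) /\ {for x, continuous (partial j u)}.

(** Derivatives are known along the axes only, so the increment is telescoped through the points
    [x + trunc k h] and each axis-parallel step is treated by the mean value theorem. *)
Lemma C1_first_order U u x (e : R) : open U -> C1_on U u -> U x -> 0 < e ->
  exists2 r, 0 < r & forall h, `|h| < r ->
    `|u (x + h) - u x - \sum_j h 0 j * partial j u x| <= e * \sum_j `|h 0 j|.
Proof.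
move=> oU uC1 Ux e0.
have [r r0 rU] := open_dist oU Ux.
have [d d0 dP] : exists2 d : R, 0 < d & forall j y, `|y - x| < d ->
    `|partial j u y - partial j u x| < e.
  pose P (j : 'I_n.+1) (d : R) : Prop := 0 < d /\ forall y, `|y - x| < d ->
    `|partial j u y - partial j u x| < e.
  have /choice[g gP] j : exists d : R, P j d.
    have [_ cj] := uC1 j x Ux.
    by have [d d0 dP] := continuous_at_dist cj e0; exists d.
  exists (\big[Num.min/1]_j g j).
    by apply/bigmin_gtP; split => // j _; have [] := gP j.
  move=> j y yx; have [_] := gP j; apply; apply: lt_le_trans yx _.
  exact: bigmin_le.
exists (Num.min d r); first by rewrite lt_min d0 r0.
move=> h; rewrite lt_min => /andP[hd hr].
have -> : u (x + h) - u x = \sum_(k < n.+1) (u (x + trunc k.+1 h) - u (x + trunc k h)).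
  rewrite -(big_mkord xpredT (fun k => u (x + trunc k.+1 h) - u (x + trunc k h))).
  by rewrite telescope_sumr // trunc_full trunc0 addr0.
rewrite -sumrB mulr_sumr (le_trans (ler_norm_sum _ _ _)) // ler_sum // => k _.
have [] := @mean_value0 R (fun s => u (x + trunc k h + s *: basis_vec k))
  (fun s => partial k u (x + trunc k h + s *: basis_vec k)) (h 0 k).
  move=> t tk; apply: is_derive_line.
  suff /(uC1 k)[] : U (x + trunc k h + t *: basis_vec k) by [].
  by apply: rU; rewrite -[x + _ + _]addrA [_ - x]addrC addKr (le_lt_trans (norm_trunc_le tk)).
move=> c ck; rewrite /= scale0r addr0 -addrA -truncS => ->.
rewrite mulrC -mulrBr normrM mulrC ler_wpM2r //.
by apply/ltW/dP; rewrite -[x + _ + _]addrA [_ - x]addrC addKr (le_lt_trans (norm_trunc_le ck)).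
Qed.

Lemma C1_directional U u x d : open U -> C1_on U u -> U x ->
  derivable u x d /\ 'D_d u x = dotp d (grad u x).
Proof.
move=> oU uC1 Ux.
suff H : (fun t : R => t^-1 *: ((u \o shift x) (t *: d) - u x)) @ (0 : R)^' -->
    dotp d (grad u x).
  by split; [apply/cvg_ex; exists (dotp d (grad u x))|apply: cvg_lim].
have -> : dotp d (grad u x) = \sum_j d 0 j * partial j u x.
  by rewrite dotpE; apply: eq_bigr => j _; rewrite mxE.
apply/cvgrPdist_le => e e0.
pose S := 1 + \sum_j `|d 0 j|.
have S0 : 0 < S by rewrite ltr_wpDr // sumr_ge0.
have [r r0 rP] := C1_first_order oU uC1 Ux (divr_gt0 e0 S0).
pose D := 1 + `|d|.
have D0 : 0 < D by rewrite ltr_wpDr.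
rewrite near_withinE; apply/nbhs_ballP; exists (r / D); first by rewrite /= divr_gt0.
move=> t; rewrite -ball_normE /ball_ /= sub0r normrN ltr_pdivlMr // => tr t0.
have := rP (t *: d); rewrite normrZ => /(_ _)/wrap[].
  by rewrite (le_lt_trans _ tr) // ler_wpM2l // /D lerDr.
move=> H; rewrite distrC.
have -> : t^-1 *: (u (t *: d + x) - u x) - \sum_j d 0 j * partial j u x =
  t^-1 * (u (x + t *: d) - u x - \sum_j (t *: d) 0 j * partial j u x).
  rewrite mulrBr [t *: d + x]addrC; congr (_ - _).
  rewrite mulr_sumr; apply: eq_bigr => j _; rewrite mxE -mulrA mulKf //.
rewrite normrM normfV ler_pdivrMl ?normr_gt0 // (le_trans H) //.
under eq_bigr do rewrite mxE normrM.
rewrite -mulr_sumr mulrCA ler_wpM2l // -mulrA ger_pMr //.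
by rewrite ler_pdivrMl // mulr1 /S lerDr.
Qed.

Lemma is_derive_C1_line U u x d (t : R) : open U -> C1_on U u -> U (x + t *: d) ->
  is_derive t 1 (fun s : R => u (x + s *: d)) (dotp d (grad u (x + t *: d))).
Proof.
move=> oU uC1 Ux; have [ud <-] := C1_directional d oU uC1 Ux.
exact: is_derive_line.
Qed.

Lemma C2_C1 U u : C2_on U u -> C1_on U u.
Proof. by case. Qed.

Lemma C2_partial_C1 U u j : C2_on U u -> C1_on U (partial j u).
Proof. by case=> _ _ u2 k x Ux; exact: u2. Qed.

Lemma is_derive_grad_line U u x d (t : R) : open U -> C2_on U u -> U (x + t *: d) ->
  is_derive t 1 (fun s : R => dotp d (grad u (x + s *: d)))
    (qform (hessian u (x + t *: d)) d).
Proof.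
move=> oU u2 Ux.
have -> : (fun s : R => dotp d (grad u (x + s *: d))) =
    \sum_j (d 0 j *: (fun s : R => partial j u (x + s *: d))).
  apply/funext => s; rewrite fct_sumE dotpE; apply: eq_bigr => j _.
  by rewrite mxE.
have -> : qform (hessian u (x + t *: d)) d =
    \sum_j (d 0 j *: dotp d (grad (partial j u) (x + t *: d))).
  rewrite qformE; apply: eq_bigr => j _; rewrite dotpE [RHS]mulr_sumr.
  by apply: eq_bigr => k _; rewrite !mxE mulrA.
apply: is_derive_sum => j.
apply: is_deriveZ; exact: is_derive_C1_line (C2_partial_C1 j u2) Ux.
Qed.
End SeveralVariables.

(** * Symmetry and definiteness of Hessians *)

Section SecondOrder.
Context {R : realType} {n : nat}.
Implicit Types (x y d h : 'rV[R]_n.+1) (U : set 'rV[R]_n.+1)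
  (u : 'rV[R]_n.+1 -> R).

Lemma norm_two_steps_le x (j k : 'I_n.+1) (a b s : R) : `|a| <= s -> `|b| <= s ->
  `|x + a *: basis_vec j + b *: basis_vec k - x| <= 2 * s.
Proof.
move=> a_s b_s; rewrite -[x + _ + _]addrA [_ - x]addrC addKr.
rewrite (le_trans (ler_normD _ _)) // !normrZ !norm_delta_mx; lra.
Qed.

Lemma mixed_difference U u x (j k : 'I_n.+1) (r s : R) : open U -> C2_on U u ->
  (forall y, `|y - x| < r -> U y) -> 0 < s -> 2 * s < r ->
  exists2 y, `|y - x| <= 2 * s &
    u (x + s *: basis_vec j + s *: basis_vec k) - u (x + s *: basis_vec j)
    - u (x + s *: basis_vec k) + u x = s ^+ 2 * partial k (partial j u) y.
Proof.
move=> oU u2 rU s0 sr; have uC1 := C2_C1 u2.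
have inU (j' k' : 'I_n.+1) a b : `|a| <= s -> `|b| <= s ->
    U (x + a *: basis_vec j' + b *: basis_vec k').
  by move=> a_s b_s; apply/rU/(le_lt_trans _ sr)/norm_two_steps_le.
have s00 : `|0 : R| <= s by rewrite normr0 ltW.
have ss : `|s| <= s by rewrite gtr0_norm.
pose q a b := partial j u (x + a *: basis_vec j + b *: basis_vec k).
have [] := @mean_value0 R
  (fun a => u (x + s *: basis_vec k + a *: basis_vec j) - u (x + a *: basis_vec j))
  (fun a => q a s - q a 0) s.
  rewrite (gtr0_norm s0) => t ts; apply: is_deriveB.
    have := @is_derive_line R n u (x + s *: basis_vec k) (basis_vec j) t.
    rewrite /q (addrAC x (t *: _)); apply.
    by have [] := uC1 j _ (inU k j s t ss ts).
  rewrite /q scale0r addr0; apply: is_derive_line.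
  have := inU j j t 0 ts s00; rewrite scale0r addr0 => xU.
  by have [] := uC1 j _ xU.
move=> c /[!(gtr0_norm s0)] cs /=; rewrite !scale0r !addr0 => E1.
have [] := @mean_value0 R (q c)
  (fun b => partial k (partial j u) (x + c *: basis_vec j + b *: basis_vec k)) s.
  rewrite (gtr0_norm s0) => t ts; apply: is_derive_line.
  by have [_ _ /(_ j k _ (inU j k c t cs ts))[]] := u2.
move=> b /[!(gtr0_norm s0)] bs E2.
exists (x + c *: basis_vec j + b *: basis_vec k); first exact: norm_two_steps_le.
move: E1; rewrite [X in X * s]E2 (addrAC x (s *: basis_vec k)) => E1.
by apply: etrans (etrans E1 _); ring.
Qed.

(** Schwarz's argument: the second difference with equal steps is unchanged when [j] and [k] are
    exchanged, so the two mixed derivatives take equal values at points [y1] and [y2] arbitrarily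
    close to [x]. *)
Lemma hessian_sym U u x : open U -> C2_on U u -> U x ->
  (hessian u x)^T = hessian u x.
Proof.
move=> oU u2 Ux; apply/matrixP => k j; rewrite !mxE; apply/eqP.
rewrite -subr_eq0 -normr_eq0; apply/eqP/le_anti; rewrite normr_ge0 andbT.
apply/ler_addgt0Pl => e e0; rewrite addr0.
have [r r0 rU] := open_dist oU Ux.
have e2 : 0 < e / 2 by rewrite divr_gt0.
have cont (a b : 'I_n.+1) : {for x, continuous (partial b (partial a u))}.
  by have [_ _ /(_ a b x Ux)[]] := u2.
have [d1 d10 H1] := continuous_at_dist (cont j k) e2.
have [d2 d20 H2] := continuous_at_dist (cont k j) e2.
have [a a0 /andP[ar ad1]] := exists_small r0 d10.
have [b b0 /andP[ba bd2]] := exists_small a0 d20.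
have s0 : 0 < b / 2 by rewrite divr_gt0.
have sr : 2 * (b / 2) < r by lra.
have [y1 y1x E1] := mixed_difference j k oU u2 rU s0 sr.
have [y2 y2x E2] := mixed_difference k j oU u2 rU s0 sr.
have E : partial k (partial j u) y1 = partial j (partial k u) y2.
  have s2 : (b / 2) ^+ 2 != 0 by rewrite lt0r_neq0 // exprn_gt0.
  apply: (mulfI s2); apply: etrans (etrans _ E2); first by rewrite -E1.
  by rewrite (addrAC x); ring.
have b2 : 2 * (b / 2) = b by rewrite mulrC divfK.
rewrite b2 in y1x y2x.
have y1d : `|y1 - x| < d1 := le_lt_trans y1x (lt_trans ba ad1).
have y2d : `|y2 - x| < d2 := le_lt_trans y2x bd2.
move: (H1 _ y1d) (H2 _ y2d); rewrite -E; set A := partial k _ y1 .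
move: A (partial k (partial j u) x) (partial j (partial k u) x) => A P Q h1 h2.
have -> : P - Q = (A - Q) - (A - P) by ring.
apply: le_trans (ler_normB (A - Q) (A - P)) _.
rewrite [e]splitr; exact: lerD (ltW h2) (ltW h1).
Qed.

Lemma line_in_open U x d : open U -> U x ->
  exists2 r : R, 0 < r & forall t : R, `|t| < r -> U (x + t *: d).
Proof.
move=> oU Ux; have [r r0 rU] := open_dist oU Ux.
have D0 : 0 < 1 + `|d| by rewrite ltr_wpDr.
exists (r / (1 + `|d|)); first by rewrite divr_gt0.
move=> t; rewrite ltr_pdivlMr // => tr; apply: rU.
rewrite [_ - x]addrC addKr normrZ (le_lt_trans _ tr) // ler_wpM2l // lerDr //.
Qed.

(** Midpoint convexity makes the symmetrised function [u (x + t *: d) + u (x - t *: d)] minimal at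
    [t = 0], where its second derivative is twice the form. *)
Lemma hessian_psd U u x d : open U -> C2_on U u -> strictly_convex_in U u -> U x ->
  0 <= qform (hessian u x) d.
Proof.
move=> oU u2 ucvx Ux; have uC1 := C2_C1 u2.
have [->|d0] := eqVneq d 0; first by rewrite qform0.
have [r r0 rU] := line_in_open d oU Ux.
have rU' t : `|t| < r -> U (x + t *: - d).
  by move=> tr; rewrite scalerN -scaleNr; apply: rU; rewrite normrN.
pose f (t : R) := u (x + t *: d) + u (x + t *: - d).
pose df (t : R) := dotp d (grad u (x + t *: d)) + dotp (- d) (grad u (x + t *: - d)).
have [] := @local_min_second_derivative R f df r
  (qform (hessian u (x + 0 *: d)) d + qform (hessian u (x + 0 *: - d)) (- d)) r0.
- move=> t tr; apply: is_deriveD; apply: is_derive_C1_line oU uC1 _.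
    exact: rU.
  exact: rU'.
- by apply: is_deriveD; apply: is_derive_grad_line oU u2 _; rewrite scale0r addr0.
- move=> t tr; rewrite /f !scale0r !addr0.
  have [->|t0] := eqVneq t 0; first by rewrite !scale0r !addr0.
  have := @ucvx (x + t *: d) (x + t *: - d).
  have ne : x + t *: d != x + t *: - d.
    rewrite (inj_eq (addrI x)) scalerN -subr_eq0 opprK -mulr2n -scaler_nat.
    by rewrite !scaler_eq0 pnatr_eq0 (negbTE t0) (negbTE d0).
  move=> /(_ ne) H; have {}H := H _ (1 / 2).
  have mid s : (1 - s) *: (x + t *: d) + s *: (x + t *: - d) = x + ((1 - 2 * s) * t) *: d.
    rewrite !scalerDr !scalerN addrACA -scalerDl subrK scale1r; congr (_ + _).
    by rewrite !scalerA -scaleNr -scalerDl; congr (_ *: _); ring.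
  have {}H : u (x + ((1 - 2 * (1 / 2)) * t) *: d) <
      (1 - 1 / 2) * u (x + t *: d) + 1 / 2 * u (x + t *: - d).
    rewrite -mid; apply: H; last by rewrite in_itv /=; lra.
    move=> s; rewrite in_itv /= => /andP[s0 s1]; rewrite mid; apply: rU.
    rewrite normrM (le_lt_trans _ tr) // ger_pMl ?normr_gt0 // ler_norml; lra.
  have E : (1 - 2 * (1 / 2)) * t = 0 :> R by lra.
  rewrite E scale0r addr0 in H; lra.
have qN (A : 'M[R]_n.+1) : qform A (- d) = qform A d.
  by rewrite -scaleN1r qformZ sqrrN expr1n mul1r.
by move=> _; rewrite !scale0r !addr0 qN; lra.
Qed.

(** A null vector [d] of a nonnegative form lies in the kernel: otherwise the form is negative at
    [d - s *: (d *m A)] for small [s]. The choice of [s] makes the quadratic term smaller than half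
    of the linear one. *)
Lemma psd_unit_posdef (A : 'M[R]_n.+1) : A^T = A -> \det A != 0 ->
  (forall d, 0 <= qform A d) -> posdef A.
Proof.
move=> As A0 Ap d d0; rewrite lt_neqAle Ap andbT eq_sym; apply/eqP => Ad.
suff dA0 : d *m A = 0.
  move: d0; apply/negP; rewrite negbK; apply/eqP.
  have <- : d *m A *m invmx A = d by rewrite mulmxK // unitmxE unitfE.
  by rewrite dA0 mul0mx.
apply/eqP/negPn/negP => dA; pose y := d *m A.
have yy : 0 < dotp y y := dotp_gt0 dA.
have yA0 := Ap y.
pose s := dotp y y / (1 + qform A y).
have s0 : 0 < s by rewrite divr_gt0 // ltr_wpDr.
have := Ap (d - s *: y); rewrite qform_subZ // Ad -/y sub0r addrC subr_ge0.
have -> : s ^+ 2 * qform A y = s * (s * qform A y) by ring.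
have -> : 2 * s * dotp y y = s * (2 * dotp y y) by ring.
rewrite ler_pM2l //.
have : s * (1 + qform A y) = dotp y y by rewrite /s mulfVK // gt_eqF // ltr_wpDr.
lra.
Qed.

End SecondOrder.

(** * The domain and its reflections *)

Section Topology.
Context {R : realType} {n : nat}.
Implicit Types (x y : 'rV[R]_n) (A : set 'rV[R]_n).

Lemma closure_distP A x :
  closure A x <-> forall e : R, 0 < e -> exists2 y, A y & `|y - x| < e.
Proof.
split=> [cx e e0|H B /nbhs_ballP[e /= e0 eB]].
  have [|y [Ay]] := cx (ball x e); first exact: nbhsx_ballx.
  by rewrite -ball_normE /ball_ /= distrC; exists y.
have [y Ay yx] := H e e0; exists y; split => //; apply: eB.
by rewrite -ball_normE /ball_ /= distrC.
Qed.

Lemma within_continuous_dist A (f : 'rV[R]_n -> R) x (e : R) :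
  {within A, continuous f} -> A x -> 0 < e ->
  exists2 d : R, 0 < d & forall y, A y -> `|y - x| < d -> `|f y - f x| < e.
Proof.
move=> /subspace_continuousP/(_ x) H Ax e0; have {H} := H Ax.
move=> /cvgrPdist_lt/(_ _ e0); rewrite near_withinE => /nbhs_ballP[d /= d0 H].
exists d => // y Ay yx; rewrite distrC; apply: H => //.
by rewrite -ball_normE /ball_ /= distrC.
Qed.

Lemma bounded_closure A : bounded_set A -> bounded_set (closure A).
Proof.
move=> [M [Mr AM]]; exists (M + 1); split; first by rewrite num_real.
move=> M' MM' x /closure_distP/(_ ((M' - (M + 1)) / 2)) [].
  by rewrite divr_gt0 // subr_gt0.
move=> y Ay yx; have := AM ((M' + M + 1) / 2) ltac:(lra) y Ay.
move=> /= yM; have := ler_normD (x - y) y; rewrite subrK distrC; lra.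
Qed.

Lemma closure_compact A : bounded_set A -> compact (closure A).
Proof.
move=> bA; apply: bounded_closed_compact; first exact: bounded_closure.
exact: closed_closure.
Qed.

Lemma within_bounded A (f : 'rV[R]_n -> R) : compact A ->
  {within A, continuous f} -> exists M : R, forall x, A x -> `|f x| <= M.
Proof.
move=> cA cf; have /compact_bounded[M [Mr H]] := continuous_compact cf cA.
by exists (M + 1) => x Ax; apply: (H (M + 1)); [rewrite ltrDl|exists x].
Qed.

(** Compactness for arguments by contradiction: [P d x] reads as a failure at scale [d] witnessed by
    [x], and [y] is a limit of failures whose scale tends to 0. *)
Lemma bounded_cluster A (P : R -> 'rV[R]_n -> Prop) : bounded_set A ->
  (forall d, 0 < d -> exists2 x, A x & P d x) ->
  (forall d d' x, d <= d' -> P d x -> P d' x) ->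
  exists y, forall d, 0 < d -> exists x, [/\ A x, `|x - y| < d & P d x].
Proof.
move=> bA AP mono.
pose F : set_system 'rV[R]_n := [set S | exists2 d : R, 0 < d &
   [set x | A x /\ P d x] `<=` S].
have FF : ProperFilter F.
  apply: Build_ProperFilter_ex.
    by move=> S [d d0 dS]; have [x Ax Px] := AP d d0; exists x; apply: dS.
  split.
  - by exists 1.
  - move=> S T [d d0 dS] [e e0 eT]; exists (Num.min d e); first by rewrite lt_min d0.
    move=> x [Ax Px]; split; [apply: dS|apply: eT]; split=> //.
      by apply: mono Px; rewrite ge_min lexx.
    by apply: mono Px; rewrite ge_min lexx orbT.
  - by move=> S T ST [d d0 dS]; exists d => // x /dS/ST.
have [|y [_ yc]] := closure_compact bA FF.
  by exists 1 => // x [Ax _]; exact: subset_closure.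
exists y => d d0; have [||x [[Ax Px] xy]] := yc [set x | A x /\ P d x] (ball y d).
- by exists d.
- exact: nbhsx_ballx.
by exists x; split => //; move: xy; rewrite -ball_normE /ball_ /= distrC.
Qed.
End Topology.

Section Geometry.
Context {R : realType} {n : nat}.
Implicit Types (x y d : 'rV[R]_n.+1) (U : set 'rV[R]_n.+1).

Lemma first_coord_add x (t : R) : (x + t *: basis_vec 0) 0 0 = x 0 0 + t.
Proof. by rewrite !mxE !eqxx mulr1. Qed.

Lemma set_firstE (t : R) x : set_first t x = x + (t - x 0 0) *: basis_vec 0.
Proof.
apply/rowP => j; rewrite !mxE eqxx /=; case: eqP => [->|_].
  by rewrite mulr1 subrKC.
by rewrite mulr0 addr0.
Qed.

Lemma reflect_atE (l : R) x :
  reflect_at l x = x + (2 * (l - x 0 0)) *: basis_vec 0.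
Proof. by rewrite /reflect_at set_firstE; congr (_ + _ *: _); ring. Qed.

Lemma first_coord_dist x y : `|x 0 0 - y 0 0| <= `|x - y|.
Proof. by have := coord_le_norm (x - y) 0; rewrite !mxE. Qed.

Lemma segment_e1 U x (s t : R) : convex_in_e1 U -> U x -> U (x + t *: basis_vec 0) ->
  0 <= s <= t -> U (x + s *: basis_vec 0).
Proof. by move=> cU Ux Uxt st; apply: cU st Ux Uxt. Qed.

Lemma lambda_0_lt U x : open U -> bounded_set U -> U x -> lambda_0 U < x 0 0.
Proof.
move=> oU [M [Mr bU]] Ux; have [r r0 rU] := open_dist oU Ux.
pose y := x + (- (r / 2)) *: basis_vec 0.
have Uy : U y.
  apply: rU; rewrite /y [_ - x]addrC addKr normrZ norm_delta_mx mulr1 normrN.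
  by rewrite gtr0_norm ?divr_gt0 // ltr_pdivrMr // ltr_pMr // ltr1n.
have : lambda_0 U <= y 0 0.
  apply: ge_inf; last by exists y.
  exists (- (M + 1)) => _ [z Uz <-].
  have := bU (M + 1) ltac:(by rewrite ltrDl) z Uz.
  by move=> /(le_trans (coord_le_norm z 0)); rewrite ler_norml => /andP[].
have : 0 < r / 2 by rewrite divr_gt0.
rewrite first_coord_add; lra.
Qed.

Lemma exists_near_lambda_0 U (e : R) : U !=set0 -> bounded_set U -> 0 < e ->
  exists2 x, U x & x 0 0 < lambda_0 U + e.
Proof.
move=> U0 [M [Mr bU]] e0.
have hi : has_inf [set x 0 0 | x in U].
  split; first by case: U0 => x Ux; exists (x 0 0); exists x.
  exists (- (M + 1)) => _ [z Uz <-].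
  have := bU (M + 1) ltac:(by rewrite ltrDl) z Uz.
  by move=> /(le_trans (coord_le_norm z 0)); rewrite ler_norml => /andP[].
by have [_ [x Ux <-] xe] := inf_adherent e0 hi; exists x.
Qed.
End Geometry.

(** * Existence of the maximal reflection position and segments up to it *)

Section ReflectionPosition.
Context {R : realType} {n : nat}.
Implicit Types (x y d : 'rV[R]_n.+1).

Lemma derive_ge0_right (g : R -> R) (D r : R) : is_derive (0 : R) 1 g D -> 0 < r ->
  (forall t, 0 < t < r -> g 0 <= g t) -> 0 <= D.
Proof.
move=> gD r0 gmin; rewrite leNgt; apply/negP => D0.
have [|d d0 H] := is_derive_dist (e := - D) gD; first by rewrite oppr_gt0.
have [h h0 /andP[hd hr]] := exists_small d0 r0.
have := H h (lt0r_neq0 h0); rewrite gtr0_norm // add0r => /(_ hd) /ltr_normlP[_ H1].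
have : h^-1 * (g h - g 0) < 0 by lra.
have := gmin h; rewrite h0 hr => /(_ isT) gh.
by rewrite pmulr_rlt0 ?invr_gt0 // subr_lt0 ltNge gh.
Qed.

Context (Omega : set 'rV[R]_n.+1).
Context (oO : open Omega) (bO : bounded_set Omega) (O0 : Omega !=set0).
Context (bdC2 : C2_boundary Omega) (cO : convex_in_e1 Omega).

Lemma boundaryE y : boundary Omega y <-> closure Omega y /\ ~ Omega y.
Proof.
have {1}-> : boundary Omega = closure Omega `\` Omega.
  by rewrite /boundary; congr (_ `\` _); move: oO; rewrite interior_id.
by [].
Qed.

(** Every direction [d] with [d 0 0 <= 0] leads out of [Omega] at a leftmost point, so [rho] has a
    nonnegative derivative along it. Using [d] and [- d] for directions in the hyperplane, the
    gradient has only a first component, which is negative because the gradient does not vanish. *)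
Lemma leftmost_defining_function y : closure Omega y -> y 0 0 = lambda_0 Omega ->
  exists2 r : R, 0 < r & exists rho : 'rV[R]_n.+1 -> R,
    [/\ forall z, `|z - y| < r -> Omega z <-> rho z < 0,
        forall z, `|z - y| < r -> derivable rho z (basis_vec 0) &
        forall z, `|z - y| < r -> partial 0 rho z < 0].
Proof.
move=> cy y0.
have left_out (z : 'rV[R]_n.+1) : z 0 0 <= lambda_0 Omega -> ~ Omega z.
  by move=> zl /(lambda_0_lt oO bO); rewrite ltNge zl.
have ny : ~ Omega y by apply: left_out; rewrite y0.
have [V [rho [oV Vy rC2 rg rO]]] := bdC2 ((boundaryE y).2 (conj cy ny)).
have rC1 := C2_C1 rC2.
have rho0 : rho y = 0.
  apply/le_anti/andP; split; last by rewrite leNgt; apply/negP => /(rO _ Vy).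
  rewrite leNgt; apply/negP => ry.
  have [crho _ _] := rC2.
  have [d d0 H] := continuous_at_dist (crho _ Vy) ry.
  have [e e0 eV] := open_dist oV Vy.
  have [|z Oz zy] := (closure_distP _ _).1 cy (Num.min d e); first by rewrite lt_min d0.
  move: zy; rewrite lt_min => /andP[zd ze].
  have : rho z < 0 by apply/(rO _ (eV _ ze)).
  by have /ltr_normlP[] := H z zd; lra.
have dir (d : 'rV[R]_n.+1) : d 0 0 <= 0 -> 0 <= dotp d (grad rho y).
  move=> dle; have [r r0 rV] := line_in_open d oV Vy.
  have y00 : y + 0 *: d = y by rewrite scale0r addr0.
  have [//|+ E] := @is_derive_C1_line R n V rho y d 0 oV rC1; first by rewrite y00.
  rewrite y00 in E => rd; apply: (@derive_ge0_right _ _ r (DeriveDef rd E) r0).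
  move=> t /andP[t0 tr]; rewrite y00 rho0 leNgt; apply/negP.
  have tV : V (y + t *: d) by apply: rV; rewrite gtr0_norm.
  move=> /(rO _ tV); apply: left_out; rewrite !mxE y0 gerDl pmulr_rle0 //.
have dirB j : dotp (basis_vec j) (grad rho y) = partial j rho y.
  rewrite dotpE (bigD1 j) //= big1 ?addr0; first by rewrite !mxE !eqxx mul1r.
  by move=> k kj; rewrite !mxE eqxx (negbTE kj) mul0r.
have dirN d : dotp (- d) (grad rho y) = - dotp d (grad rho y).
  by rewrite /dotp mulNmx mxE.
have pj j : j != 0 -> partial j rho y = 0.
  move=> j0; apply/le_anti/andP; split.
    by rewrite -oppr_ge0 -dirB -dirN dir // !mxE eqxx [0 == j]eq_sym (negbTE j0) oppr0.
  by rewrite -dirB dir // !mxE eqxx [0 == j]eq_sym (negbTE j0).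
have p0 : partial 0 rho y < 0.
  rewrite lt_neqAle; apply/andP; split; last first.
    by rewrite -oppr_ge0 -dirB -dirN dir // !mxE !eqxx oppr_le0.
  apply: contra (rg _ Vy) => /eqP p0; apply/eqP/rowP => j; rewrite !mxE.
  by have [->//|/pj] := eqVneq j 0.
have [r1 r10 r1V] := open_dist oV Vy.
have [_ cp] := rC1 0 _ Vy.
have [|d d0 H] := continuous_at_dist (e := - partial 0 rho y) cp; first by rewrite oppr_gt0.
have [r r0 /andP[rr rd]] := exists_small r10 d0; exists r => //; exists rho; split.
- by move=> z zr; apply/rO/r1V/(lt_trans zr).
- by move=> z zr; have [] := rC1 0 z (r1V _ (lt_trans zr rr)).
- by move=> z zr; have /ltr_normlP[] := H z (lt_trans zr rd); lra.
Qed.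

(** The regularity of the boundary enters here. If positions close to [lambda_0] failed, the points
    with reflections outside [Omega] would cluster at a leftmost boundary point; there [rho]
    decreases along [e_1], so the short segment from such a point to its reflection remains in
    [Omega]. *)
Lemma exists_reflection_position :
  exists2 l, lambda_0 Omega < l & reflect_at l @` cap Omega l `<=` Omega.
Proof.
apply: contrapT => no.
have [||y yP] := @bounded_cluster R n.+1 Omega (fun (d : R) x => exists l : R,
  [/\ lambda_0 Omega < l < lambda_0 Omega + d, x 0 0 < l &
      ~ Omega (reflect_at l x)]) bO.
- move=> d d0; apply: contrapT => H; apply: no.
  have d2 : 0 < d / 2 by rewrite divr_gt0.
  exists (lambda_0 Omega + d / 2); first by rewrite ltrDl.
  move=> _ [x [Ox xl] <-]; apply: contrapT => nO; apply: H; exists x => //.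
  by exists (lambda_0 Omega + d / 2); split => //; lra.
- move=> d d' x dd' [l [/andP[l1 l2] xl nO]]; exists l; split => //.
  by rewrite l1 (lt_le_trans l2) // lerD2l.
have cy : closure Omega y.
  by apply/closure_distP => e /yP[x [Ox xy _]]; exists x.
have y0 : y 0 0 = lambda_0 Omega.
  apply/eqP; rewrite -subr_eq0 -normr_eq0; apply/eqP/le_anti; rewrite normr_ge0 andbT.
  apply/ler_addgt0Pl => e e0; rewrite addr0.
  have e2 : 0 < e / 2 by rewrite divr_gt0.
  have [x [Ox xy [l [/andP[l1 l2] xl _]]]] := yP _ e2.
  have := le_lt_trans (first_coord_dist x y) xy.
  have := lambda_0_lt oO bO Ox; rewrite ltr_norml ler_norml; lra.
have [r r0 [rho [rO rd rneg]]] := leftmost_defining_function cy y0.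
(* The segment from [x] to its reflection is shorter than [2 * r / 3], hence stays within [r] of
   [y]. *)
have r3 : 0 < r / 3 by rewrite divr_gt0.
have [x [Ox xy [l [/andP[l1 l2] xl nO]]]] := yP _ r3.
have xl0 := lambda_0_lt oO bO Ox.
pose T := 2 * (l - x 0 0).
have inball t : 0 <= t <= T -> `|x + t *: basis_vec 0 - y| < r.
  move=> /andP[t0 tT]; rewrite addrAC (le_lt_trans (ler_normD _ _)) //.
  by rewrite normrZ norm_delta_mx mulr1 ger0_norm //; rewrite /T in tT; lra.
have T0 : 0 < T by rewrite mulr_gt0 // subr_gt0.
have [|c cT E] := @mean_value R (fun t => rho (x + t *: basis_vec 0))
    (fun t => partial 0 rho (x + t *: basis_vec 0)) 0 T (ltW T0).
  by move=> t tT; apply: is_derive_line; apply/rd/inball.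
apply: nO; rewrite reflect_atE -/T; apply/rO.
  by apply: inball; rewrite lexx ltW.
have rx : rho x < 0 by apply/rO => //; rewrite (lt_le_trans xy) //; lra.
have : partial 0 rho (x + c *: basis_vec 0) * (T - 0) < 0.
  by rewrite subr0 pmulr_llt0 // rneg // inball.
by rewrite -E scale0r addr0; lra.
Qed.

Let S := [set l | lambda_0 Omega < l /\ reflect_at l @` cap Omega l `<=` Omega].

(** Makes [Lambda_0] a genuine supremum rather than the default value of [sup]. *)
Lemma has_sup_reflection_positions : has_sup S.
Proof.
split; first by have [l l0 lO] := exists_reflection_position; exists l.
have [M [Mr OM]] := bO; have {OM} OM z : Omega z -> `|z 0 0| <= M + 1.
  by move=> Oz; rewrite (le_trans (coord_le_norm z 0)) // (OM (M + 1)) // ltrDl.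
exists (M + 1) => l [l0 lO].
have [|x Ox] := exists_near_lambda_0 O0 bO (e := l - lambda_0 Omega).
  by rewrite subr_gt0.
rewrite subrKC => xl.
have /OM : Omega (reflect_at l x) by apply: lO; exists x.
by rewrite reflect_atE first_coord_add ler_norml; lra.
Qed.

(** The endpoint, the reflection of [x] in the extremal plane, is included. Openness allows a shift
    of [x] to the left by [r / 2]; reflecting the shifted point at a position within [r / 4] of the
    supremum lands beyond that endpoint, and convexity in [e_1] fills the segment. Hence all
    positions up to [Lambda_0] are admissible. *)
Lemma segment_to_reflection x (s : R) : Omega x -> x 0 0 < Lambda_0 Omega ->
  0 <= s <= 2 * (Lambda_0 Omega - x 0 0) -> Omega (x + s *: basis_vec 0).
Proof.
move=> Ox xL /andP[s0 sL].
have [r r0 rO] := line_in_open (basis_vec 0) oO Ox.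
have r2 : 0 < r / 2 by rewrite divr_gt0.
have r4 : 0 < r / 4 by rewrite divr_gt0.
have [l [l0 lO] lL] := sup_adherent r4 has_sup_reflection_positions.
rewrite -/(Lambda_0 Omega) in lL.
pose x' := x + (- (r / 2)) *: basis_vec 0.
have Ox' : Omega x' by apply: rO; rewrite normrN gtr0_norm //; lra.
have Oz : Omega (reflect_at l x').
  by apply: lO; exists x' => //; split => //; rewrite /x' first_coord_add; lra.
apply: (@segment_e1 _ _ _ x s (2 * (l - x 0 0) + r / 2)) => //; last by apply/andP; lra.
move: Oz; rewrite reflect_atE /x' first_coord_add -addrA -scalerDl.
by congr (Omega (_ + _ *: _)); ring.
Qed.

Lemma reflection_in x (l : R) : l <= Lambda_0 Omega -> Omega x -> x 0 0 < l ->
  Omega (reflect_at l x).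
Proof.
move=> lL Ox xl; rewrite reflect_atE; apply: segment_to_reflection => //; lra.
Qed.
End ReflectionPosition.

(** * Strong convexity and boundary behaviour *)

Section ConvexAlongE1.
Context {R : realType} {n : nat} {Omega : set 'rV[R]_n.+1}.
Context (oO : open Omega) (bO : bounded_set Omega) (O0 : Omega !=set0).
Context (bdC2 : C2_boundary Omega) (cO : convex_in_e1 Omega).
Context (u : 'rV[R]_n.+1 -> R) (u2 : C2_on Omega u) (mu : R) (mu0 : 0 < mu).
Context (u_mu : forall x, Omega x -> mu <= hessian u x 0 0).
Implicit Types (x y : 'rV[R]_n.+1).

Lemma is_derive_e1 x (t : R) : Omega (x + t *: basis_vec 0) ->
  is_derive t 1 (fun s : R => u (x + s *: basis_vec 0))
    (partial 0 u (x + t *: basis_vec 0)).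
Proof.
by move=> Ox; apply: is_derive_line; have [_ /(_ 0 _ Ox)[]] := u2.
Qed.

Lemma is_derive_partial_e1 x (t : R) : Omega (x + t *: basis_vec 0) ->
  is_derive t 1 (fun s : R => partial 0 u (x + s *: basis_vec 0))
    (hessian u (x + t *: basis_vec 0) 0 0).
Proof.
by move=> Ox; rewrite mxE; apply: is_derive_line; have [_ _ /(_ 0 0 _ Ox)[]] := u2.
Qed.

Lemma partial_e1_incr x (a b : R) : a <= b ->
  (forall t, a <= t <= b -> Omega (x + t *: basis_vec 0)) ->
  mu * (b - a) <= partial 0 u (x + b *: basis_vec 0) - partial 0 u (x + a *: basis_vec 0).
Proof.
move=> ab xO.
have [|c cab ->] := @mean_value R (fun t => partial 0 u (x + t *: basis_vec 0))
    (fun t => hessian u (x + t *: basis_vec 0) 0 0) a b ab.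
  by move=> t tab; apply/is_derive_partial_e1/xO.
by rewrite ler_wpM2r ?subr_ge0 //; exact/u_mu/xO.
Qed.

(** Convexity of [t |-> u (x + t *: basis_vec 0) - mu / 2 * t ^+ 2] on the segment, multiplied by
    [l] to avoid divisions. *)
Lemma strong_convexity_e1 x (s l : R) : 0 < l -> 0 <= s <= l ->
  (forall t, 0 <= t <= l -> Omega (x + t *: basis_vec 0)) ->
  l * u (x + s *: basis_vec 0) <=
  (l - s) * u x + s * u (x + l *: basis_vec 0) - mu / 2 * (s * (l - s) * l).
Proof.
move=> l0 /andP[s0 sl] xO.
pose g t := u (x + t *: basis_vec 0) - mu / 2 * (t * t).
pose dg t := partial 0 u (x + t *: basis_vec 0) - mu * t.
have gd t : 0 <= t <= l -> is_derive t 1 g (dg t).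
  move=> tl; apply: is_deriveB; first exact/is_derive_e1/xO.
  apply: is_derive_eq; rewrite /GRing.scale /= !mulr1; lra.
have [c /andP[c0 cs] E1] : exists2 c, 0 <= c <= s & g s - g 0 = dg c * (s - 0).
  by apply: mean_value => // t /andP[t0 ts]; apply: gd; rewrite t0 (le_trans ts).
have [d /andP[sd dl] E2] : exists2 d, s <= d <= l & g l - g s = dg d * (l - s).
  by apply: mean_value => // t /andP[ts tl]; apply: gd; rewrite tl (le_trans s0).
have cd : dg c <= dg d.
  have := @partial_e1_incr x c d (le_trans cs sd).
  have H t : c <= t <= d -> Omega (x + t *: basis_vec 0).
    by move=> /andP[ct td]; apply: xO; rewrite (le_trans c0 ct) (le_trans td dl).
  by move=> /(_ H); rewrite /dg; lra.
have : (l - s) * (g s - g 0) <= s * (g l - g s).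
  rewrite E1 E2 subr0; have : s * (l - s) * dg c <= s * (l - s) * dg d.
    by rewrite ler_wpM2l // mulr_ge0 // subr_ge0.
  lra.
rewrite /g scale0r addr0 mul0r mulr0 subr0.
move: (u (x + s *: _)) (u (x + l *: _)) (u x) => us ul ux H; nra.
Qed.

(** Strong convexity puts the midpoint value strictly below [u x], even if both end values agree. So
    the slope is negative somewhere in the first half, and it increases along the segment. *)
Lemma partial_e1_lt0 x (l : R) : 0 < l ->
  (forall t, 0 <= t <= l -> Omega (x + t *: basis_vec 0)) ->
  u (x + l *: basis_vec 0) <= u x -> partial 0 u x < 0.
Proof.
move=> l0 xO ul.
have l2 : 0 < l / 2 by rewrite divr_gt0.
have l2l : 0 <= l / 2 <= l by apply/andP; split; lra.
have SC := strong_convexity_e1 l0 l2l xO.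
have lt_mid : u (x + (l / 2) *: basis_vec 0) < u x.
  rewrite -(ltr_pM2l l0) (le_lt_trans SC) //.
  have : 0 < mu / 2 * (l / 2 * (l - l / 2) * l).
    by rewrite mulr_gt0 ?divr_gt0 // mulr_gt0 // mulr_gt0 //; lra.
  have : l / 2 * u (x + l *: basis_vec 0) <= l / 2 * u x by rewrite ler_wpM2l // ltW.
  lra.
have [|c /andP[c0 cl] E] := @mean_value R (fun t => u (x + t *: basis_vec 0))
    (fun t => partial 0 u (x + t *: basis_vec 0)) 0 (l / 2) (ltW l2).
  by move=> t /andP[t0 tl]; apply/is_derive_e1/xO; rewrite t0 (le_trans tl) //; lra.
have pc : partial 0 u (x + c *: basis_vec 0) < 0.
  rewrite -(pmulr_llt0 _ l2) -[X in _ * X]subr0 -E scale0r addr0; lra.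
have := @partial_e1_incr x 0 c c0.
have H t : 0 <= t <= c -> Omega (x + t *: basis_vec 0).
  by move=> /andP[t0 tc]; apply: xO; rewrite t0 (le_trans tc) // (le_trans cl) //; lra.
move=> /(_ H); rewrite scale0r addr0 subr0; have : 0 <= mu * c by rewrite mulr_ge0 // ltW.
lra.
Qed.

Context (cu : {within closure Omega, continuous u}).
Context (u_bi : forall x y, Omega x -> boundary Omega y -> y 0 0 < x 0 0 -> u x < u y).
Context (u_bb : forall x y, boundary Omega x -> boundary Omega y ->
  y 0 0 < x 0 0 -> u x <= u y).

Let Lambda := Lambda_0 Omega.

(* Along a segment starting at the boundary point [y] the boundary conditions
   make [u] at most [u y], so strong convexity forces a strict decrease: no
   sequence of points whose reflections have larger values can approach [y]. *)
Lemma no_boundary_cluster y (l : R) : l < Lambda -> ~ Omega y ->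
  (forall d, 0 < d -> exists l' x, [/\ `|l' - l| < d, `|x - y| < d, Omega x,
     x 0 0 < l' & u x <= u (reflect_at l' x)]) -> False.
Proof.
move=> lL nOy H.
have cy : closure Omega y.
  by apply/closure_distP => e /H[l' [x [_ xy Ox _ _]]]; exists x.
have by_ : boundary Omega y by apply/boundaryE.
pose tau := 2 * (l - y 0 0).
have tau0 : 0 <= tau.
  rewrite /tau mulr_ge0 // subr_ge0; apply/ler_addgt0Pl => e e0.
  have e2 : 0 < e / 2 by rewrite divr_gt0.
  have [l' [x [l'l xy Ox xl' _]]] := H _ e2.
  have := le_lt_trans (first_coord_dist x y) xy.
  by move: l'l; rewrite !ltr_norml; lra.
(* [tau] is the limiting distance between [x] and its reflection and may be 0; the excess
   [Lambda - l] keeps the segment from degenerating. *)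
pose k := tau + (Lambda - l).
have ktau : tau < k by rewrite /k; lra.
have k0 : 0 < k by lra.
have inO x t : `|x - y| < (Lambda - l) / 4 -> Omega x -> 0 <= t <= k ->
    Omega (x + t *: basis_vec 0).
  move=> xy Ox /andP[t0 tk]; have := le_lt_trans (first_coord_dist x y) xy.
  rewrite ltr_norml => /andP[x1 x2].
  apply: (segment_to_reflection oO bO O0 bdC2 cO) => //;
    rewrite -/Lambda; rewrite /k /tau in tk tau0; lra.
have d4 : 0 < (Lambda - l) / 4 by rewrite divr_gt0 // subr_gt0.
pose y' := y + k *: basis_vec 0.
have cy' : closure Omega y'.
  apply/closure_distP => e e0; have [d d0 /andP[de d4']] := exists_small e0 d4.
  have [l' [x [_ xy Ox _ _]]] := H _ d0; exists (x + k *: basis_vec 0).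
    by apply: inO => //; rewrite ?lexx ?ltW // (lt_trans xy).
  by rewrite /y' [y + _]addrC addrKA (lt_trans xy).
have uy' : u y' <= u y.
  have yy' : y 0 0 < y' 0 0 by rewrite first_coord_add ltrDl.
  have [Oy'|nOy'] := pselect (Omega y'); first exact/ltW/u_bi.
  by apply: u_bb => //; apply/boundaryE.
pose K := mu / 2 * (k * (k - tau)).
have K0 : 0 < K by rewrite mulr_gt0 ?divr_gt0 // mulr_gt0 // subr_gt0.
have K8 : 0 < K / 8 by rewrite divr_gt0.
have [d1 d10 H1] := within_continuous_dist cu cy K8.
have [d2 d20 H2] := within_continuous_dist cu cy' K8.
have kt8 : 0 < (k - tau) / 8 by rewrite divr_gt0 // subr_gt0.
have [a a0 /andP[ad1 ad2]] := exists_small d10 d20.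
have [b b0 /andP[bk b4]] := exists_small kt8 d4.
have [d d0 /andP[da db]] := exists_small a0 b0.
have [l' [x [l'l xy Ox xl' ux]]] := H _ d0.
have xy4 := lt_trans xy (lt_trans db b4).
have segO t := inO x t xy4 Ox.
have Ox' : Omega (x + k *: basis_vec 0) by apply: segO; rewrite lexx ltW.
have /ltr_normlP[h1 h1'] : `|u x - u y| < K / 8.
  by apply: H1; [exact: subset_closure|rewrite (lt_trans xy) // (lt_trans da)].
have /ltr_normlP[h2 h2'] : `|u (x + k *: basis_vec 0) - u y'| < K / 8.
  apply: H2; first exact: subset_closure.
  by rewrite /y' [y + _]addrC addrKA (lt_trans xy) // (lt_trans da).
pose s := 2 * (l' - x 0 0).
have s0 : 0 < s by rewrite mulr_gt0 // subr_gt0.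
have stau : s <= tau + (k - tau) / 2.
  have : d < (k - tau) / 8 := lt_trans db bk.
  have : s <= tau + 4 * d.
    have := le_lt_trans (first_coord_dist x y) xy.
    by move: l'l; rewrite !ltr_norml /s /tau; lra.
  lra.
have sk : 0 <= s <= k by apply/andP; split; lra.
have := strong_convexity_e1 k0 sk segO.
rewrite reflect_atE -/s in ux.
move: (u (x + s *: _)) (u (x + k *: _)) (u x) (u y) (u y') ux h1 h1' h2 h2' uy'
  => us uk ux uy uy' uxs h1 h1' h2 h2' uyy' SC.
(* The factor [s] cancels, so it may tend to 0. What remains bounds [uk - ux] below by [K / 2],
   while continuity and [u y' <= u y] bound it above by [K / 4]. *)
have SC' : s * (mu / 2 * (k * (k - s))) <= s * (uk - ux).
  have : k * ux <= k * us by rewrite ler_wpM2l // ltW.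
  lra.
have {}SC' : mu / 2 * (k * (k - s)) <= uk - ux by rewrite -(ler_pM2l s0).
have : K / 2 <= mu / 2 * (k * (k - s)).
  have -> : K / 2 = mu / 2 * (k * ((k - tau) / 2)) by rewrite /K; ring.
  have mu2 : 0 < mu / 2 by rewrite divr_gt0.
  rewrite (ler_pM2l mu2) (ler_pM2l k0); lra.
lra.
Qed.
End ConvexAlongE1.

(** * Uniform bounds *)

Section Bounds.
Context {R : realType} {n : nat}.
Implicit Types (x y : 'rV[R]_n.+1).
Context (Omega : set 'rV[R]_n.+1) (oO : open Omega) (bO : bounded_set Omega).

Lemma extends_bounded (g : 'rV[R]_n.+1 -> R) : extends_continuously Omega g ->
  exists M : R, forall x, Omega x -> `|g x| <= M.
Proof.
move=> [h [ch hg]]; have [M hM] := within_bounded (closure_compact bO) ch.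
by exists M => x Ox; rewrite -hg // hM //; exact: subset_closure.
Qed.

Lemma finite_bound (I : finType) (g : I -> 'rV[R]_n.+1 -> R) :
  (forall i, exists M : R, forall x, Omega x -> `|g i x| <= M) ->
  exists M : R, forall i x, Omega x -> `|g i x| <= M.
Proof.
move=> /choice[M gM]; exists (\big[Num.max/0]_i M i) => i x Ox.
by apply: le_trans (gM i x Ox) _; exact: le_bigmax.
Qed.

Lemma C2_closure_bounded (u : 'rV[R]_n.+1 -> R) : C2_closure Omega u ->
  exists2 M : R, 0 < M & forall x, Omega x ->
    [/\ `|u x| <= M, `|grad u x| <= M & forall j k, `|hessian u x j k| <= M].
Proof.
move=> [cu _ u1 u2].
have [M0 H0] := within_bounded (closure_compact bO) cu.
have [M1 H1] := @finite_bound _ (fun j x => partial j u x)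
  (fun j => extends_bounded (u1 j)).
have [M2 H2] := @finite_bound _ (fun jk x => partial jk.2 (partial jk.1 u) x)
  (fun jk => extends_bounded (u2 jk.1 jk.2)).
have le1 : M0 <= Num.max 1 (Num.max M0 (Num.max M1 M2)) by rewrite !le_max lexx !orbT.
have le2 : M1 <= Num.max 1 (Num.max M0 (Num.max M1 M2)) by rewrite !le_max lexx !orbT.
have le3 : M2 <= Num.max 1 (Num.max M0 (Num.max M1 M2)) by rewrite !le_max lexx !orbT.
have gt0 : 0 < Num.max 1 (Num.max M0 (Num.max M1 M2)) by rewrite lt_max ltr01.
exists (Num.max 1 (Num.max M0 (Num.max M1 M2))) => // x Ox; split.
- by rewrite (le_trans _ le1) // H0 //; exact: subset_closure.
- apply: norm_le_coord; first exact: ltW.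
  by move=> j; rewrite mxE (le_trans _ le2) // H1.
- by move=> j k; rewrite mxE (le_trans _ le3) // (H2 (j, k)).
Qed.

Lemma qform_le_entries (A : 'M[R]_n.+1) (M : R) d : (forall j k, `|A j k| <= M) ->
  qform A d <= M * n.+1%:R * dotp d d.
Proof.
move=> AM; rewrite qformE.
have M0 : 0 <= M by rewrite (le_trans _ (AM 0 0)).
apply: (@le_trans _ _ (\sum_j \sum_k M / 2 * (d 0 j ^+ 2 + d 0 k ^+ 2))).
  apply: ler_sum => j _; apply: ler_sum => k _.
  apply: (le_trans (ler_norm _)); rewrite normrM normrM.
  apply: (@le_trans _ _ (`|d 0 j| * `|d 0 k| * M)); first by rewrite ler_wpM2l.
  rewrite -(real_normK (num_real (d 0 j))) -(real_normK (num_real (d 0 k))).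
  have : 0 <= M * (`|d 0 j| - `|d 0 k|) ^+ 2 by rewrite mulr_ge0 ?sqr_ge0.
  lra.
have -> : dotp d d = \sum_j d 0 j ^+ 2.
  by rewrite dotpE; apply: eq_bigr => j _; rewrite expr2.
set S := \sum_j d 0 j ^+ 2.
under eq_bigr => j _ do rewrite -mulr_sumr big_split /= sumr_const card_ord -/S.
rewrite -mulr_sumr big_split /= sumr_const card_ord sumrMnl -/S.
by rewrite -[S *+ _]mulr_natr; lra.
Qed.

Lemma hessian_elliptic (u : 'rV[R]_n.+1 -> R) (c : R) : C2_closure Omega u ->
  strictly_convex_in Omega u -> 0 < c ->
  (forall x, Omega x -> c <= \det (hessian u x)) ->
  exists mu K : R, [/\ 0 < mu, 0 < K & forall x d, Omega x ->
    mu * dotp d d <= qform (hessian u x) d <= K * dotp d d].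
Proof.
move=> uC ucvx c0 cdet; have [_ u2 _ _] := uC.
have [M M0 H] := C2_closure_bounded uC.
pose K := M * n.+1%:R; have K0 : 0 < K by rewrite mulr_gt0.
exists (c * K / (2 * K ^+ n.+1)), K; split => //.
  by rewrite divr_gt0 ?mulr_gt0 ?exprn_gt0.
move=> x d Ox; have [_ _ HM] := H x Ox.
have up e : qform (hessian u x) e <= K * dotp e e by apply: qform_le_entries.
rewrite up andbT; have sym := hessian_sym oO u2 Ox.
apply: qform_lower => //; last exact: cdet.
apply: psd_unit_posdef => //; first by rewrite gt_eqF // (lt_le_trans c0) // cdet.
by move=> e; apply: hessian_psd oO u2 ucvx Ox.
Qed.
End Bounds.

(** * One-sided Lipschitz bound for the right-hand sides *)

Section Nonlinearity.
Context {R : realType} {n m : nat}.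
Context (Omega : set 'rV[R]_n.+1) (bO : bounded_set Omega).
Implicit Types (g : 'rV[R]_n.+1 -> 'rV[R]_m.+1 -> 'rV[R]_n.+1 -> R).

(** Monotonicity is given in each component separately, so [z] is turned into [z'] one component at
    a time. *)
Lemma nonincreasing_off g (i : 'I_m.+1) x (z z' : 'rV[R]_m.+1) p :
  (forall j, j != i -> nonincreasing_z Omega j g) -> closure Omega x ->
  z 0 i = z' 0 i -> (forall j, z' 0 j <= z 0 j) -> g x z p <= g x z' p.
Proof.
move=> gn cx zi zz.
pose mix k : 'rV[R]_m.+1 := \row_j (if (j < k)%N then z' 0 j else z 0 j).
suff H k : (k <= m.+1)%N -> g x z p <= g x (mix k) p.
  have -> : z' = mix m.+1 by apply/rowP => j; rewrite mxE ltn_ord.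
  exact: H.
elim: k => [_|k IHk km].
  by have -> : mix 0%N = z by apply/rowP => j; rewrite mxE.
apply: le_trans (IHk (ltnW km)) _.
have [ki|ki] := eqVneq (Ordinal km) i.
  suff -> : mix k.+1 = mix k by [].
  apply/rowP => j; rewrite !mxE ltnS leq_eqVlt; case: eqP => //= jk.
  by rewrite -jk ltnn; have -> : j = i by rewrite -ki; apply/val_inj.
apply: gn ki _ _ _ _ cx _ _.
  move=> j jk; rewrite !mxE ltnS leq_eqVlt.
  by have /negbTE -> : (j : nat) != k by apply: contra jk => /eqP jk; apply/eqP/val_inj.
by rewrite !mxE /= ltnSn ltnn.
Qed.

(** The bound is one-sided. Through the intermediate vector [y], lowering the components other than
    [i] can only raise [g]; lowering component [i] raises [f2] and changes [f1] by at most [L] times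
    the step. Local constants suffice because all arguments stay in the compact set [K]. *)
Lemma rhs_lipschitz g (i : 'I_m.+1) (M : R) : 0 < M ->
  (exists f1 f2 : 'rV[R]_n.+1 -> 'rV[R]_m.+1 -> 'rV[R]_n.+1 -> R,
       [/\ forall (x : 'rV[R]_n.+1) (z : 'rV[R]_m.+1) (p : 'rV[R]_n.+1),
             closure Omega x -> g x z p = f1 x z p + f2 x z p,
           loc_unif_lipschitz_z Omega i f1 &
           nonincreasing_z Omega i f2]) ->
  (forall j, j != i -> nonincreasing_z Omega j g) ->
  loc_unif_lipschitz_p Omega g ->
  exists2 L : R, 0 <= L & forall x (z z' : 'rV[R]_m.+1) p p', Omega x ->
    `|z| <= M -> `|z'| <= M -> `|p| <= M -> `|p'| <= M ->
    (forall j, z' 0 j <= z 0 j) ->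
    g x z p - g x z' p' <= L * (z 0 i - z' 0 i) + L * `|p - p'|.
Proof.
move=> M0 [f1 [f2 [gE f1L f2n]]] gn gp.
pose K : set ('rV[R]_n.+1 * 'rV[R]_m.+1 * 'rV[R]_n.+1) :=
  (closure Omega `*` [set z | `|z| <= M]) `*` [set p | `|p| <= M].
have cball k : compact [set z : 'rV[R]_k | `|z| <= M].
  apply: bounded_closed_compact.
    by exists M; split => [|M' MM' z /= zM]; rewrite ?num_real // (le_trans zM) // ltW.
  have -> : [set z : 'rV[R]_k | `|z| <= M] = (fun z => `|z|) @^-1` [set t | t <= M] by [].
  by apply: closed_comp => [z _|]; [exact: norm_continuous|exact: closed_le].
have cK : compact K by apply: compact_setX => //; apply: compact_setX => //; exact: closure_compact.
have Kph : K `<=` phase Omega by move=> w [[+ _] _].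
have [L1 H1] := f1L K cK Kph; have [L2 H2] := gp K cK Kph.
pose L := Num.max 0 (Num.max L1 L2).
have L0 : 0 <= L by rewrite le_max lexx.
have L1L : L1 <= L by rewrite !le_max lexx !orbT.
have L2L : L2 <= L by rewrite !le_max lexx !orbT.
exists L => // x z z' p p' Ox zM zM' pM pM' zz.
have cx : closure Omega x by exact: subset_closure.
pose y : 'rV[R]_m.+1 := \row_j (if j == i then z 0 i else z' 0 j).
have yM : `|y| <= M.
  apply: norm_le_coord; first exact: ltW.
  move=> j; rewrite mxE; case: eqP => _; rewrite (le_trans (coord_le_norm _ _)) //.
have yi : y 0 i = z 0 i by rewrite mxE eqxx.
have s1 : g x z p <= g x y p.
  apply: (nonincreasing_off (i := i)) => // j; rewrite mxE; case: eqP => [->|_] //.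
have s2 : g x y p - g x z' p <= L * (z 0 i - z' 0 i).
  have ag : agree_off i y z' by move=> j ji; rewrite mxE (negbTE ji).
  have ag' : agree_off i z' y by move=> j ji; rewrite ag.
  have h1 := H1 x y z' p ag; rewrite yi in h1.
  have {}h1 : `|f1 x y p - f1 x z' p| <= L * (z 0 i - z' 0 i).
    apply: le_trans (h1 _ _) _ => //.
    by rewrite ger0_norm ?subr_ge0 // ler_wpM2r // subr_ge0.
  have h2 : f2 x y p <= f2 x z' p by apply: f2n ag' _ => //; rewrite yi.
  rewrite !gE //; have := ler_norm (f1 x y p - f1 x z' p); lra.
have s3 : g x z' p - g x z' p' <= L * `|p - p'|.
  apply: le_trans (ler_norm _) _; apply: le_trans (H2 x z' p p' _ _) _ => //.
  by rewrite ler_wpM2r.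
lra.
Qed.
End Nonlinearity.

(** * Comparison with an exponential barrier *)

Section Barrier.
Context {R : realType} {n : nat}.
Implicit Types (x y z d : 'rV[R]_n.+1).

Definition drop_coord (k : 'I_n.+1) d : 'rV[R]_n.+1 :=
  \row_j (if j == k then 0 else d 0 j).

Lemma dotp_drop_le k d : dotp (drop_coord k d) (drop_coord k d) <= dotp d d.
Proof.
rewrite !dotpE; apply: ler_sum => j _; rewrite mxE; case: eqP => // _.
by rewrite mulr0 -expr2 sqr_ge0.
Qed.

Lemma drop_coordD k x d : drop_coord k (x + d) = drop_coord k x + drop_coord k d.
Proof. by apply/rowP => j; rewrite !mxE; case: eqP; rewrite ?addr0. Qed.

Lemma drop_coordZ k (t : R) d : drop_coord k (t *: d) = t *: drop_coord k d.
Proof. by apply/rowP => j; rewrite !mxE; case: eqP; rewrite ?mulr0. Qed.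

Lemma dotpDl x y z : dotp (x + y) z = dotp x z + dotp y z.
Proof. by rewrite /dotp mulmxDl mxE. Qed.

Lemma dotpZl (t : R) x y : dotp (t *: x) y = t * dotp x y.
Proof. by rewrite /dotp -scalemxAl mxE. Qed.

Lemma dotp_basis k x : dotp (basis_vec k) x = x 0 k.
Proof.
rewrite dotpE (bigD1 k) //= big1 ?addr0; first by rewrite !mxE !eqxx mul1r.
by move=> j jk; rewrite !mxE eqxx (negbTE jk) mul0r.
Qed.

Lemma dotp_drop k x d : dotp (drop_coord k x) (drop_coord k d) = dotp (drop_coord k x) d.
Proof.
by rewrite !dotpE; apply: eq_bigr => j _; rewrite !mxE; case: eqP => _; rewrite ?mul0r.
Qed.

(* [paraboloid sg k z ell kap] is positive exactly inside the paraboloid with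
   axis [sg * e_k], apex [z + ell * sg * e_k] and opening controlled by [kap]. *)
Definition paraboloid (sg : R) k z (ell kap : R) x : R :=
  ell - sg * (x - z) 0 k - kap * dotp (drop_coord k (x - z)) (drop_coord k (x - z)).

Definition paraboloid_grad (sg : R) k z (kap : R) x : 'rV[R]_n.+1 :=
  (- sg) *: basis_vec k + (- (2 * kap)) *: drop_coord k (x - z).

(** The expansion is exact, so on each line the barrier is the exponential of a quadratic
    polynomial. *)
Lemma paraboloid_line sg k z ell kap x d (t : R) :
  paraboloid sg k z ell kap (x + t *: d) =
  paraboloid sg k z ell kap x + t * dotp (paraboloid_grad sg k z kap x) d
  - kap * dotp (drop_coord k d) (drop_coord k d) * t ^+ 2.
Proof.
rewrite /paraboloid /paraboloid_grad [x + _ - z]addrAC (drop_coordD k (x - z)) drop_coordZ.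
have -> : ((x - z) + t *: d) 0 k = (x - z) 0 k + t * d 0 k by rewrite !mxE.
set a := drop_coord k (x - z); set b := drop_coord k d.
rewrite [dotp (- sg *: _ + _) _]dotpDl !dotpZl dotp_basis.
rewrite -[dotp a d]dotp_drop -/b dotpDl [dotp a (a + _)]dotpC [dotp (t *: b) _]dotpC.
rewrite !dotpDl !dotpZl [dotp b (t *: b)]dotpC dotpZl [dotp a (t *: b)]dotpC dotpZl.
rewrite [dotp b a]dotpC.
ring.
Qed.

(** The axial component alone contributes 1. This uniform lower bound is what makes the [al ^+ 2]
    term of the barrier effective everywhere. *)
Lemma paraboloid_grad_sqr sg k z kap x : sg ^+ 2 = 1 ->
  1 <= dotp (paraboloid_grad sg k z kap x) (paraboloid_grad sg k z kap x).
Proof.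
move=> sg1; have := sqr_coord_le_dotp (paraboloid_grad sg k z kap x) k.
by rewrite !mxE !eqxx mulr0 addr0 mulr1 sqrrN sg1.
Qed.

Lemma paraboloid_grad_coord sg k z kap x j : sg ^+ 2 = 1 -> 0 <= kap ->
  `|paraboloid_grad sg k z kap x 0 j| <= 1 + 2 * kap * `|x - z|.
Proof.
move=> sg1 kap0; have nsg : `|sg| = 1.
  by apply/eqP; rewrite -sqr_norm_eq1 ?sg1 // eqxx.
rewrite 2!mxE [basis_vec k 0 j]mxE eqxx /= (le_trans (ler_normD _ _)) // lerD //.
  rewrite normrM normrN nsg mul1r; case: (j == k); rewrite ?normr1 ?normr0 //.
rewrite !mxE normrM normrN (ger0_norm (mulr_ge0 _ kap0)) // ler_wpM2l ?mulr_ge0 //.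
by case: eqP => _; rewrite ?normr0 //; have := coord_le_norm (x - z) j; rewrite !mxE.
Qed.

Lemma continuous_sum (I : Type) (s : seq I) (f : I -> 'rV[R]_n.+1 -> R) :
  (forall i, continuous (f i)) -> continuous (fun x => \sum_(i <- s) f i x).
Proof.
move=> fc; elim: s => [|i s IHs] x.
  by under eq_fun do rewrite big_nil; exact: cst_continuous.
have -> : (fun x => \sum_(j <- i :: s) f j x) = f i \+ (fun x => \sum_(j <- s) f j x).
  by apply/funext => y; rewrite big_cons.
by apply: continuousD; [exact: fc|exact: IHs].
Qed.

Lemma paraboloid_continuous sg k z ell kap : continuous (paraboloid sg k z ell kap).
Proof.
have cj (j : 'I_n.+1) : continuous (fun x => (x - z) 0 j).
  have -> : (fun x => (x - z) 0 j) = (fun x => x 0 j) \+ cst (- z 0 j).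
    by apply/funext => x; rewrite !mxE.
  by move=> x; apply: continuousD; [exact: coord_continuous|exact: cst_continuous].
have -> : paraboloid sg k z ell kap = cst ell \- (cst sg \* (fun x => (x - z) 0 k))
    \- (cst kap \* (fun x => \sum_j (if j == k then 0 else (x - z) 0 j * (x - z) 0 j))).
  apply/funext => x; rewrite /paraboloid dotpE /=; congr (_ - _ * _).
  by apply: eq_bigr => j _; rewrite [drop_coord _ _ _ _]mxE; case: eqP; rewrite ?mul0r.
move=> x; apply: continuousB; first apply: continuousB.
- exact: cst_continuous.
- by apply: continuousM; [exact: cst_continuous|exact: cj].
apply: continuousM; first exact: cst_continuous.
apply: continuous_sum => j {}x; case: eqP => _; first exact: cst_continuous.
by apply: continuousM; exact: cj.
Qed.
End Barrier.

(** * First- and second-order conditions where the barrier touches *)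

Section Touching.
Context {R : realType} {n : nat}.
Implicit Types (x y z d : 'rV[R]_n.+1).

Lemma negate_firstE d :
  negate_first d = d *m diag_mx (\row_j (if j == 0 then -1 else 1)).
Proof.
apply/rowP => j; rewrite mul_mx_diag !mxE.
by case: eqP => [->|_]; rewrite ?mulrN1 ?mulr1.
Qed.

Lemma reflect_at_line (l : R) x d (t : R) :
  reflect_at l (x + t *: d) = reflect_at l x + t *: negate_first d.
Proof. by apply/rowP => j; rewrite !mxE; case: eqP => _ //; ring. Qed.

(** For [A] the Hessian of [u] at [reflect_at l x], this is the Hessian of [u \o reflect_at l] at
    [x]. *)
Definition flip_mx (A : 'M[R]_n.+1) : 'M[R]_n.+1 :=
  let S := diag_mx (\row_j (if j == 0 then -1 else 1)) in S *m A *m S.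

Lemma qform_flip A d : qform (flip_mx A) d = qform A (negate_first d).
Proof. by rewrite /qform /flip_mx negate_firstE trmx_mul tr_diag_mx !mulmxA. Qed.

Lemma det_flip A : \det (flip_mx A) = \det A.
Proof.
rewrite /flip_mx !det_mulmx mulrC mulrA -det_mulmx.
set D := diag_mx _; suff -> : D *m D = 1%:M by rewrite det1 mul1r.
rewrite mulmx_diag; apply/matrixP => i j; rewrite !mxE.
by case: (i == 0); rewrite ?mulrNN mulr1.
Qed.

Lemma flip_sym A : A^T = A -> (flip_mx A)^T = flip_mx A.
Proof. by move=> As; rewrite /flip_mx !trmx_mul As tr_diag_mx mulmxA. Qed.

Lemma negate_first_dotp d : dotp (negate_first d) (negate_first d) = dotp d d.
Proof.
rewrite !dotpE; apply: eq_bigr => j _; rewrite !mxE.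
by case: eqP => [->|//]; rewrite mulrNN.
Qed.

Lemma is_derive_exp_quadratic (al g0 b c t : R) :
  is_derive t 1 (fun s : R => expR (al * (g0 + s * b - c * s ^+ 2)))
    (expR (al * (g0 + t * b - c * t ^+ 2)) * (al * (b - 2 * c * t))).
Proof.
pose p (s : R) := al * (g0 + s * b - c * s ^+ 2).
have dp : is_derive t 1 p (al * (b - 2 * c * t)).
  by apply: is_derive_eq; rewrite /GRing.scale /=; ring.
by apply: (@is_derive1_comp _ expR p t _ _ _ dp).
Qed.

Let touching_arith (eps al e b c kap dd q q' : R) :
  eps * e * al * c <= eps * e * al * (kap * dd) ->
  0 <= q - q' - eps * (e * (al * b) * (al * b) + e * (al * (- (2 * c)))) ->
  q' + eps * e * (al ^+ 2 * b ^+ 2 - 2 * al * kap * dd) <= q.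
Proof. lra. Qed.

(** A minimum along each line through [x] is enough, with a radius depending on the direction. On
    the line of direction [d] the reflected function moves along [negate_first d]; the term with
    [dotp d d] absorbs the curvature of the paraboloid. *)
Lemma touching_conditions U (u : 'rV[R]_n.+1 -> R) (l eps al sg ell kap : R) k z x :
  open U -> C2_on U u -> 0 <= eps -> 0 <= al -> 0 <= kap ->
  let g := paraboloid sg k z ell kap in
  let Phi y := u y - u (reflect_at l y) - eps * (expR (al * g y) - 1) in
  (forall d, exists2 r : R, 0 < r & forall t : R, `|t| < r ->
    [/\ U (x + t *: d), U (reflect_at l (x + t *: d)) & Phi x <= Phi (x + t *: d)]) ->
  forall d, let b := dotp (paraboloid_grad sg k z kap x) d in
    dotp d (grad u x) - dotp (negate_first d) (grad u (reflect_at l x)) =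
      eps * expR (al * g x) * (al * b) /\
    qform (hessian u (reflect_at l x)) (negate_first d) +
      eps * expR (al * g x) * (al ^+ 2 * b ^+ 2 - 2 * al * kap * dotp d d) <=
      qform (hessian u x) d.
Proof.
move=> oU u2 eps0 al0 kap0 g Phi loc d b.
have [r r0 rP] := loc d; have u1 := C2_C1 u2.
pose c := kap * dotp (drop_coord k d) (drop_coord k d).
pose E (t : R) := expR (al * (g x + t * b - c * t ^+ 2)).
have gt t : g (x + t *: d) = g x + t * b - c * t ^+ 2 by exact: paraboloid_line.
pose f (t : R) := u (x + t *: d) - u (reflect_at l x + t *: negate_first d) - eps * (E t - 1).
pose df (t : R) := dotp d (grad u (x + t *: d)) -
  dotp (negate_first d) (grad u (reflect_at l x + t *: negate_first d)) -
  eps * (E t * (al * (b - 2 * c * t))).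
have fE t : f t = Phi (x + t *: d) by rewrite /f /Phi reflect_at_line gt.
pose D := qform (hessian u (x + 0 *: d)) d -
  qform (hessian u (reflect_at l x + 0 *: negate_first d)) (negate_first d) -
  eps * (E 0 * (al * (b - 2 * c * 0)) * (al * (b - 2 * c * 0)) + E 0 * (al * (- (2 * c)))).
have [|||df0 D0] := @local_min_second_derivative R f df r D r0.
- move=> t tr; have [Ux Ux' _] := rP t tr; rewrite reflect_at_line in Ux'.
  apply: is_deriveB; first by apply: is_deriveB; exact: is_derive_C1_line oU u1 _.
  have Ed := is_derive_exp_quadratic al (g x) b c t.
  apply: is_derive_eq; rewrite /GRing.scale /= /E; ring.
- have [|Ux Ux' _] := rP 0; first by rewrite normr0.
  rewrite reflect_at_line in Ux'.
  apply: is_deriveB; first by apply: is_deriveB; exact: is_derive_grad_line oU u2 _.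
  have Ed := is_derive_exp_quadratic al (g x) b c 0.
  apply: is_derive_eq; rewrite /GRing.scale /= /E; ring.
- by move=> t /rP[_ _]; rewrite !fE scale0r addr0.
have E0 : E 0 = expR (al * g x) by rewrite /E mul0r addr0 expr0n /= mulr0 subr0.
move: df0 D0; rewrite /df /D !scale0r !addr0 E0 mulr0 subr0 => df0 D0; split.
  by rewrite -mulrA; apply/eqP; rewrite -subr_eq0 df0.
have cd : c <= kap * dotp d d by rewrite ler_wpM2l // dotp_drop_le.
apply: touching_arith D0.
by rewrite ler_wpM2l // !mulr_ge0 // expR_ge0.
Qed.
End Touching.

Section Comparison.
Context {R : realType} {n : nat}.
Implicit Types (x y z d : 'rV[R]_n.+1).

Lemma dist_continuous_at (f : 'rV[R]_n.+1 -> R) x :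
  (forall e, 0 < e -> exists2 d : R, 0 < d & forall y, `|y - x| < d -> `|f y - f x| < e) ->
  {for x, continuous f}.
Proof.
move=> H; have FF : Filter (nbhs x) by exact: nbhs_filter.
apply/(@cvgrPdist_lt _ _ _ (nbhs x) FF) => e /H[d d0 dP]; apply/nbhs_ballP; exists d => // y.
by rewrite -ball_normE /ball_ /= distrC => /dP; rewrite distrC.
Qed.

Lemma reflect_at_dist (l : R) x y : `|reflect_at l y - reflect_at l x| <= `|y - x|.
Proof.
apply: norm_le_coord => // j; have := coord_le_norm (y - x) j; rewrite !mxE.
case: eqP => [->|//]; apply: le_trans; rewrite -normrN le_eqVlt; apply/orP; left.
by apply/eqP; congr (`|_|); ring.
Qed.

Lemma reflect_continuous_at (u : 'rV[R]_n.+1 -> R) (l : R) x :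
  {for reflect_at l x, continuous u} -> {for x, continuous (u \o reflect_at l)}.
Proof.
move=> cu; apply: dist_continuous_at => e e0.
have [d d0 H] := continuous_at_dist cu e0; exists d => // y yx /=.
exact/H/(le_lt_trans (reflect_at_dist l x y)).
Qed.

(** Choice of [al]: the gain [al ^+ 2 / (2 * K)] is quadratic in [al], while the loss from the
    curvature of the paraboloid and the terms with [L] grow at most linearly. *)
Let alpha_arith (N K c mu kap L Y al : R) : 0 <= N -> 0 < K -> 0 < c -> 0 < mu ->
  0 < kap -> 0 <= L -> 0 <= Y ->
  al = 1 + 2 * K / c * (2 * c * N * kap / mu + L * Y + L) ->
  1 <= al /\ L * (1 + al * Y) < c * (al ^+ 2 / (2 * K) - N * (2 * kap * al) / mu).
Proof.
move=> N0 K0 c0 mu0 kap0 L0 Y0 alE.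
set q := 2 * c * N * kap / mu + L * Y + L in alE.
have q0 : 0 <= q by rewrite !addr_ge0 // ?mulr_ge0 // ?invr_ge0 ltW.
have al1 : 1 <= al by rewrite alE lerDl !mulr_ge0 // ?invr_ge0 ltW.
split=> //; have cal : c * al / (2 * K) = c / (2 * K) + q by rewrite alE; field; rewrite !gt_eqF.
have cK : 0 < c / (2 * K) by rewrite divr_gt0 // mulr_gt0.
have -> : c * (al ^+ 2 / (2 * K) - N * (2 * kap * al) / mu) =
  al * (c * al / (2 * K) - 2 * c * N * kap / mu) by field; rewrite !gt_eqF.
rewrite cal /q; have -> : c / (2 * K) + (2 * c * N * kap / mu + L * Y + L) -
  2 * c * N * kap / mu = c / (2 * K) + L * Y + L by ring.
move: (c / (2 * K)) cK => a a0.
have : L <= L * al by rewrite ler_peMr.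
have : 0 < al * a by rewrite mulr_gt0 // (lt_le_trans _ al1).
lra.
Qed.

(** Here [r] is the factor [eps * expR (al * g x0)]. Gain, loss and the upper bounds are all linear
    in [r], so the contradiction does not depend on how small [eps] had to be. *)
Let final_arith (r al K N kap mu c L Y yy dA dB W D : R) :
  0 < r -> 0 < al -> 0 < K -> 0 < c -> 0 < mu -> 0 <= L -> 1 <= yy -> 0 <= Y ->
  L * (1 + al * Y) < c * (al ^+ 2 / (2 * K) - N * (2 * kap * al) / mu) ->
  c <= dB ->
  dB * (1 + r * al ^+ 2 * yy / (2 * K) - N * (r * (2 * al * kap)) / mu) <= dA ->
  dA - dB <= L * W + L * D -> W <= r -> D <= r * (al * Y) -> False.
Proof.
move=> r0 al0 K0 c0 mu0 L0 yy1 Y0 big cB gain diff Wr DY.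
set X := al ^+ 2 / (2 * K) - N * (2 * kap * al) / mu in big.
have X0 : 0 < X.
  rewrite -(pmulr_rgt0 _ c0); apply: le_lt_trans big.
  by rewrite mulr_ge0 // addr_ge0 // mulr_ge0 // ltW.
have p : 0 <= r * al ^+ 2 / (2 * K).
  by rewrite divr_ge0 ?mulr_ge0 ?sqr_ge0 // ltW.
have XB : r * X <= r * al ^+ 2 * yy / (2 * K) - N * (r * (2 * al * kap)) / mu.
  have : r * al ^+ 2 / (2 * K) <= r * al ^+ 2 / (2 * K) * yy by rewrite ler_peMr.
  have -> : r * al ^+ 2 * yy / (2 * K) = r * al ^+ 2 / (2 * K) * yy.
    by field; rewrite gt_eqF.
  have -> : r * X = r * al ^+ 2 / (2 * K) - N * (r * (2 * al * kap)) / mu.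
    by rewrite /X; field; rewrite !gt_eqF.
  by rewrite lerD2r.
have dB0 : 0 < dB := lt_le_trans c0 cB.
have h1 : dB * (1 + r * X) <= dA.
  by apply: le_trans gain; rewrite (ler_pM2l dB0) -addrA lerD2l.
have h2 : c * (r * X) <= dB * (r * X) by rewrite ler_wpM2r // mulr_ge0 // ltW.
have h3 : L * W <= L * r by rewrite ler_wpM2l.
have h4 : L * D <= L * (r * (al * Y)) by rewrite ler_wpM2l.
have h5 : r * (L * (1 + al * Y)) < r * (c * X) by rewrite ltr_pM2l.
move: (c * X) (X) h1 h2 h5 => ? ?; lra.
Qed.

Context (Omega : set 'rV[R]_n.+1) (oO : open Omega) (bO : bounded_set Omega).
Context (u : 'rV[R]_n.+1 -> R) (u2 : C2_on Omega u).
Context (mu K c L : R) (mu0 : 0 < mu) (K0 : 0 < K) (c0 : 0 < c) (L0 : 0 <= L).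
Context (ell_u : forall x d, Omega x ->
  mu * dotp d d <= qform (hessian u x) d <= K * dotp d d).
Context (det_u : forall x, Omega x -> c <= \det (hessian u x)).
Context (l : R).
Context (u_ge : forall x, Omega x -> Omega (reflect_at l x) -> x 0 0 < l ->
  u (reflect_at l x) <= u x).
Context (det_diff : forall x, Omega x -> Omega (reflect_at l x) -> x 0 0 < l ->
  \det (hessian u x) - \det (hessian u (reflect_at l x)) <=
  L * (u x - u (reflect_at l x)) +
  L * `|negate_first (grad u x) - grad u (reflect_at l x)|).

Section Paraboloid.
Context (sg : R) (k : 'I_n.+1) (z : 'rV[R]_n.+1) (ell kap : R).
Context (sg1 : sg ^+ 2 = 1) (ell0 : 0 < ell) (kap0 : 0 < kap).
Let g := paraboloid sg k z ell kap.
(** A solid with a flat base and the lateral surface [g = 0]. The hypotheses below let it meet the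
    plane [x_1 = l] where [g] vanishes, so that interior propagation and Hopf's lemma share one
    comparison. *)
Let G := [set x | 0 <= sg * (x - z) 0 k /\ 0 <= g x].
Context (GO : forall x, G x -> Omega x /\ Omega (reflect_at l x)).
Context (Gle : forall x, G x -> x 0 0 <= l).
Context (Glt : forall x, G x -> 0 < g x -> x 0 0 < l).
Context (Gbase : forall x, G x -> (x - z) 0 k = 0 -> u (reflect_at l x) < u x).

Let w x := u x - u (reflect_at l x).

Let w_ge0 x : G x -> 0 <= w x.
Proof.
move=> Gx; have [Ox Ox'] := GO Gx; rewrite subr_ge0.
have := Gle Gx; rewrite le_eqVlt => /orP[/eqP xl|]; last exact: u_ge.
by rewrite reflect_atE xl subrr mulr0 scale0r addr0.
Qed.

Let w_continuous x : G x -> {for x, continuous w}.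
Proof.
move=> /GO[Ox Ox']; have [cu _ _] := u2.
by apply: continuousB; [exact: cu|apply: reflect_continuous_at; exact: cu].
Qed.

Let axis_continuous : continuous (fun x => sg * (x - z) 0 k).
Proof.
have -> : (fun x => sg * (x - z) 0 k) = cst sg \* ((fun x => x 0 k) \+ cst (- z 0 k)).
  by apply/funext => x; rewrite !mxE.
move=> x; apply: continuousM; first exact: cst_continuous.
by apply: continuousD; [exact: coord_continuous|exact: cst_continuous].
Qed.

Let G_closed : closed G.
Proof.
have -> : G = (fun x => sg * (x - z) 0 k) @^-1` [set t | 0 <= t] `&`
              g @^-1` [set t | 0 <= t] by [].
apply: closedI; apply: closed_comp; try exact: closed_ge; move=> x _.
  exact: axis_continuous.
exact: paraboloid_continuous.
Qed.

Let G_compact : compact G.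
Proof.
apply: bounded_closed_compact => //.
have [M [Mr H]] := bO; exists M; split => // M' MM' x /GO[Ox _].
exact: H.
Qed.

Let Gz : G z.
Proof.
rewrite /G /g /= /paraboloid subrr !mxE mulr0 subr0; split => //.
by rewrite /dotp /drop_coord mxE big1 ?mulr0 ?subr0 ?ltW // => j _; rewrite !mxE if_same mul0r.
Qed.

Let base_min : exists2 m : R, 0 < m & forall x, G x -> (x - z) 0 k = 0 -> m <= w x.
Proof.
pose B := G `&` (fun x => sg * (x - z) 0 k) @^-1` [set 0].
have cB : compact B.
  apply: (subclosed_compact _ G_compact) => [|x []//].
  apply: closedI => //; apply: closed_comp => [x _|]; last exact: closed_eq.
  exact: axis_continuous.
have Bz : B !=set0 by exists z; split => //=; rewrite subrr mxE mulr0.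
have [|x0] := EVT_min_rV Bz cB (f := w).
  by apply: continuous_in_subspaceT => x /[!inE] -[Gx _]; exact: w_continuous.
have sg0 : sg != 0 by rewrite -sqrf_eq0 sg1 oner_eq0.
rewrite inE => -[Gx0 /= /eqP]; rewrite mulf_eq0 (negbTE sg0) /= => /eqP x0k min0.
exists (w x0); first by rewrite subr_gt0 Gbase.
by move=> x Gx xk; apply: min0; rewrite inE; split => //=; rewrite xk mulr0.
Qed.

(** A negative minimum of [Phi] cannot lie on the lateral surface, where the barrier vanishes and
    [w >= 0], nor on the base, where [w >= m] exceeds the barrier. So it is interior, and the
    touching conditions contradict the bound on the difference of determinants. *)
Lemma barrier_comparison : exists eps al : R, [/\ 0 < eps, 0 < al &
  forall x, G x -> eps * (expR (al * g x) - 1) <= u x - u (reflect_at l x)].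
Proof.
have [m m0 mw] := base_min.
have [M [M0 OM]] : exists M : R, 0 <= M /\ forall x, Omega x -> `|x| <= M.
  have [M [Mr H]] := bO; exists (Num.max 0 (M + 1)); split; first by rewrite le_max lexx.
  by move=> x Ox; apply: H => //; rewrite lt_max ltrDl ltr01 orbT.
(* Bounds the coordinates of the paraboloid gradient, since [x0] and [z] both lie in [Omega]. *)
pose Y := 1 + 2 * kap * (2 * M).
have Y0 : 0 <= Y by rewrite addr_ge0 // !mulr_ge0 // ltW.
pose N : R := n.+1%:R.
have N0 : 0 < N by rewrite ltr0n.
have N1 : 1 <= N by rewrite ler1n.
pose al := 1 + 2 * K / c * (2 * c * N * kap / mu + L * Y + L).
have [al1 al_big] := @alpha_arith N K c mu kap L Y al (ltW N0) K0 c0 mu0 kap0 L0 Y0 erefl.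
have al0 : 0 < al := lt_le_trans ltr01 al1.
pose E := expR (al * ell).
have E0 : 0 < E := expR_gt0 _.
have q0 : 0 < mu / (4 * kap * al * N * E) by rewrite divr_gt0 // !mulr_gt0.
(* The first bound keeps the barrier below [m] on the base; the second keeps the loss [N * s / mu]
   below [1 / 2], as [det_gain] requires. *)
have [eps eps0 /andP[epsm epsq]] := exists_small (divr_gt0 m0 E0) q0.
rewrite ltr_pdivlMr // in epsm; rewrite ltr_pdivlMr ?mulr_gt0 // in epsq.
exists eps, al; split => //.
have gE x : G x -> expR (al * g x) <= E.
  move=> [x1 x2]; rewrite ler_expR ler_pM2l // /g /paraboloid.
  have : 0 <= kap * dotp (drop_coord k (x - z)) (drop_coord k (x - z)).
    by rewrite mulr_ge0 ?dotp_ge0 // ltW.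
  lra.
pose Phi x := w x - eps * (expR (al * g x) - 1).
have [|x0] := EVT_min_rV (ex_intro _ z Gz) G_compact (f := Phi).
  apply: continuous_in_subspaceT => x /[!inE] Gx; apply: continuousB.
    exact: w_continuous.
  have -> : (fun x => eps * (expR (al * g x) - 1)) =
      cst eps \* ((expR \o (cst al \* g)) \+ cst (-1)) by [].
  apply: continuousM; first exact: cst_continuous.
  apply: continuousD; last exact: cst_continuous.
  apply: continuous_comp; last exact: continuous_expR.
  by apply: continuousM; [exact: cst_continuous|exact: paraboloid_continuous].
rewrite inE => Gx0 minPhi.
suff Phi0 : 0 <= Phi x0.
  move=> x Gx; rewrite -subr_ge0; apply: (le_trans Phi0).
  by apply: minPhi; rewrite inE.
rewrite leNgt; apply/negP => Phi_neg.
have [Ox0 Ox0'] := GO Gx0.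
have w0 := w_ge0 Gx0.
have g0 : 0 < g x0.
  rewrite lt_neqAle eq_sym; have [_ ->] := Gx0; rewrite andbT; apply/eqP => gx0.
  by move: Phi_neg; rewrite /Phi gx0 mulr0 expR0 subrr mulr0 subr0 ltNge w0.
have e_pos : 0 < expR (al * g x0) := expR_gt0 _.
have k0 : 0 < sg * (x0 - z) 0 k.
  rewrite lt_neqAle eq_sym; have [-> _] := Gx0; rewrite andbT; apply/eqP => sx0.
  have xk : (x0 - z) 0 k = 0 by rewrite -[LHS]mul1r -sg1 expr2 -mulrA sx0 mulr0.
  have := mw _ Gx0 xk; move: Phi_neg; rewrite /Phi.
  have : eps * (expR (al * g x0) - 1) <= eps * E.
    by rewrite ler_pM2l // (le_trans _ (gE _ Gx0)) // gerBl.
  lra.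
have loc d : exists2 r : R, 0 < r & forall t : R, `|t| < r ->
    [/\ Omega (x0 + t *: d), Omega (reflect_at l (x0 + t *: d)) &
        Phi x0 <= Phi (x0 + t *: d)].
  have oV : open ((fun x => sg * (x - z) 0 k) @^-1` [set t | 0 < t] `&`
                  g @^-1` [set t | 0 < t]).
    apply: openI; apply: open_comp; try exact: open_gt; move=> x _.
      exact: axis_continuous.
    exact: paraboloid_continuous.
  have [|r r0 rV] := line_in_open d oV (x := x0); first by split.
  exists r; [exact: r0|move=> t /rV[t1 t2]].
  have Gt : G (x0 + t *: d) by split; exact: ltW.
  have [inO inO'] := GO Gt; split; [exact: inO|exact: inO'|].
  by apply: minPhi; rewrite inE.
have TC := touching_conditions oO u2 (ltW eps0) (ltW al0) (ltW kap0) loc.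
pose e := expR (al * g x0).
pose y := paraboloid_grad sg k z kap x0.
have y1 : 1 <= dotp y y := paraboloid_grad_sqr k z kap x0 sg1.
have yY j : `|y 0 j| <= Y.
  apply: le_trans (paraboloid_grad_coord _ _ _ _ sg1 (ltW kap0)) _.
  rewrite lerD2l; have kap2 : 0 < 2 * kap by rewrite mulr_gt0.
  rewrite (ler_pM2l kap2); have [Oz _] := GO Gz; have := OM _ Oz; have := OM _ Ox0.
  have := ler_normB x0 z; lra.
(* The vector on the left is the gradient of [w] at [x0] with its first coordinate negated, and at
   the minimum this gradient equals that of the barrier. *)
have gradY : `|negate_first (grad u x0) - grad u (reflect_at l x0)| <= eps * e * (al * Y).
  apply: norm_le_coord; first by rewrite !mulr_ge0 // ltW.
  move=> j; have [Ej _] := TC (basis_vec j).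
  have -> : (negate_first (grad u x0) - grad u (reflect_at l x0)) 0 j =
      (if j == 0 then -1 else 1) * (eps * e * (al * y 0 j)).
    rewrite -[y 0 j]dotp_basis [dotp _ y]dotpC -[LHS]mul1r -Ej dotp_basis.
    have -> : dotp (negate_first (basis_vec j)) (grad u (reflect_at l x0)) =
        (if j == 0 then -1 else 1) * grad u (reflect_at l x0) 0 j.
      rewrite -dotp_basis -dotpZl; congr (dotp _ _).
      apply/rowP => i; rewrite negate_firstE mul_mx_diag !mxE eqxx /= mulrC.
      by case: (eqVneq i j) => [->|_]; rewrite ?mulr0.
    rewrite !mxE; case: eqP => [->|_]; ring.
  rewrite normrM (_ : `|if j == 0 then -1 else 1| = 1 :> R); last first.
    by case: ifP => _; rewrite ?normrN normr1.
  rewrite mul1r normrM (gtr0_norm (mulr_gt0 eps0 e_pos)) ler_pM2l ?mulr_gt0 //.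
  by rewrite normrM (gtr0_norm al0) ler_pM2l.
pose A := hessian u x0; pose B := flip_mx (hessian u (reflect_at l x0)).
pose s := eps * e * (2 * al * kap); pose t := eps * e * al ^+ 2.
have ee : 0 < eps * e by rewrite mulr_gt0.
have s0 : 0 <= s by rewrite mulr_ge0 ?ltW // !mulr_gt0.
have t0 : 0 <= t by rewrite mulr_ge0 ?sqr_ge0 // ltW.
have As : A^T = A := hessian_sym oO u2 Ox0.
have Bs : B^T = B by apply: flip_sym; exact: hessian_sym oO u2 Ox0'.
have BK d : mu * dotp d d <= qform B d <= K * dotp d d.
  by rewrite qform_flip -negate_first_dotp ell_u.
have BA d : qform B d - s * dotp d d + t * dotp y d ^+ 2 <= qform A d.
  have [_] := TC d; rewrite qform_flip; apply: le_trans.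
  rewrite le_eqVlt; apply/orP; left; apply/eqP; rewrite /s /t /e /y /g; ring.
have Ns : N * s / mu <= 1 / 2.
  rewrite ler_pdivrMr //; have : s <= eps * E * (2 * al * kap).
    have p : 0 < 2 * al * kap by rewrite !mulr_gt0.
    by rewrite /s (ler_pM2r p) (ler_pM2l eps0); exact: gE.
  rewrite -(ler_pM2l N0); move: epsq; lra.
have s2 : s / mu <= 1 / 2.
  apply: le_trans Ns; rewrite ler_wpM2r ?ler_peMl // invr_ge0.
  exact: ltW.
have gain := det_gain As Bs mu0 K0 s0 t0 BK Ns s2 BA.
have detBE : \det B = \det (hessian u (reflect_at l x0)) by rewrite det_flip.
have diff := det_diff Ox0 Ox0' (Glt Gx0 g0).
(* Negativity of [Phi] bounds [w] itself by the barrier, so the zeroth-order term also has size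
   [eps * e]. *)
have ww : u x0 - u (reflect_at l x0) <= eps * e.
  have : w x0 < eps * (e - 1) by rewrite -subr_lt0; exact: Phi_neg.
  by move=> /ltW/le_trans; apply; rewrite ler_pM2l // gerBl.
have detB := det_u Ox0'.
rewrite detBE in gain.
exact: final_arith ee al0 K0 c0 mu0 L0 y1 Y0 al_big detB gain diff ww gradY.
Qed.
End Paraboloid.
End Comparison.

(** * Propagation of positivity *)

Section Propagation.
Context {R : realType} {n : nat}.
Implicit Types (x y z d p q : 'rV[R]_n.+1).

Lemma line_continuous z d : continuous (fun t : R => z + t *: d).
Proof.
by move=> t; apply: cvgD; [exact: cvg_cst|exact: scalel_continuous].
Qed.

Lemma segment_tube (V : set 'rV[R]_n.+1) z d (a : R) : open V ->
  (forall t, 0 <= t <= a -> V (z + t *: d)) ->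
  exists2 r, 0 < r & forall t x, 0 <= t <= a -> `|x - (z + t *: d)| < r -> V x.
Proof.
move=> oV segV; apply: contrapT => no.
pose A := (fun t : R => z + t *: d) @` `[0, a].
have cA : compact A.
  apply: continuous_compact; last exact: segment_compact.
  by apply: continuous_subspaceT; exact: line_continuous.
have clA : closed A by apply: compact_closed cA; exact: norm_hausdorff.
have [||y yP] := @bounded_cluster R n.+1 A
    (fun r x => exists2 x', `|x' - x| < r & ~ V x') (compact_bounded cA).
- move=> r r0; apply: contrapT => H; apply: no; exists r => // t x ta xt.
  apply: contrapT => nV; apply: H; exists (z + t *: d); last by exists x.
  by exists t; rewrite //= in_itv.
- by move=> r r' x rr' [x' x'x nV]; exists x' => //; exact: lt_le_trans rr'.
have : A y by apply: clA; apply/closure_distP => e /yP[x [Ax xy _]]; exists x.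
move=> [t]; rewrite /= in_itv /= => /segV Vt ty; rewrite ty in Vt.
have [e e0 eV] := open_dist oV Vt.
have e2 : 0 < e / 2 by rewrite divr_gt0.
have [x [_ xy [x' x'x nV]]] := yP _ e2; apply: nV; apply: eV.
have -> : x' - y = (x' - x) + (x - y) by rewrite addrA subrK.
by rewrite (le_lt_trans (ler_normD _ _)) // [e]splitr ltrD.
Qed.

Context (Omega : set 'rV[R]_n.+1) (oO : open Omega) (bO : bounded_set Omega).
Context (u : 'rV[R]_n.+1 -> R) (u2 : C2_on Omega u).
Context (mu K c L : R) (mu0 : 0 < mu) (K0 : 0 < K) (c0 : 0 < c) (L0 : 0 <= L).
Context (ell_u : forall x d, Omega x ->
  mu * dotp d d <= qform (hessian u x) d <= K * dotp d d).
Context (det_u : forall x, Omega x -> c <= \det (hessian u x)).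
Context (l : R).
Context (u_ge : forall x, Omega x -> Omega (reflect_at l x) -> x 0 0 < l ->
  u (reflect_at l x) <= u x).
Context (det_diff : forall x, Omega x -> Omega (reflect_at l x) -> x 0 0 < l ->
  \det (hessian u x) - \det (hessian u (reflect_at l x)) <=
  L * (u x - u (reflect_at l x)) +
  L * `|negate_first (grad u x) - grad u (reflect_at l x)|).

Let barrier := barrier_comparison oO bO u2 mu0 K0 c0 L0 ell_u det_u u_ge det_diff.

Lemma open_cap : open (cap Omega l).
Proof.
have -> : cap Omega l = Omega `&` (fun x => x 0 0) @^-1` [set t | t < l] by [].
apply: openI => //; apply: open_comp; last exact: open_lt.
by move=> x _; exact: coord_continuous.
Qed.

Context (refl_in : forall x, Omega x -> x 0 0 < l -> Omega (reflect_at l x)).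

Lemma lateral_bound k z (ell kap r : R) x : 0 < kap -> 0 < r -> ell / kap < r ^+ 2 ->
  kap * dotp (drop_coord k (x - z)) (drop_coord k (x - z)) <= ell ->
  forall j, j != k -> `|(x - z) 0 j| < r.
Proof.
move=> kap0 r0 er qe j jk.
rewrite -(ltr_pXn2r (ltn0Sn 1)) ?nnegrE ?normr_ge0 ?(ltW r0) // real_normK ?num_real //.
apply: le_lt_trans er; rewrite ler_pdivlMr // mulrC (le_trans _ qe) // ler_pM2l //.
have := sqr_coord_le_dotp (drop_coord k (x - z)) j.
by rewrite [drop_coord _ _ 0 j]mxE (negbTE jk).
Qed.

(** A thin paraboloid around the segment, with its base in a ball about [z] where [w_l > 0] and its
    apex beyond the far end, carries positivity to that end. *)
Lemma propagate_segment k (sg a : R) z : sg ^+ 2 = 1 -> 0 <= a ->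
  (forall t, 0 <= t <= a -> cap Omega l (z + t *: (sg *: basis_vec k))) ->
  u (reflect_at l z) < u z ->
  u (reflect_at l (z + a *: (sg *: basis_vec k))) < u (z + a *: (sg *: basis_vec k)).
Proof.
move=> sg1 a0 seg wz; set v := sg *: basis_vec k in seg *.
have nsg : `|sg| = 1 by apply/eqP; rewrite -sqr_norm_eq1 ?sg1 // eqxx.
have [r r0 tube] := segment_tube open_cap seg.
have [cu _ _] := u2.
have [Oz zl] : cap Omega l z by rewrite -[z]addr0 -(scale0r v); apply: seg; rewrite lexx.
have cw : {for z, continuous (fun x => u x - u (reflect_at l x))}.
  apply: continuousB; first exact: cu.
  by apply: reflect_continuous_at; apply/cu/refl_in.
have wz0 : 0 < u z - u (reflect_at l z) by rewrite subr_gt0.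
have [r1 r10 near_z] := continuous_at_dist cw wz0.
have [s s0 /andP[sr sr1]] := exists_small r0 r10.
(* The apex lies [s] beyond the far end, so the paraboloid function equals [s > 0] there. With the
   next choice, [ell / kap = s ^+ 2 / 2]: the lateral extent stays below [s], inside both the tube
   and the ball. *)
pose ell := a + s.
have ell0 : 0 < ell by rewrite ltr_wpDl.
pose kap := 2 * ell / s ^+ 2.
have kap0 : 0 < kap by rewrite divr_gt0 ?mulr_gt0 // exprn_gt0.
have ellkap : ell / kap < s ^+ 2.
  have -> : ell / kap = s ^+ 2 / 2 by rewrite /kap; field; rewrite !gt_eqF.
  by rewrite ltr_pdivrMr // ltr_pMr ?ltr1n // exprn_gt0.
have lat x : 0 <= sg * (x - z) 0 k -> 0 <= paraboloid sg k z ell kap x ->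
    (forall j, j != k -> `|(x - z) 0 j| < s) /\ sg * (x - z) 0 k <= ell.
  rewrite /paraboloid => x1 x2.
  have q0 : 0 <= kap * dotp (drop_coord k (x - z)) (drop_coord k (x - z)).
    by rewrite mulr_ge0 ?dotp_ge0 // ltW.
  by split; [apply: (lateral_bound kap0 s0 ellkap); lra|lra].
have inC x : 0 <= sg * (x - z) 0 k -> 0 <= paraboloid sg k z ell kap x -> cap Omega l x.
  move=> x1 x2; have [xj xk] := lat _ x1 x2.
  pose t := Num.min a (sg * (x - z) 0 k).
  apply: (tube t); first by rewrite le_min a0 x1 ge_min lexx.
  apply: norm_lt_coord => // j.
  have -> : (x - (z + t *: v)) 0 j = (x - z) 0 j - t * (sg * (j == k)%:R).
    by rewrite !mxE eqxx /=; ring.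
  have [->|jk] := eqVneq j k; last by rewrite mulr0 mulr0 subr0 (lt_trans (xj _ jk)).
  have -> : (x - z) 0 k - t * (sg * true%:R) = sg * (sg * (x - z) 0 k - t).
    by rewrite [RHS]mulrBr [sg * (sg * _)]mulrA -[sg * sg]expr2 sg1 /=; ring.
  rewrite normrM nsg mul1r ger0_norm ?subr_ge0 ?ge_min ?lexx ?orbT //.
  apply: (le_lt_trans _ sr); rewrite /t.
  have [aX|Xa] := leP a (sg * (x - z) 0 k); first by rewrite lerBlDl.
  by rewrite subrr ltW.
have [||||eps [al [eps0 al0 H]]] := @barrier sg k z ell kap sg1 ell0 kap0.
- by move=> x [x1 x2]; have [Ox xl] := inC _ x1 x2; split => //; exact: refl_in.
- by move=> x [x1 x2]; have [_ /ltW] := inC _ x1 x2.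
- by move=> x [x1 x2] _; have [_] := inC _ x1 x2.
- move=> x [x1 x2] xk; have [xj _] := lat _ x1 x2.
  have xz : `|x - z| < r1.
    apply: norm_lt_coord => // j; have [->|jk] := eqVneq j k.
      by rewrite xk normr0.
    by rewrite (lt_trans (xj _ jk)).
  by have /ltr_normlP[] := near_z _ xz; lra.
set e := z + a *: v.
have ek : sg * (e - z) 0 k = a.
  have -> : (e - z) 0 k = a * sg by rewrite !mxE !eqxx /=; ring.
  by rewrite mulrCA -expr2 sg1 mulr1.
have ge : paraboloid sg k z ell kap e = s.
  rewrite /paraboloid ek; have -> : drop_coord k (e - z) = 0.
    apply/rowP => j; rewrite !mxE eqxx /=; case: eqP => // _.
    by rewrite !mulr0 addr0 subrr.
  by rewrite /dotp mul0mx mxE /ell; ring.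
have He : eps * (expR (al * s) - 1) <= u e - u (reflect_at l e).
  by rewrite -{1}ge; apply: H; split; [rewrite ek|rewrite ge ltW].
rewrite -subr_gt0; apply: lt_le_trans He.
by rewrite mulr_gt0 // subr_gt0 expR_gt1 mulr_gt0.
Qed.

(** The paraboloid has axis [e_1], its apex exactly at [x] and its base at distance [s / 2] inside
    the cap. The inequality [expR a >= 1 + a] makes [w_l] grow at least at the rate [eps * al] away
    from the plane, and on the axis [w_l] is a symmetric difference of [u] about [x]. *)
Lemma hopf_at_plane x (r : R) : Omega x -> x 0 0 = l -> 0 < r ->
  (forall y, cap Omega l y -> `|y - x| < r -> u (reflect_at l y) < u y) ->
  partial 0 u x < 0.
Proof.
move=> Ox xl r0 wpos.
have [r1 r10 r1O] := open_dist oO Ox.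
have [s s0 /andP[sr sr1]] := exists_small r0 r10.
have rx : reflect_at l x = x by rewrite reflect_atE xl subrr mulr0 scale0r addr0.
have s2 : 0 < s / 2 by rewrite divr_gt0.
pose ell := s / 2; have ell0 : 0 < ell := s2.
pose kap := 2 * ell / s ^+ 2.
have kap0 : 0 < kap by rewrite divr_gt0 ?mulr_gt0 // exprn_gt0.
have ellkap : ell / kap < s ^+ 2.
  have -> : ell / kap = s ^+ 2 / 2 by rewrite /kap; field; rewrite !gt_eqF.
  by rewrite ltr_pdivrMr // ltr_pMr ?ltr1n // exprn_gt0.
pose z := x + (- ell) *: basis_vec 0.
have yz0 y : (y - z) 0 0 = y 0 0 - l + ell by rewrite !mxE !eqxx xl /=; ring.
have yzj y j : j != 0 -> (y - z) 0 j = (y - x) 0 j.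
  by move=> j0; rewrite !mxE eqxx (negbTE j0) /=; ring.
have lat y : 0 <= 1 * (y - z) 0 0 -> 0 <= paraboloid 1 0 z ell kap y ->
    `|y - x| < s /\ y 0 0 <= l.
  rewrite /paraboloid mul1r => y1 y2.
  have q0 : 0 <= kap * dotp (drop_coord 0 (y - z)) (drop_coord 0 (y - z)).
    by rewrite mulr_ge0 ?dotp_ge0 // ltW.
  have yl : y 0 0 <= l by rewrite yz0 in y2; lra.
  split => //; apply: norm_lt_coord => // j; have [->|j0] := eqVneq j 0.
    rewrite !mxE xl ler0_norm ?subr_le0 // ; rewrite yz0 /ell in y1; lra.
  rewrite -yzj //; apply: (lateral_bound kap0 s0 ellkap _ j0); lra.
have inO y : `|y - x| < s -> Omega y /\ Omega (reflect_at l y).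
  move=> yx; split; apply: r1O; first exact: lt_trans sr1.
  by rewrite -rx (le_lt_trans (reflect_at_dist l x y)) // (lt_trans yx).
have one1 : (1 : R) ^+ 2 = 1 by rewrite expr1n.
have [||||eps [al [eps0 al0 H]]] := @barrier 1 0 z ell kap one1 ell0 kap0.
- by move=> y [y1 y2]; have [/inO] := lat _ y1 y2.
- by move=> y [y1 y2]; have [] := lat _ y1 y2.
- move=> y [y1 y2] y3; move: y3; rewrite /paraboloid mul1r yz0.
  have : 0 <= kap * dotp (drop_coord 0 (y - z)) (drop_coord 0 (y - z)).
    by rewrite mulr_ge0 ?dotp_ge0 // ltW.
  by move=> *; lra.
- move=> y [y1 y2] y3; have [yx _] := lat _ y1 y2; have [Oy _] := inO _ yx.
  apply: wpos; last exact: lt_trans sr.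
  by split => //; move: y3; rewrite yz0 => *; lra.
pose f t := u (x + t *: basis_vec 0).
have decr t : 0 < t <= ell -> eps * al * t <= f (- t) - f t.
  move=> /andP[t0 tl]; pose y := x + (- t) *: basis_vec 0.
  have yy : (y - z) 0 0 = ell - t.
    by rewrite yz0 /y first_coord_add xl; ring.
  have gy : paraboloid 1 0 z ell kap y = t.
    rewrite /paraboloid yy; have -> : drop_coord 0 (y - z) = 0.
      apply/rowP => j; rewrite [LHS]mxE [RHS]mxE; case: eqP => // /eqP j0.
      by rewrite yzj // !mxE ?(negbTE j0) ?andbF ?mulr0 ?addr0 subrr.
    by rewrite /dotp mul0mx mxE; ring.
  have : eps * (expR (al * t) - 1) <= u y - u (reflect_at l y).
    rewrite -{1}gy; apply: H; split; last by rewrite gy ltW.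
    by rewrite yy mul1r subr_ge0.
  have -> : reflect_at l y = x + t *: basis_vec 0.
    rewrite reflect_atE /y first_coord_add xl -addrA -scalerDl.
    by congr (_ + _ *: _); ring.
  apply: le_trans; rewrite -mulrA ler_pM2l //.
  by have := expR_ge1Dx (al * t); lra.
rewrite ltNge; apply/negP => p0.
have x00 : x + 0 *: basis_vec 0 = x by rewrite scale0r addr0.
have fd : is_derive (0 : R) 1 f (partial 0 u x).
  have := @is_derive_line R n u x (basis_vec 0) 0; rewrite x00; apply.
  by have [_ /(_ 0 _ Ox)[]] := u2.
(* Each one-sided quotient is off by less than [eps * al / 4], so together they lose at most half of
   the rate [eps * al]. *)
have e4 : 0 < eps * al / 4 by rewrite divr_gt0 // mulr_gt0.
have [d d0 Hd] := is_derive_dist fd e4.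
have [t t0 /andP[td te]] := exists_small d0 ell0.
have tn : - t != 0 by rewrite oppr_eq0 gt_eqF.
have := Hd t (lt0r_neq0 t0); rewrite gtr0_norm // add0r => /(_ td) /ltr_normlP[h1 _].
have := Hd (- t) tn; rewrite normrN gtr0_norm // add0r => /(_ td) /ltr_normlP[h2 _].
have := decr t; rewrite t0 ltW // => /(_ isT).
move: h1 h2 e4 p0; rewrite invrN mulNr.
move: (f t) (f (- t)) (f 0) (partial 0 u x) => ft fmt f0 D h1 h2 e4 p0 h3.
have g1 : t * (D - t^-1 * (ft - f0)) < t * (eps * al / 4) by rewrite ltr_pM2l //; lra.
have g2 : t * (D + t^-1 * (fmt - f0)) < t * (eps * al / 4) by rewrite ltr_pM2l //; lra.
have cancel X : t * (t^-1 * X) = X by rewrite mulrA divff ?mul1r ?gt_eqF.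
move: g1 g2; rewrite [t * (D - _)]mulrBr [t * (D + _)]mulrDr !cancel.
have : 0 <= t * D by rewrite mulr_ge0 // ltW.
have : 0 < t * (eps * al) by rewrite !mulr_gt0.
lra.
Qed.

(** [q] is turned into [p] one coordinate at a time, along axis-parallel segments in the box that
    they span. *)
Lemma box_positive p q :
  (forall x, (forall j, p 0 j <= x 0 j <= q 0 j \/ q 0 j <= x 0 j <= p 0 j) ->
     cap Omega l x) ->
  u (reflect_at l q) < u q -> u (reflect_at l p) < u p.
Proof.
move=> box wq.
pose mix k : 'rV[R]_n.+1 := \row_j (if (j < k)%N then p 0 j else q 0 j).
suff H k : (k <= n.+1)%N -> u (reflect_at l (mix k)) < u (mix k).
  have -> : p = mix n.+1 by apply/rowP => j; rewrite mxE ltn_ord.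
  exact: H.
elim: k => [_|k IHk kn].
  by have -> : mix 0%N = q by apply/rowP => j; rewrite mxE.
pose kk := Ordinal kn.
pose D := p 0 kk - q 0 kk.
pose sg : R := if 0 <= D then 1 else -1.
have sg1 : sg ^+ 2 = 1 by rewrite /sg; case: ifP; rewrite ?sqrrN expr1n.
have sgD : `|D| * sg = D.
  rewrite /sg; case: (leP 0 D) => D0; first by rewrite mulr1 ger0_norm.
  by rewrite mulrN1 ltr0_norm // opprK.
have coord t j : (mix k + t *: (sg *: basis_vec kk)) 0 j =
    if j == kk then q 0 kk + t * sg else mix k 0 j.
  rewrite !mxE eqxx /=; have [->|jk] := eqVneq j kk; last by rewrite !mulr0 addr0.
  by rewrite /= ltnn mulr1.
have -> : mix k.+1 = mix k + `|D| *: (sg *: basis_vec kk).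
  apply/rowP => j; rewrite coord sgD [LHS]mxE; have [->|jk] := eqVneq j kk.
    by rewrite /= ltnSn /D addrC subrK.
  rewrite mxE ltnS leq_eqVlt; suff /negbTE -> : (j : nat) != k by [].
  by apply: contra jk => /eqP jk; apply/eqP/val_inj.
apply: propagate_segment => //; last exact/IHk/ltnW.
move=> t /andP[t0 tD]; apply: box => j; rewrite coord; have [->|jk] := eqVneq j kk.
  move: tD; rewrite /sg; case: (leP 0 D) => D0 tD.
    by right; rewrite ger0_norm // /D in tD; apply/andP; split; lra.
  have {}tD : t <= - D by rewrite -(ltr0_norm D0).
  by left; move: tD D0; rewrite /D => *; apply/andP; split; lra.
rewrite mxE; case: ifP => _; rewrite !lexx ?andbT /=.
  by case: (leP (p 0 j) (q 0 j)) => ?; [left|right; rewrite ltW].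
by case: (leP (p 0 j) (q 0 j)) => ?; [left|right; rewrite ltW].
Qed.
End Propagation.

(** * Moving planes *)

Lemma reflect_at_dist2 {R : realType} {n : nat} (l l' : R) (x y : 'rV[R]_n.+1) :
  `|reflect_at l' x - reflect_at l y| <= 2 * `|l' - l| + `|x - y|.
Proof.
have -> : reflect_at l' x - reflect_at l y =
    (2 * (l' - l)) *: basis_vec 0 + (reflect_at l x - reflect_at l y).
  rewrite addrA; congr (_ - _); rewrite !reflect_atE [RHS]addrCA -scalerDl.
  by congr (_ + _ *: _); ring.
apply: le_trans (ler_normD _ _) _; apply: lerD; last exact: reflect_at_dist.
by rewrite normrZ norm_delta_mx mulr1 normrM ger0_norm.
Qed.

Lemma reflect_atK {R : realType} {n : nat} (l : R) (x : 'rV[R]_n.+1) :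
  reflect_at l (reflect_at l x) = x.
Proof.
apply/rowP => j; have [->|j0] := eqVneq j 0; rewrite !mxE /=; first by ring.
by rewrite (negbTE j0).
Qed.

Lemma reflect_at_first {R : realType} {n : nat} (l : R) (x : 'rV[R]_n.+1) :
  (reflect_at l x) 0 0 = 2 * l - x 0 0.
Proof. by rewrite !mxE. Qed.

Section MovingPlanes.
Context {R : realType} {n m : nat} {Omega : set 'rV[R]_n.+1}.
Context (oO : open Omega) (coO : connected Omega) (O0 : Omega !=set0).
Context (bO : bounded_set Omega) (bdC2 : C2_boundary Omega) (cO : convex_in_e1 Omega).
Context (Lambda_le0 : Lambda_0 Omega <= 0).
Context (f : 'I_m.+1 -> 'rV[R]_n.+1 -> 'rV[R]_m.+1 -> 'rV[R]_n.+1 -> R).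
Context (f_positive : forall i, exists2 c : R, 0 < c &
   forall (x : 'rV[R]_n.+1) (z : 'rV[R]_m.+1) (p : 'rV[R]_n.+1),
     Omega x -> c <= f i x z p).
Context (f_split : forall i,
   exists f1 f2 : 'rV[R]_n.+1 -> 'rV[R]_m.+1 -> 'rV[R]_n.+1 -> R,
   [/\ forall (x : 'rV[R]_n.+1) (z : 'rV[R]_m.+1) (p : 'rV[R]_n.+1),
         closure Omega x -> f i x z p = f1 x z p + f2 x z p,
       loc_unif_lipschitz_z Omega i f1 & nonincreasing_z Omega i f2]).
Context (f_coupling : forall i j : 'I_m.+1, j != i -> nonincreasing_z Omega j (f i)).
Context (f_lipschitz_p : forall i, loc_unif_lipschitz_p Omega (f i)).
Context (f_reflect : forall i (x : 'rV[R]_n.+1) (z : 'rV[R]_m.+1)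
                    (p : 'rV[R]_n.+1) (y1 : R),
   Omega x -> closure Omega (set_first y1 x) ->
   p 0 0 <= 0 -> x 0 0 <= 0 -> x 0 0 <= y1 <= - x 0 0 ->
   f i x z p <= f i (set_first y1 x) z (negate_first p)).
Context (u : 'I_m.+1 -> 'rV[R]_n.+1 -> R).
Context (u_C2 : forall i, C2_closure Omega (u i)).
Context (u_convex : forall i, strictly_convex_in Omega (u i)).
Context (u_eq : forall i (x : 'rV[R]_n.+1), Omega x ->
   \det (hessian (u i) x) = f i x (\row_j u j x) (grad (u i) x)).
Context (u_bi : forall i (x y : 'rV[R]_n.+1),
   Omega x -> boundary Omega y -> y 0 0 < x 0 0 -> u i x < u i y).
Context (u_bb : forall i (x y : 'rV[R]_n.+1),
   boundary Omega x -> boundary Omega y -> y 0 0 < x 0 0 -> u i x <= u i y).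
Implicit Types (x y z p q : 'rV[R]_n.+1) (i j : 'I_m.+1) (l : R).

Let Lambda := Lambda_0 Omega.

Let u2 i : C2_on Omega (u i). Proof. by have [] := u_C2 i. Qed.

(** All components at once: the sign of the coupling can be exploited for one [i] only when every
    [w_l^j] is nonnegative. *)
Definition ge_reflection l := forall i x, Omega x -> x 0 0 < l ->
  u i (reflect_at l x) <= u i x.

Definition gt_reflection l := forall i x, Omega x -> x 0 0 < l ->
  u i (reflect_at l x) < u i x.

Let elliptic i : exists mu K c : R, [/\ 0 < mu, 0 < K, 0 < c,
  forall x d, Omega x ->
    mu * dotp d d <= qform (hessian (u i) x) d <= K * dotp d d &
  forall x, Omega x -> c <= \det (hessian (u i) x)].
Proof.
have [c c0 fc] := f_positive i.
have det_c x : Omega x -> c <= \det (hessian (u i) x).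
  by move=> Ox; rewrite u_eq //; exact: fc.
have [mu [K [mu0 K0 H]]] := hessian_elliptic oO bO (u_C2 i) (u_convex i) c0 det_c.
by exists mu, K, c.
Qed.

Let hessian00_ge i : exists2 mu : R, 0 < mu &
  forall x, Omega x -> mu <= hessian (u i) x 0 0.
Proof.
have [mu [K [c [mu0 _ _ H _]]]] := elliptic i; exists mu => // x Ox.
have /andP[+ _] := H x (basis_vec 0) Ox.
by rewrite dotp_basis [basis_vec 0 0 0]mxE !eqxx mulr1 qform_delta.
Qed.

Let refl_in l x : l <= Lambda -> Omega x -> x 0 0 < l -> Omega (reflect_at l x).
Proof. exact: reflection_in. Qed.

Lemma partial_e1_neg l i x : l <= Lambda -> ge_reflection l -> Omega x ->
  x 0 0 < l -> partial 0 (u i) x < 0.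
Proof.
move=> lL wl Ox xl; have [mu mu0 umu] := hessian00_ge i.
apply: (partial_e1_lt0 (u2 i) mu0 umu (l := 2 * (l - x 0 0))).
- by rewrite mulr_gt0 // subr_gt0.
- move=> t /andP[t0 tl]; apply: segment_to_reflection => //; rewrite -/Lambda; lra.
- by rewrite -reflect_atE; exact: wl.
Qed.

Let solution_bound : exists2 M : R, 0 < M & forall x, Omega x ->
  `|\row_j u j x| <= M /\ forall i, `|grad (u i) x| <= M.
Proof.
have /choice[M MP] i : exists M : R, 0 < M /\ forall x, Omega x ->
    `|u i x| <= M /\ `|grad (u i) x| <= M.
  have [M M0 H] := C2_closure_bounded bO (u_C2 i); exists M; split => // x Ox.
  by have [] := H x Ox.
have le_max i : M i <= \big[Num.max/1]_j M j by exact: le_bigmax.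
have max0 : 0 < \big[Num.max/1]_j M j.
  by apply: lt_le_trans (le_max 0); have [] := MP 0.
exists (\big[Num.max/1]_j M j) => // x Ox; split.
  apply: norm_le_coord => [|j]; first exact: ltW.
  by rewrite mxE; apply: le_trans (le_max j); have [_ /(_ x Ox)[]] := MP j.
by move=> i; apply: le_trans (le_max i); have [_ /(_ x Ox)[]] := MP i.
Qed.

(** [L] comes from global bounds on the solution and does not depend on [l]. The reflection
    hypothesis, with [y1 = 2 * l - x 0 0 <= - x 0 0] because [l <= 0], first moves the point to
    [reflect_at l x]; only then are the arguments [z] and [p] compared, at a fixed point. *)
Let det_difference i : exists2 L : R, 0 <= L & forall l, l <= Lambda ->
  ge_reflection l -> forall x, Omega x -> Omega (reflect_at l x) -> x 0 0 < l ->
  \det (hessian (u i) x) - \det (hessian (u i) (reflect_at l x)) <=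
  L * (u i x - u i (reflect_at l x)) +
  L * `|negate_first (grad (u i) x) - grad (u i) (reflect_at l x)|.
Proof.
have [M M0 HM] := solution_bound.
have [L L0 HL] := rhs_lipschitz bO M0 (f_split i) (@f_coupling i) (@f_lipschitz_p i).
exists L => // l lL wl x Ox Ox' xl.
have p0 := partial_e1_neg i lL wl Ox xl.
have l0 : l <= 0 := le_trans lL Lambda_le0.
have [zM gM] := HM x Ox; have [zM' gM'] := HM _ Ox'.
rewrite [X in X - _ <= _](u_eq i Ox) [X in _ - X <= _](u_eq i Ox').
have refl : f i x (\row_j u j x) (grad (u i) x) <=
    f i (reflect_at l x) (\row_j u j x) (negate_first (grad (u i) x)).
  apply: f_reflect => //; first exact: subset_closure.
  - by rewrite mxE ltW.
  - by rewrite (le_trans (ltW xl)).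
  - apply/andP; split; lra.
apply: le_trans (lerB refl (lexx _)) _.
have -> : u i x = (\row_j u j x) 0 i by rewrite mxE.
have -> : u i (reflect_at l x) = (\row_j u j (reflect_at l x)) 0 i by rewrite mxE.
apply: HL => //.
  apply: norm_le_coord => [|j]; first exact: ltW.
  apply: le_trans (gM i); apply: le_trans (coord_le_norm (grad (u i) x) j).
  by rewrite !mxE; case: eqP => [->|_]; rewrite ?normrN.
by move=> j; rewrite !mxE; exact: wl.
Qed.

Lemma segment_positive l i x (a : R) : l <= Lambda -> ge_reflection l -> 0 <= a ->
  (forall t, 0 <= t <= a -> cap Omega l (x + t *: basis_vec 0)) ->
  u i (reflect_at l x) < u i x ->
  u i (reflect_at l (x + a *: basis_vec 0)) < u i (x + a *: basis_vec 0).
Proof.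
move=> lL wl a0 seg wx.
have [mu [K [c [mu0 K0 c0 ell_u det_u]]]] := elliptic i.
have [L L0 HL] := det_difference i.
have wli y : Omega y -> Omega (reflect_at l y) -> y 0 0 < l ->
    u i (reflect_at l y) <= u i y by move=> Oy _; exact: wl.
have one1 : (1 : R) ^+ 2 = 1 by rewrite expr1n.
have := propagate_segment oO bO (u2 i) mu0 K0 c0 L0 ell_u det_u wli (HL l lL wl)
  (fun y => refl_in lL) (k := 0) one1 a0.
by rewrite scale1r; apply.
Qed.

Lemma box_zero l i p q : l <= Lambda -> ge_reflection l ->
  (forall x, (forall j : 'I_n.+1, p 0 j <= x 0 j <= q 0 j \/ q 0 j <= x 0 j <= p 0 j) ->
     cap Omega l x) ->
  u i (reflect_at l p) = u i p -> u i (reflect_at l q) = u i q.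
Proof.
move=> lL wl box wp; have [Oq ql] : cap Omega l q.
  by apply: box => j; case: (leP (p 0 j) (q 0 j)) => pq; [left|right];
    rewrite lexx ?andbT ?pq ?ltW.
apply/eqP; rewrite eq_le wl //= leNgt; apply/negP => wq.
have [mu [K [c [mu0 K0 c0 ell_u det_u]]]] := elliptic i.
have [L L0 HL] := det_difference i.
have wli y : Omega y -> Omega (reflect_at l y) -> y 0 0 < l ->
    u i (reflect_at l y) <= u i y by move=> Oy _; exact: wl.
have := box_positive oO bO (u2 i) mu0 K0 c0 L0 ell_u det_u wli (HL l lL wl)
  (fun y => refl_in lL) box wq.
by rewrite wp ltxx.
Qed.

Lemma hopf_zero l i x (r : R) : l <= Lambda -> ge_reflection l -> Omega x ->
  x 0 0 = l -> 0 < r -> 0 <= partial 0 (u i) x ->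
  exists y, [/\ cap Omega l y, `|y - x| < r & u i (reflect_at l y) = u i y].
Proof.
move=> lL wl Ox xl r0 p0; apply: contrapT => no.
have [mu [K [c [mu0 K0 c0 ell_u det_u]]]] := elliptic i.
have [L L0 HL] := det_difference i.
have wli y : Omega y -> Omega (reflect_at l y) -> y 0 0 < l ->
    u i (reflect_at l y) <= u i y by move=> Oy _; exact: wl.
suff : partial 0 (u i) x < 0 by rewrite ltNge p0.
apply: (hopf_at_plane oO bO (u2 i) mu0 K0 c0 L0 ell_u det_u wli (HL l lL wl) Ox xl r0).
move=> y [Oy yl] yx; rewrite lt_neqAle wl // andbT; apply/eqP => wy.
by apply: no; exists y.
Qed.

(** A zero of [w_l] at [x] forces zeros at all points to its left on the same line, since positivity
    there would propagate to [x]. These zeros accumulate at the boundary point [y], which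
    [no_boundary_cluster] forbids. *)
Lemma gt_reflectionW l : l < Lambda -> ge_reflection l -> gt_reflection l.
Proof.
move=> lL wl i x Ox xl; rewrite lt_neqAle wl // andbT; apply/eqP => wx.
have [mu mu0 umu] := hessian00_ge i.
pose S := [set s : R | 0 <= s /\ Omega (x + (- s) *: basis_vec 0)].
have [M [Mr OM]] := bO.
have supS : has_sup S.
  split; first by exists 0; rewrite /S /= oppr0 scale0r addr0.
  exists (`|x 0 0| + (M + 1)) => s [s0 /(OM (M + 1))].
  have MM : M < M + 1 by rewrite ltrDl.
  move=> /(_ MM) /= /(le_trans (coord_le_norm _ 0)); rewrite first_coord_add.
  by rewrite ler_norml; have := ler_norm (x 0 0); lra.
have S0 s : S s -> s <= sup S by apply: ub_le_sup; case: supS.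
pose y := x + (- sup S) *: basis_vec 0.
have nOy : ~ Omega y.
  move=> Oy; have [r r0 rO] := line_in_open (- basis_vec 0) oO Oy.
  have r2 : 0 < r / 2 by rewrite divr_gt0.
  have sup0 : 0 <= sup S by apply: S0; rewrite /S /= oppr0 scale0r addr0.
  have : sup S + r / 2 <= sup S.
    apply: S0; split; first by rewrite addr_ge0 // ltW.
    have := rO (r / 2); rewrite gtr0_norm // ltr_pdivrMr // ltr_pMr ?ltr1n //.
    move=> /(_ isT); rewrite /y scalerN -scaleNr -addrA -scalerDl.
    by congr (Omega (_ + _ *: _)); ring.
  by rewrite gerDl leNgt r2.
have [cu _ _ _] := u_C2 i.
apply: (no_boundary_cluster oO bO O0 bdC2 cO (u2 i) mu0 umu cu (u_bi i) (u_bb i) lL nOy).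
move=> d d0; have [s [s0 Os] sS] := sup_adherent d0 supS.
exists l, (x + (- s) *: basis_vec 0); split => //.
- by rewrite subrr normr0.
- have -> : x + (- s) *: basis_vec 0 - y = (sup S - s) *: basis_vec 0.
    by rewrite /y opprD addrACA subrr add0r -scaleNr -scalerDl opprK addrC.
  have sle : s <= sup S by apply: S0.
  by rewrite normrZ norm_delta_mx mulr1 ger0_norm ?subr_ge0 //; lra.
- by rewrite first_coord_add; lra.
rewrite leNgt; apply/negP => ws.
have := segment_positive (ltW lL) wl s0 _ ws.
have -> : x + - s *: basis_vec 0 + s *: basis_vec 0 = x.
  by rewrite -addrA -scalerDl addNr scale0r addr0.
rewrite wx ltxx => H; suff : false by []; apply: H => t /andP[t0 ts].
have -> : x + - s *: basis_vec 0 + t *: basis_vec 0 = x + (t - s) *: basis_vec 0.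
  by rewrite -addrA -scalerDl [- s + t]addrC.
split; last by rewrite first_coord_add; lra.
have := @segment_e1 R n Omega (x + - s *: basis_vec 0) t s cO Os.
rewrite -!addrA -!scalerDl addNr scale0r addr0 [- s + t]addrC; apply => //.
by rewrite t0.
Qed.

Lemma ge_reflection_limit l : l <= Lambda ->
  (forall l', l' < l -> gt_reflection l') -> ge_reflection l.
Proof.
move=> lL H i x Ox xl; rewrite leNgt; apply/negP => wx.
have Ox' := refl_in lL Ox xl; have [cu _ _] := u2 i.
have [|d d0 dP] := continuous_at_dist (e := u i (reflect_at l x) - u i x) (cu _ Ox').
  by rewrite subr_gt0.
have d2 : 0 < d / 2 by rewrite divr_gt0.
have lx : 0 < l - x 0 0 by rewrite subr_gt0.
have [s s0 /andP[sd sx]] := exists_small d2 lx.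
have := H (l - s) _ i x Ox; rewrite gtrBl => /(_ s0) wls.
have {}wls : u i (reflect_at (l - s) x) < u i x by apply: wls; lra.
have : `|reflect_at (l - s) x - reflect_at l x| < d.
  apply: le_lt_trans (reflect_at_dist2 _ _ _ _) _.
  have -> : l - s - l = - s by ring.
  by rewrite subrr normr0 addr0 normrN gtr0_norm //; lra.
by move=> /dP /ltr_normlP[h _]; lra.
Qed.

(** Failures at positions decreasing to [l] would cluster at some [y]. The boundary is excluded by
    [no_boundary_cluster], the open cap by strict positivity and continuity, and the plane by Hopf:
    there [u i] decreases along short segments in direction [e_1], hence from a point to its
    reflection. *)
Lemma gt_reflection_right l i : l < Lambda -> ge_reflection l ->
  exists2 d : R, 0 < d & forall l', l < l' < l + d -> forall x, Omega x -> x 0 0 < l' ->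
    u i (reflect_at l' x) < u i x.
Proof.
move=> lL wl; have wl' := gt_reflectionW lL wl.
apply: contrapT => no; have [mu mu0 umu] := hessian00_ge i.
have [||y yP] := @bounded_cluster R n.+1 Omega (fun d x => exists l' : R,
  [/\ l < l' < l + d, x 0 0 < l' & u i x <= u i (reflect_at l' x)]) bO.
- move=> d d0; apply: contrapT => H; apply: no; exists d => // l' ll' x Ox xl'.
  by rewrite ltNge; apply/negP => wx; apply: H; exists x => //; exists l'.
- move=> d d' x dd' [l' [/andP[l1 l2] xl' wx]]; exists l'; split => //.
  by rewrite l1 (lt_le_trans l2) // lerD2l.
have [cu _ _ _] := u_C2 i; have [cu' _ _] := u2 i.
have [Oy|nOy] := pselect (Omega y); last first.
  apply: (no_boundary_cluster oO bO O0 bdC2 cO (u2 i) mu0 umu cu (u_bi i) (u_bb i) lL nOy).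
  move=> d d0; have [x [Ox xy [l' [/andP[l1 l2] xl' wx]]]] := yP d d0.
  by exists l', x; split => //; rewrite gtr0_norm ?subr_gt0 // ltrBlDl.
have yl : y 0 0 <= l.
  apply/ler_addgt0Pl => e e0; have e2 : 0 < e / 2 by rewrite divr_gt0.
  have [x [Ox xy [l' [/andP[l1 l2] xl' _]]]] := yP _ e2.
  have := le_lt_trans (first_coord_dist x y) xy.
  by rewrite ltr_norml => /andP[? ?]; lra.
move: yl; rewrite le_eqVlt => /orP[/eqP yl|yl]; last first.
  have Oy' := refl_in (ltW lL) Oy yl.
  have gap : 0 < (u i y - u i (reflect_at l y)) / 2.
    by rewrite divr_gt0 // subr_gt0; exact: wl'.
  have [d1 d10 H1] := continuous_at_dist (cu' _ Oy) gap.
  have [d2 d20 H2] := continuous_at_dist (cu' _ Oy') gap.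
  have d23 : 0 < d2 / 3 by rewrite divr_gt0.
  have [d d0 /andP[dd1 dd2]] := exists_small d10 d23.
  have [x [Ox xy [l' [/andP[l1 l2] xl' wx]]]] := yP _ d0.
  have /ltr_normlP[h1 _] := H1 _ (lt_trans xy dd1).
  have : `|reflect_at l' x - reflect_at l y| < d2.
    apply: le_lt_trans (reflect_at_dist2 _ _ _ _) _.
    by rewrite gtr0_norm ?subr_gt0 //; lra.
  by move=> /H2 /ltr_normlP[_ h2]; lra.
have neg : partial 0 (u i) y < 0.
  rewrite ltNge; apply/negP => p0.
  have [z [[Oz zl] _ wz]] := hopf_zero (ltW lL) wl Oy yl ltr01 p0.
  by have := wl' i z Oz zl; rewrite wz ltxx.
have [_ /(_ 0 _ Oy)[_ cp] _] := u2 i.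
have [|d1 d10 H1] := continuous_at_dist (e := - partial 0 (u i) y) cp.
  by rewrite oppr_gt0.
have [r1 r10 rO] := open_dist oO Oy.
have [r r0 /andP[rd rr]] := exists_small d10 r10.
(* The segment from [x] to its reflection is shorter than [4 * r / 5], hence stays within [r] of
   [y]. *)
have r5 : 0 < r / 5 by rewrite divr_gt0.
have [x [Ox xy [l' [/andP[l1 l2] xl' wx]]]] := yP _ r5.
pose T := 2 * (l' - x 0 0).
have T0 : 0 < T by rewrite mulr_gt0 // subr_gt0.
have inball t : 0 <= t <= T -> `|x + t *: basis_vec 0 - y| < r.
  move=> /andP[t0 tT]; rewrite addrAC (le_lt_trans (ler_normD _ _)) //.
  rewrite normrZ norm_delta_mx mulr1 ger0_norm //.
  have := le_lt_trans (first_coord_dist x y) xy; rewrite ltr_norml => /andP[x1 x2].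
  by rewrite /T in tT; lra.
have [|c cT E] := @mean_value R (fun t => u i (x + t *: basis_vec 0))
    (fun t => partial 0 (u i) (x + t *: basis_vec 0)) 0 T (ltW T0).
  by move=> t tT; apply: is_derive_e1 (u2 i) _ _ _; apply/rO/(lt_trans (inball t tT)).
have pc : partial 0 (u i) (x + c *: basis_vec 0) < 0.
  by have /ltr_normlP[] := H1 _ (lt_trans (inball c cT) rd); lra.
have : partial 0 (u i) (x + c *: basis_vec 0) * (T - 0) < 0.
  by rewrite subr0 pmulr_llt0.
by rewrite -E scale0r addr0 -reflect_atE subr_lt0 ltNge wx.
Qed.

(** Truncating the set of positions at [l] keeps its supremum strictly below [Lambda], where the
    plane can still be moved to the right. *)
Lemma moving_plane l : l < Lambda -> gt_reflection l.
Proof.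
move=> lL; apply: contrapT => nl.
have ll : lambda_0 Omega < l.
  rewrite ltNge; apply/negP => ll; apply: nl => i x Ox xl.
  by have := lambda_0_lt oO bO Ox; rewrite ltNge (le_trans (ltW xl)).
pose S := [set l1 | l1 <= l /\ forall l', l' <= l1 -> gt_reflection l'].
(* The start is vacuous: up to [lambda_0] the caps are empty. *)
have Sl0 : S (lambda_0 Omega).
  split; first exact: ltW.
  move=> l' l'l i x Ox xl'; have := lambda_0_lt oO bO Ox.
  by rewrite ltNge (le_trans (ltW xl')).
have supS : has_sup S by split; [exists (lambda_0 Omega)|exists l => l1 []].
have S_le s : S s -> s <= sup S by apply: ub_le_sup; case: supS.
have supl : sup S <= l by apply: ge_sup => [|s []//]; case: supS.
have supL : sup S < Lambda := le_lt_trans supl lL.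
have below l' : l' < sup S -> gt_reflection l'.
  move=> l's; have e0 : 0 < sup S - l' by rewrite subr_gt0.
  have [s [_ sP] ss] := sup_adherent e0 supS; apply: sP.
  by rewrite subKr in ss; exact: ltW.
have wsup := ge_reflection_limit (ltW supL) below.
have gsup := gt_reflectionW supL wsup.
have /choice[d dP] i : exists d : R, 0 < d /\ forall l', sup S < l' < sup S + d ->
    forall x, Omega x -> x 0 0 < l' -> u i (reflect_at l' x) < u i x.
  by have [d d0 H] := gt_reflection_right i supL wsup; exists d.
pose dmin := \big[Num.min/1]_i d i.
have dmin0 : 0 < dmin by apply/bigmin_gtP; split => // i _; have [] := dP i.
have good l' : l' < sup S + dmin -> gt_reflection l'.
  move=> l'd; have [l's|l's] := ltP l' (sup S); first exact: below.
  have [l'e|l'ne] := eqVneq l' (sup S); first by rewrite l'e.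
  move=> i; have [_] := dP i; apply; rewrite lt_neqAle eq_sym l'ne l's /=.
  by rewrite (lt_le_trans l'd) // lerD2l; exact: bigmin_le.
have [lle|lgt] := ltP l (sup S + dmin); first exact/nl/good.
have : sup S + dmin / 2 <= sup S.
  apply: S_le; split; first by rewrite (le_trans _ lgt) // lerD2l; lra.
  by move=> l' l'le; apply: good; apply: (le_lt_trans l'le); rewrite ltrD2l; lra.
by rewrite gerDl leNgt divr_gt0.
Qed.

Lemma ge_reflection_Lambda : ge_reflection Lambda.
Proof. by apply: ge_reflection_limit => // l' /moving_plane. Qed.

(** Balls of the sup norm are cubes, so they contain the box spanned by any two of their points, and
    so do their intersections with the half-space. *)
Lemma cube_zero i z (r : R) p q :
  (forall y, `|y - z| < r -> y 0 0 < Lambda -> Omega y) ->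
  `|p - z| < r -> p 0 0 < Lambda -> `|q - z| < r -> q 0 0 < Lambda ->
  u i (reflect_at Lambda p) = u i p -> u i (reflect_at Lambda q) = u i q.
Proof.
move=> zO pz pL qz qL; apply: box_zero => //; first exact: ge_reflection_Lambda.
have r0 : 0 < r := le_lt_trans (normr_ge0 _) pz.
move=> x xpq; have xL : x 0 0 < Lambda.
  by have [/andP[_ x0]|/andP[_ x0]] := xpq 0; exact: le_lt_trans x0 _.
split => //; apply: zO => //; apply: norm_lt_coord => // j.
have := le_lt_trans (coord_le_norm (p - z) j) pz.
have := le_lt_trans (coord_le_norm (q - z) j) qz.
rewrite [(q - z) 0 j]mxE [(p - z) 0 j]mxE [(x - z) 0 j]mxE !ltr_norml.
move=> /andP[q1 q2] /andP[p1 p2].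
by have [/andP[x1 x2]|/andP[x1 x2]] := xpq j; apply/andP; split; lra.
Qed.

(** Membership of the reflected point is included, so the symmetry of the domain is propagated
    together with that of [u i]. *)
Definition locally_symmetric i x := exists2 r : R, 0 < r & forall y, `|y - x| < r ->
  [/\ Omega y, Omega (reflect_at Lambda y) & u i (reflect_at Lambda y) = u i y].

Let reflect_fix x : x 0 0 = Lambda -> reflect_at Lambda x = x.
Proof. by move=> xL; rewrite reflect_atE xL subrr mulr0 scale0r addr0. Qed.

Lemma locally_symmetric_left i z p (r : R) : 0 < r ->
  (forall y, `|y - z| < r -> cap Omega Lambda y) -> `|p - z| < r ->
  u i (reflect_at Lambda p) = u i p -> locally_symmetric i z.
Proof.
move=> r0 zO pz wp; exists r => // q qz; have [Oq qL] := zO q qz.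
have [_ pL] := zO p pz; split => //; first exact: refl_in.
by apply: (cube_zero _ pz pL qz qL wp) => y yz _; have [] := zO y yz.
Qed.

Lemma locally_symmetric_plane i z p (r : R) : 0 < r -> z 0 0 = Lambda ->
  (forall y, `|y - z| < r -> Omega y) -> `|p - z| < r -> p 0 0 < Lambda ->
  u i (reflect_at Lambda p) = u i p -> locally_symmetric i z.
Proof.
move=> r0 zL zO pz pL wp; exists r => // q qz.
have rz y : `|y - z| < r -> `|reflect_at Lambda y - z| < r.
  by move=> yz; rewrite -[z in X in X < r](reflect_fix zL) (le_lt_trans (reflect_at_dist _ _ _)).
split; [exact: zO|exact/zO/rz|].
have zO' y : `|y - z| < r -> y 0 0 < Lambda -> Omega y by move=> yz _; exact: zO.
case: (ltgtP (q 0 0) Lambda) => qL.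
- exact: cube_zero zO' pz pL qz qL wp.
- have qL' : (reflect_at Lambda q) 0 0 < Lambda by rewrite reflect_at_first; lra.
  by have := cube_zero zO' pz pL (rz _ qz) qL' wp; rewrite reflect_atK.
- by rewrite reflect_fix.
Qed.

Lemma locally_symmetric_closed i z : Omega z -> closure (locally_symmetric i) z ->
  locally_symmetric i z.
Proof.
move=> Oz /closure_distP cz.
have openC := @open_cap R n Omega oO Lambda.
case: (ltgtP (z 0 0) Lambda) => zL.
- have [r r0 rC] := open_dist openC (conj Oz zL : cap Omega Lambda z).
  have [p [s s0 sP] pz] := cz r r0.
  have [|_ _ wp] := sP p; first by rewrite subrr normr0.
  exact: locally_symmetric_left r0 rC pz wp.
- have zL' : (reflect_at Lambda z) 0 0 < Lambda by rewrite reflect_at_first; lra.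
  have dist_refl p q : `|reflect_at Lambda p - reflect_at Lambda q| <= `|p - q|.
    exact: reflect_at_dist.
  (* If the reflected point were on the boundary, the limit of the symmetric points would give [u i]
     equal values at it and at [z], against the strict boundary condition. *)
  have [Oz'|nOz'] := pselect (Omega (reflect_at Lambda z)); last first.
    have cz' : closure Omega (reflect_at Lambda z).
      apply/closure_distP => e e0; have [p [s s0 sP] pz] := cz e e0.
      have [|_ Op _] := sP p; first by rewrite subrr normr0.
      by exists (reflect_at Lambda p) => //; exact: le_lt_trans (dist_refl _ _) pz.
    have bz' : boundary Omega (reflect_at Lambda z) by apply/boundaryE.
    have zz : (reflect_at Lambda z) 0 0 < z 0 0 by exact: lt_trans zL.
    have gap : 0 < (u i (reflect_at Lambda z) - u i z) / 2.
      by rewrite divr_gt0 // subr_gt0; exact: u_bi.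
    have [cu _ _ _] := u_C2 i.
    have [d1 d10 H1] := within_continuous_dist cu (subset_closure Oz) gap.
    have [d2 d20 H2] := within_continuous_dist cu cz' gap.
    have [d d0 /andP[dd1 dd2]] := exists_small d10 d20.
    have [p [s s0 sP] pz] := cz d d0.
    have [|Op Op' wp] := sP p; first by rewrite subrr normr0.
    have /ltr_normlP[_ h1] := H1 p (subset_closure Op) (lt_trans pz dd1).
    have pz' := le_lt_trans (dist_refl p z) (lt_trans pz dd2).
    have /ltr_normlP[h2 _] := H2 _ (subset_closure Op') pz'.
    by rewrite wp in h2; lra.
  have [r r0 rC] := open_dist openC (conj Oz' zL' : cap Omega Lambda _).
  have [p [s s0 sP] pz] := cz r r0.
  have [|_ _ wp] := sP p; first by rewrite subrr normr0.
  have pz' := le_lt_trans (dist_refl p z) pz.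
  have wp' : u i (reflect_at Lambda (reflect_at Lambda p)) = u i (reflect_at Lambda p).
    by rewrite reflect_atK.
  have [r' r'0 H] := locally_symmetric_left r0 rC pz' wp'.
  exists r' => // y yz; have [|H1 H2 H3] := H (reflect_at Lambda y).
    exact: le_lt_trans (dist_refl _ _) yz.
  by rewrite reflect_atK in H2 H3; split.
have [r r0 rO] := open_dist oO Oz.
have [p [s s0 sP] pz] := cz r r0.
have [|Op Op' wp] := sP p; first by rewrite subrr normr0.
case: (ltgtP (p 0 0) Lambda) => pL.
- exact: locally_symmetric_plane r0 zL rO pz pL wp.
- apply: (locally_symmetric_plane (p := reflect_at Lambda p) r0 zL rO).
  + by rewrite -(reflect_fix zL) (le_lt_trans (reflect_at_dist _ _ _)).
  + by rewrite reflect_at_first; lra.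
  + by rewrite reflect_atK.
(* A point of the plane is its own reflection, so the equality at [p] is empty; a point slightly to
   its left, still within the symmetric neighbourhood of [p], replaces it. *)
have gap : 0 < r - `|p - z| by rewrite subr_gt0.
have [t t0 /andP[ts tr]] := exists_small s0 gap.
have pt : `|p + (- t) *: basis_vec 0 - p| = t.
  by rewrite addrC addKr normrZ norm_delta_mx mulr1 normrN gtr0_norm.
have [|_ _ wt] := sP (p + (- t) *: basis_vec 0); first by rewrite pt.
apply: (locally_symmetric_plane r0 zL rO _ _ wt).
  have -> : p + - t *: basis_vec 0 - z = (p + - t *: basis_vec 0 - p) + (p - z).
    by rewrite addrA subrK.
  by apply: le_lt_trans (ler_normD _ _) _; rewrite pt; lra.
by rewrite first_coord_add pL; lra.
Qed.

(** By Hopf, a vanishing derivative yields a zero of [w_Lambda] in the cap near [x], which starts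
    the connectedness argument. The conclusion covers all of [Omega], so the domain itself turns out
    symmetric. *)
Lemma symmetric_of_partial0 i x : Omega x -> x 0 0 = Lambda ->
  partial 0 (u i) x = 0 ->
  forall y, Omega y -> Omega (reflect_at Lambda y) /\ u i (reflect_at Lambda y) = u i y.
Proof.
move=> Ox xL px.
have sub y : locally_symmetric i y -> Omega y.
  by move=> [r r0 H]; have [|Oy _ _] := H y; first by rewrite subrr normr0.
have oS : open (locally_symmetric i).
  rewrite openE => y [r r0 H]; apply/nbhs_ballP; exists (r / 2) => /=.
    by rewrite divr_gt0.
  move=> y'; rewrite -ball_normE /ball_ /= distrC => y'y.
  exists (r / 2); first by rewrite divr_gt0.
  move=> y'' y''y'; apply: H.
  have -> : y'' - y = (y'' - y') + (y' - y) by rewrite addrA subrK.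
  by apply: le_lt_trans (ler_normD _ _) _; lra.
suff SO : locally_symmetric i = Omega.
  move=> y; rewrite -{1}SO => -[r r0 H].
  by have [|_ Oy' wy] := H y; first by rewrite subrr normr0.
apply: coO.
- have [r r0 rO] := open_dist oO Ox; exists x.
  have p0 : 0 <= partial 0 (u i) x by rewrite px.
  have [p [[Op pL] pz wp]] := hopf_zero (lexx Lambda) ge_reflection_Lambda Ox xL r0 p0.
  exact: locally_symmetric_plane r0 xL rO pz pL wp.
- exists (locally_symmetric i) => //; apply/seteqP; split => y.
    by move=> Sy; split => //; exact: sub.
  by case.
exists (closure (locally_symmetric i)); first exact: closed_closure.
apply/seteqP; split => y.
  by move=> Sy; split; [exact: sub|exact: subset_closure].
by move=> [Oy cy]; exact: locally_symmetric_closed.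
Qed.

Lemma strictly_decreasing_e1 i x (t : R) : Omega x -> Omega (set_first t x) ->
  x 0 0 < t -> t < Lambda -> u i (set_first t x) < u i x.
Proof.
move=> Ox; rewrite set_firstE => Ot xt tL.
have T0 : 0 < t - x 0 0 by rewrite subr_gt0.
have seg s : 0 <= s <= t - x 0 0 -> Omega (x + s *: basis_vec 0).
  by move=> st; exact: segment_e1 cO Ox Ot st.
have [|c cT E] := @mean_value R (fun s => u i (x + s *: basis_vec 0))
    (fun s => partial 0 (u i) (x + s *: basis_vec 0)) 0 (t - x 0 0) (ltW T0).
  by move=> s st; apply: is_derive_e1 (u2 i) _ _ _; exact: seg.
have pc : partial 0 (u i) (x + c *: basis_vec 0) < 0.
  apply: (partial_e1_neg i (lexx Lambda) ge_reflection_Lambda); first exact: seg.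
  by rewrite first_coord_add; case/andP: cT => ? ?; lra.
have : partial 0 (u i) (x + c *: basis_vec 0) * (t - x 0 0 - 0) < 0.
  by rewrite subr0 pmulr_llt0.
by rewrite -E scale0r addr0 subr_lt0.
Qed.
End MovingPlanes.

Theorem theorem3p3 (R : realType) (n m : nat)
    (Omega : set 'rV[R]_n.+1)
    (Omega_domain : domain Omega)
    (Omega_bounded : bounded_set Omega)
    (Omega_C2 : C2_boundary Omega)
    (Omega_simply_connected : simply_connected Omega)
    (Omega_convex : convex_in_e1 Omega)
    (* normalisation of the origin, implicit in hypothesis f_reflect *)
    (origin : Lambda_0 Omega <= 0)
    (f : 'I_m.+1 -> 'rV[R]_n.+1 -> 'rV[R]_m.+1 -> 'rV[R]_n.+1 -> R)
    (f_continuous : forall i, continuous_nonlinearity Omega (f i))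
    (f_positive : forall i, exists2 c : R, 0 < c &
       forall (x : 'rV[R]_n.+1) (z : 'rV[R]_m.+1) (p : 'rV[R]_n.+1),
         Omega x -> c <= f i x z p)
    (f_split : forall i,
       exists f1 f2 : 'rV[R]_n.+1 -> 'rV[R]_m.+1 -> 'rV[R]_n.+1 -> R,
       [/\ forall (x : 'rV[R]_n.+1) (z : 'rV[R]_m.+1) (p : 'rV[R]_n.+1),
             closure Omega x -> f i x z p = f1 x z p + f2 x z p,
           loc_unif_lipschitz_z Omega i f1 &
           nonincreasing_z Omega i f2])
    (f_coupling : forall i j : 'I_m.+1, j != i -> nonincreasing_z Omega j (f i))
    (f_lipschitz_p : forall i, loc_unif_lipschitz_p Omega (f i))
    (f_reflect : forall i (x : 'rV[R]_n.+1) (z : 'rV[R]_m.+1)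
                        (p : 'rV[R]_n.+1) (y1 : R),
       Omega x -> closure Omega (set_first y1 x) ->
       p 0 0 <= 0 -> x 0 0 <= 0 -> x 0 0 <= y1 <= - x 0 0 ->
       f i x z p <= f i (set_first y1 x) z (negate_first p))
    (u : 'I_m.+1 -> 'rV[R]_n.+1 -> R)
    (u_C2 : forall i, C2_closure Omega (u i))
    (u_convex : forall i, strictly_convex_in Omega (u i))
    (u_eq : forall i (x : 'rV[R]_n.+1), Omega x ->
       \det (hessian (u i) x) = f i x (\row_j u j x) (grad (u i) x))
    (u_boundary_interior : forall i (x y : 'rV[R]_n.+1),
       Omega x -> boundary Omega y -> y 0 0 < x 0 0 -> u i x < u i y)
    (u_boundary_boundary : forall i (x y : 'rV[R]_n.+1),
       boundary Omega x -> boundary Omega y -> y 0 0 < x 0 0 ->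
       u i x <= u i y) :
  forall i : 'I_m.+1,
    (forall x : 'rV[R]_n.+1, Omega x -> x 0 0 < Lambda_0 Omega ->
       u i (reflect_at (Lambda_0 Omega) x) <= u i x /\
       partial 0 (u i) x < 0) /\
    ((exists x : 'rV[R]_n.+1,
        [/\ Omega x, x 0 0 = Lambda_0 Omega & partial 0 (u i) x = 0]) ->
     [/\ (* symmetry about the hyperplane x_1 = Lambda_0 *)
         forall x : 'rV[R]_n.+1, Omega x ->
           `|x 0 0 - Lambda_0 Omega| < Lambda_0 Omega - lambda_0 Omega ->
           Omega (reflect_at (Lambda_0 Omega) x) /\
           u i (reflect_at (Lambda_0 Omega) x) = u i x,
         (* strict decrease in the direction e_1 *)
         forall (x : 'rV[R]_n.+1) (t : R), Omega x -> Omega (set_first t x) ->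
           x 0 0 < t -> t < Lambda_0 Omega -> u i (set_first t x) < u i x,
         (* u^i depends on x_1 only through |x_1 - Lambda_0| *)
         forall (x : 'rV[R]_n.+1) (t : R), Omega x -> Omega (set_first t x) ->
           `|x 0 0 - Lambda_0 Omega| < Lambda_0 Omega - lambda_0 Omega ->
           `|t - Lambda_0 Omega| = `|x 0 0 - Lambda_0 Omega| ->
           u i (set_first t x) = u i x &
         forall x : 'rV[R]_n.+1, Omega x -> x 0 0 < Lambda_0 Omega -> partial 0 (u i) x < 0]).
Proof.
have [oO coO O0] := Omega_domain.
have ge i x : Omega x -> x 0 0 < Lambda_0 Omega ->
    u i (reflect_at (Lambda_0 Omega) x) <= u i x.
  exact: (ge_reflection_Lambda oO O0 Omega_bounded Omega_C2 Omega_convex origin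
    f_positive f_split f_coupling f_lipschitz_p f_reflect u_C2 u_convex u_eq
    u_boundary_interior u_boundary_boundary).
have neg i x : Omega x -> x 0 0 < Lambda_0 Omega -> partial 0 (u i) x < 0.
  exact: (partial_e1_neg oO O0 Omega_bounded Omega_C2 Omega_convex
    f_positive u_C2 u_convex u_eq i (lexx _) ge).
move=> i; split => [x Ox xL|[x [Ox xL px]]]; first by split; [exact: ge|exact: neg].
have sym := symmetric_of_partial0 oO coO O0 Omega_bounded Omega_C2 Omega_convex origin
  f_positive f_split f_coupling f_lipschitz_p f_reflect u_C2 u_convex u_eq
  u_boundary_interior u_boundary_boundary Ox xL px.
split=> [y Oy _|y t Oy Ot yt tL|y t Oy Ot _ ty|y Oy yL].
- exact: sym.
- exact: (strictly_decreasing_e1 oO O0 Omega_bounded Omega_C2 Omega_convex origin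
    f_positive f_split f_coupling f_lipschitz_p f_reflect u_C2 u_convex u_eq
    u_boundary_interior u_boundary_boundary i Oy Ot yt tL).
- have /eqP := ty; rewrite eqr_norm2 (inj_eq (addIr _)) => /orP[/eqP ty0|/eqP tyN].
    by rewrite set_firstE ty0 subrr scale0r addr0.
  have -> : set_first t y = reflect_at (Lambda_0 Omega) y.
    by rewrite /reflect_at; congr set_first; lra.
  by have [] := sym y Oy.
- exact: neg.
Qed.
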